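(* Let $(M,g)$ be a pseudo-Riemannian manifold of dimension $n\ge 3$. Let $Q_{2N}$ denote the $Q$-curvatures of $g$, let $\mathcal{M}_{2N}$ and $W_{2N}$ denote the second-order differential operators and scalar invariants on $M$ defined from the Poincaré metric of $g$, and let $n_I$ be the constants, all as defined in the context. Then for every integer $N\ge 1$ (and $N\le n/2$ if $n$ is even), $$(-1)^NQ_{2N}=\sum_{|(I,a)|=N} n_{(I,a)}\,a!\,(a-1)!\,2^{2a}\,\mathcal{M}_{2I}(W_{2a}),$$ where the sum is over all compositions $(I,a)$ of $N$ with last entry $a\geq 1$, $I$ being allowed to be empty.
   Context: Setting. $g$ is a pseudo-Riemannian metric of signature $(p,q)$, $p+q=n\ge 3$, on an $n$-dimensional manifold $M$. A Poincaré metric in normal form relative to $g$ is a metric on $M\times(0,\epsilon)$ of the form $g_+=r^{-2}(dr^2+h_r)$, where $h_r$ is a smooth 1-parameter family of metrics on $M$ with $h_0=g$, for which $\mathrm{Ric}(g_+)+ng_+=0$ asymptotically at $r=0$: if $n$ is odd, $\mathrm{Ric}(g_+)+ng_+=O(r^\infty)$; if $n$ is even, $\mathrm{Ric}(g_+)+ng_+=O(r^{n-2})$ and the tangential trace of $r^{2-n}(\mathrm{Ric}(g_+)+ng_+)$ vanishes at $r=0$. The family $h_r$ is even in $r$, in the sense that $h_r=g_\rho$ with $\rho=-r^2/2$ for a smooth 1-parameter family $g_\rho$ of metrics on $M$, $\rho\in(-\epsilon,\epsilon)$, $g_0=g$. The quantities defined below are independent of the remaining choices. Operators $\mathcal{M}_{2N}$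 and invariants $W_{2N}$. Set $V(r)=\sqrt{\det h_r/\det h_0}$ and $W(r)=\sqrt{V(r)}$. Let $\delta\varphi=\nabla_i\varphi^i$ be the divergence on vector fields with respect to $g$, so $\delta(h_r^{-1}df)=\nabla_i(h_r^{ij}\partial_j f)$. Define $$\mathcal{M}(r)=\delta(h_r^{-1}d)-U(r),\qquad U(r)=\frac{[\partial_r^2-(n-1)r^{-1}\partial_r+\delta(h_r^{-1}d)]W(r)}{W(r)},$$ where $U(r)$ acts as a zeroth order (multiplication) term. The operators $\mathcal{M}_{2N}$ and the functions $W_{2N}$ on $M$, for $N\ge1$ (and $N\le n/2$ if $n$ is even), are defined by the Taylor expansions at $r=0$ $$\mathcal{M}(r)=\sum_{N\ge1}\mathcal{M}_{2N}\frac{1}{(N-1)!^2}\left(\frac{r^2}{4}\right)^{N-1},\qquad W(r)=1+\sum_{N\ge1}W_{2N}r^{2N}.$$ GJMS operators. Let $\widetilde g=2\rho\,dt^2+2t\,dt\,d\rho+t^2g_\rho$ on $\mathbb{R}_+\times M\times(-\epsilon,\epsilon)$ (coordinates $t,x,\rho$), with Laplacian $\widetilde\Delta$ (sign: trace of the Hessian). For $N\ge1$ (and $N\le n/2$ if $n$ is even), $P_{2N}f=\widetilde\Delta^N(t^{N-n/2}\widetilde f)|_{\rho=0,\,t=1}$, where $f\in C^\infty(M)$ and $\widetilde f\in C^\infty(M\times(-\epsilon,\epsilon))$ is any function with $\widetilde f(x,0)=f(x)$; the result is independent of the choice of $\widetilde f$. With this convention $P_{2N}=\Delta^N+\cdots$,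 where $\Delta=\delta(g^{-1}d)$. $Q$-curvatures. For $N\ge1$ (and $N\le n/2$ if $n$ is even), $Q_{2N}$ is defined by $P_{2N}(1)=(-1)^N\left(\frac n2-N\right)Q_{2N}$ when $N\ne n/2$. When $n$ is even and $N=n/2$, $Q_n$ is defined by analytic continuation in the dimension (removing the factor $n/2-N$); equivalently, $(-1)^{n/2}Q_n=-\widetilde\Delta^{n/2}(\log t)|_{\rho=0,\,t=1}$. Compositions and constants. A composition is an ordered list $I=(I_1,\ldots,I_r)$ of positive integers, with $|I|=I_1+\cdots+I_r$. When a composition is written $(I,a)$, $a>0$ is its last entry and $I$ is allowed to be empty. Set $\mathcal{M}_{2I}=\mathcal{M}_{2I_1}\circ\cdots\circ\mathcal{M}_{2I_r}$ (the identity if $I$ is empty) and $$n_I=(|I|-1)!^2\prod_{j=1}^r\frac{1}{(I_j-1)!^2}\prod_{j=1}^{r-1}\frac{1}{\left(\sum_{k=1}^jI_k\right)\left(\sum_{k=j+1}^rI_k\right)}.$$ Empty products equal 1. Notation: $k!^2=(k!)^2$. *)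

(* Defs.v *)
From HB Require Import structures.
From mathcomp Require Import all_boot all_order all_algebra.
From mathcomp Require Import all_classical all_reals all_analysis.

Set Implicit Arguments.
Unset Strict Implicit.
Unset Printing Implicit Defensive.

Import Order.TTheory GRing.Theory Num.Theory.
Import numFieldNormedType.Exports.

Local Open Scope classical_set_scope.
Local Open Scope ring_scope.

Section Smooth.
Variables (R : realType) (m : nat).

Definition partial (i : 'I_m) (u : 'rV[R]_m -> R) (x : 'rV[R]_m) : R :=
  'D_(delta_mx 0 i) u x.

Fixpoint Ck (k : nat) (A : set 'rV[R]_m) (u : 'rV[R]_m -> R) : Prop :=
  (forall x, A x -> {for x, continuous u}) /\
  (if k is k'.+1 then forall i : 'I_m,
     (forall x, A x -> derivable u x (delta_mx 0 i)) /\ Ck k' A (partial i u)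
   else True).

(* Intended for open A. *)
Definition smooth_on (A : set 'rV[R]_m) (u : 'rV[R]_m -> R) : Prop :=
  forall k, Ck k A u.

End Smooth.

(* Tensor calculus in coordinates: a metric on an open subset of R^m is given
   by its matrix of components. *)
Section LocalMetric.
Variables (R : realType) (m : nat).
Implicit Types (g : 'rV[R]_m -> 'M[R]_m) (x : 'rV[R]_m) (u : 'rV[R]_m -> R).

(* christoffel g k i j is Gamma^k_{ij}, with k the upper index *)
Definition christoffel g (k i j : 'I_m) x : R :=
  2^-1 * \sum_l invmx (g x) k l *
    (partial i (fun y => g y j l) x + partial j (fun y => g y i l) x
     - partial l (fun y => g y i j) x).

(* Sign convention: the round sphere has positive Ricci curvature. *)
Definition ricci g x : 'M[R]_m := \matrix_(i, j)
  \sum_k (partial k (christoffel g k i j) x - partial j (christoffel g k i k) x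
    + \sum_l (christoffel g k k l x * christoffel g l i j x
              - christoffel g k j l x * christoffel g l i k x)).

(* nabla_i phi^i *)
Definition divergence g (phi : 'I_m -> 'rV[R]_m -> R) x : R :=
  \sum_i (partial i (phi i) x + \sum_k christoffel g i i k x * phi k x).

(* trace of the Hessian nabla^2 u *)
Definition laplacian g u x : R :=
  \sum_i \sum_j invmx (g x) i j *
    (partial i (partial j u) x - \sum_k christoffel g k i j x * partial k u x).

(* delta (h^{-1} d u), the divergence delta being that of g *)
Definition div_grad g (h : 'rV[R]_m -> 'M[R]_m) u x : R :=
  divergence g (fun i y => \sum_j invmx (h y) i j * partial j u y) x.

Definition has_signature (p q : nat) (A : 'M[R]_m) : Prop :=
  (p + q)%N = m /\
  exists2 S : 'M[R]_m, S \in unitmx &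
    S^T *m A *m S = diag_mx (\row_(i < m) (if (i < p)%N then 1 else -1)).

End LocalMetric.

(* The coefficient of r^k in the Taylor expansion at r = 0.  The derivatives are
   taken as limits at 0+ because the expanded functions may be given by formulas
   with a removable singularity at r = 0 (the term r^{-1} d/dr of U(r)). *)
Definition taylor_coef (R : realType) (u : R -> R) (k : nat) : R :=
  lim (derive1n k u r @[r --> 0^'+]) / k`!%:R.

(* The constructions attached to a metric g and a family rho |-> gr rho of
   metrics on an open subset of R^n. *)
Section LocalConstructions.
Variables (R : realType) (n : nat).
Variables (g : 'rV[R]_n -> 'M[R]_n) (gr : R -> 'rV[R]_n -> 'M[R]_n).

Definition hfam (r : R) : 'rV[R]_n -> 'M[R]_n := gr (- r ^+ 2 / 2).

(* g_+ = r^{-2} (dr^2 + h_r) in the coordinates (x, r) *)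
Definition gplus (z : 'rV[R]_(n + 1)) : 'M[R]_(n + 1) :=
  let x := lsubmx z in let r := rsubmx z 0 0 in
  r ^- 2 *: block_mx (hfam r x) 0 0 1%:M.

Definition einstein_defect (x : 'rV[R]_n) (r : R) : 'M[R]_(n + 1) :=
  let z := row_mx x r%:M in ricci gplus z + n%:R *: gplus z.

(* Ric(g_+) + n g_+ = O(r^k), locally uniformly in x *)
Definition einstein_to_order (D : set 'rV[R]_n) (k : nat) : Prop :=
  forall x, D x -> forall i j, exists C : R,
    \forall y \near x & r \near 0^'+, `|einstein_defect y r i j| <= C * r ^+ k.

Definition tangential_trace (x : 'rV[R]_n) (r : R) : R :=
  \sum_i \sum_j invmx (g x) i j * ulsubmx (einstein_defect x r) i j.

Definition asymptotically_einstein (D : set 'rV[R]_n) : Prop :=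
  if odd n then forall k, einstein_to_order D k
  else einstein_to_order D (n - 2) /\
       (forall x, D x ->
         r ^- (n - 2) * tangential_trace x r @[r --> 0^'+] --> 0).

Definition Vfun (r : R) (x : 'rV[R]_n) : R :=
  Num.sqrt (\det (hfam r x) / \det (hfam 0 x)).

Definition Wfun (r : R) (x : 'rV[R]_n) : R := Num.sqrt (Vfun r x).

Definition Ufun (r : R) (x : 'rV[R]_n) : R :=
  (derive1n 2 (fun s => Wfun s x) r
   - (n%:R - 1) * r^-1 * derive1 (fun s => Wfun s x) r
   + div_grad g (hfam r) (Wfun r) x) / Wfun r x.

Definition Mop (r : R) (u : 'rV[R]_n -> R) (x : 'rV[R]_n) : R :=
  div_grad g (hfam r) u x - Ufun r x * u x.

Definition W2_loc (N : nat) (x : 'rV[R]_n) : R :=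
  taylor_coef (fun r => Wfun r x) N.*2.

Definition M2_loc (N : nat) (u : 'rV[R]_n -> R) (x : 'rV[R]_n) : R :=
  (N.-1)`!%:R ^+ 2 * 4 ^+ N.-1 * taylor_coef (fun r => Mop r u x) N.-1.*2.

(* Coordinates (t, x, rho) on the ambient space. *)
Definition amb_t (z : 'rV[R]_(1 + (n + 1))) : R := lsubmx z 0 0.
Definition amb_x (z : 'rV[R]_(1 + (n + 1))) : 'rV[R]_n := lsubmx (rsubmx z).
Definition amb_rho (z : 'rV[R]_(1 + (n + 1))) : R := rsubmx (rsubmx z) 0 0.
Definition amb_pt (t : R) (x : 'rV[R]_n) (rho : R) : 'rV[R]_(1 + (n + 1)) :=
  row_mx t%:M (row_mx x rho%:M).

(* 2 rho dt^2 + 2 t dt drho + t^2 g_rho *)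
Definition gtilde (z : 'rV[R]_(1 + (n + 1))) : 'M[R]_(1 + (n + 1)) :=
  let t := amb_t z in
  block_mx (2 * amb_rho z)%:M     (row_mx 0 t%:M)
           (col_mx 0 t%:M)        (block_mx (t ^+ 2 *: gr (amb_rho z) (amb_x z)) 0
                                            0 0).

Definition amb_power (N : nat) (u : 'rV[R]_(1 + (n + 1)) -> R) (x : 'rV[R]_n) : R :=
  iter N (laplacian gtilde) u (amb_pt 1 x 0).

(* P_{2N} f does not depend on the extension of f off rho = 0; the extension used
   here is the one that is constant in rho. *)
Definition P2_loc (N : nat) (f : 'rV[R]_n -> R) : 'rV[R]_n -> R :=
  amb_power N (fun z => amb_t z `^ (N%:R - n%:R / 2) * f (amb_x z)).

Definition Q2_loc (N : nat) (x : 'rV[R]_n) : R :=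
  if N.*2 == n then (-1) ^+ N * (- amb_power N (fun z => ln (amb_t z)) x)
  else (-1) ^+ N * P2_loc N (fun=> 1) x / (n%:R / 2 - N%:R).

End LocalConstructions.

Record chart (R : realType) (n : nat) (M : topologicalType) := Chart {
  cdom : set M ;
  cmap : M -> 'rV[R]_n ;
  cinv : 'rV[R]_n -> M ;
  cdom_open : open cdom ;
  cimg_open : open (cmap @` cdom) ;
  cmapK : forall x, cdom x -> cinv (cmap x) = x ;
  cmap_continuous : {in cdom, continuous cmap} ;
  cinv_continuous : {in cmap @` cdom, continuous cinv} }.

Definition cimg R n (M : topologicalType) (c : chart R n M) : set 'rV[R]_n :=
  cmap c @` cdom c.

(* c's coordinates to d's coordinates, on the image of the overlap *)
Definition transition R n (M : topologicalType) (c d : chart R n M) :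
  'rV[R]_n -> 'rV[R]_n := cmap d \o cinv c.
Definition overlap R n (M : topologicalType) (c d : chart R n M) :
  set 'rV[R]_n := cmap c @` (cdom c `&` cdom d).

Record manifold (R : realType) (n : nat) := Manifold {
  mcarrier :> topologicalType ;
  mindex : Type ;
  mchart : mindex -> chart R n mcarrier ;
  mhausdorff : hausdorff_space mcarrier ;
  msecond_countable : @second_countable mcarrier ;
  mcover : forall x : mcarrier, exists c, cdom (mchart c) x ;
  msmooth : forall (c d : mindex) (k : 'I_n),
    smooth_on (overlap (mchart c) (mchart d))
              (fun y => transition (mchart c) (mchart d) y 0 k) }.

(* Components of a covariant 2-tensor field in every chart of the atlas; only the
   values on the image of each chart are meaningful. *)
Definition tensor2 R n (M : manifold R n) := mindex M -> 'rV[R]_n -> 'M[R]_n.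

Section Geometry.
Variables (R : realType) (n : nat) (M : manifold R n).

(* 'J f y has the derivative of the k-th component along the i-th coordinate
   at position (i, k). *)
Definition tensorial (g : tensor2 M) : Prop :=
  forall (c d : mindex M) y, overlap (mchart c) (mchart d) y ->
    let tau := transition (mchart c) (mchart d) in
    g c y = 'J tau y *m g d (tau y) *m ('J tau y)^T.

Definition is_metric (p q : nat) (g : tensor2 M) : Prop :=
  [/\ tensorial g,
      forall c y, cimg (mchart c) y -> (g c y)^T = g c y /\ has_signature p q (g c y)
    & forall c i j, smooth_on (cimg (mchart c)) (fun y => g c y i j)].

(* A family gr of metrics, smooth jointly in (x, rho) for |rho| < eps. *)
Definition is_metric_family (p q : nat) (eps : R) (gr : R -> tensor2 M) : Prop :=
  (forall rho, `|rho| < eps -> is_metric p q (gr rho)) /\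
  (forall c i j,
    smooth_on [set z : 'rV[R]_(n + 1) |
                 cimg (mchart c) (lsubmx z) /\ `|rsubmx z 0 0| < eps]
              (fun z => gr (rsubmx z 0 0) c (lsubmx z) i j)).

(* r^{-2} (dr^2 + h_r), h_r = gr (- r^2 / 2), is a Poincare metric in normal form
   relative to g. *)
Definition poincare_normal_form (p q : nat) (g : tensor2 M) (eps : R)
    (gr : R -> tensor2 M) : Prop :=
  [/\ 0 < eps, is_metric_family p q eps gr,
      forall c y, cimg (mchart c) y -> gr 0 c y = g c y
    & forall c, asymptotically_einstein (g c) (gr^~ c) (cimg (mchart c))].

(* The invariants of (M, g) as functions and operators on functions on M, computed
   in the chart c; they are meaningful on the domain of c, where, being given by
   coordinate-invariant expressions, they do not depend on c. *)
Variables (g : tensor2 M) (gr : R -> tensor2 M) (c : mindex M).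

Definition W2 (N : nat) (x : M) : R := W2_loc (gr^~ c) N (cmap (mchart c) x).

Definition M2 (N : nat) (f : M -> R) (x : M) : R :=
  M2_loc (g c) (gr^~ c) N (f \o cinv (mchart c)) (cmap (mchart c) x).

Definition M2_comp (I : seq nat) (f : M -> R) : M -> R := foldr M2 f I.

Definition Q2 (N : nat) (x : M) : R := Q2_loc (gr^~ c) N (cmap (mchart c) x).

End Geometry.

Definition is_composition (N : nat) (I : seq nat) : bool :=
  all (leq 1) I && (sumn I == N).

Definition nI (R : realType) (I : seq nat) : R :=
  (sumn I).-1`!%:R ^+ 2 * \prod_(i <- I) (i.-1`!%:R ^+ 2)^-1
  * \prod_(1 <= j < size I) ((sumn (take j I))%:R * (sumn (drop j I))%:R)^-1.

(* Sum of F I a over the compositions (I, a) of N with last entry a: these have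
   at most N entries, each at most N, so that I has length k < N. *)
Definition sum_compositions (R : realType) (N : nat) (F : seq nat -> nat -> R) : R :=
  \sum_(k < N) \sum_(I : k.-tuple 'I_N.+1)
    \sum_(a < N.+1 | is_composition N (rcons (map val I) a)) F (map val I) a.

(* Main.v *)
(* Let w = (det g_rho / det g_0)^(1/4).  Conjugating the ambient Laplacian on
   functions of homogeneity gamma = k - n/2 by w turns it into
     R_k = - 2 rho d_rho^2 + (2 k - 2) d_rho + (delta g_rho^-1 d - U),
   whose zeroth order part in d_rho is M(r) with rho = - r^2/2, and the first
   Laplacian applied to t^(N - n/2), or to log t when N = n/2, is a multiple of
   w^-1 dw/drho.  Hence
     (-1)^N Q_2N = R_(2-N) R_(4-N) ... R_(N-2) psi at rho = 0, psi = - 2 dw/drho.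
   In the variable s = - rho/2 the coefficients of psi are a 4^a W_2a, and R_k acts
   on the coefficient sequences of functions by
     (R_k f)_j = (j+1) (j+1-k) f_(j+1) + \sum_(c <= j) M_(2c+2) f_(j-c) / c!^2.
   The relation R_k s = s R_(k-2) + (1 - k) makes R_(2-N) ... R_(N-2) R_N kill every
   multiple of s at s = 0, since \sum_(j=1)^N (1 - (2j - N)) = 0.  Solving
   R_N f = - psi degree by degree with f_0 = 0 is obstructed only in degree N - 1:
   the denominators j (N - j) met on the way and the coefficients of M(r) produce the
   constants n_(I,a), and the product of the remaining factors evaluates the
   obstruction to (N-1)!^2 times itself. *)

Require Import Defs.
From HB Require Import structures.
From mathcomp Require Import all_boot all_order all_algebra.
From mathcomp Require Import all_classical all_reals all_analysis.
From mathcomp Require Import ring lra.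

Set Implicit Arguments.
Unset Strict Implicit.
Unset Printing Implicit Defensive.

Import Order.TTheory GRing.Theory Num.Theory.
Import numFieldNormedType.Exports.

Local Open Scope classical_set_scope.
Local Open Scope ring_scope.

(** * Smooth functions on open subsets of R^m *)

(** The square of w is the ratio of the volume densities of g_rho and g_0. Conjugation by w
    therefore removes two first-order terms at once: the term (2/w) <dw, df> by which the Laplacian
    of g_rho differs from delta g_rho^-1 d, and the term - rho (d_rho log det g_rho) d_rho of the
    ambient Laplacian. Since d_rho w / w is a quarter of d_rho log det g_rho, the zeroth-order term
    proportional to gamma is absorbed as well, and one potential U serves every homogeneity. A
    Laplacian lowers the homogeneity by 2, which fixes the steps of k. R_N does not occur in the
    product for Q_2N; it is adjoined because the indices 2 - N, ..., N are then symmetric about 1,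
    the value where the commutator with s vanishes. The constants are read off as follows. M_2i is
    (i-1)!^2 times a coefficient of M(r), which accounts for (I_j-1)!^-2 in n_I; for the last entry,
    a! (a-1)! 2^(2a) / (a-1)!^2 is a 4^a, the factor in psi. A factor j (N - j) occurs for each
    proper suffix of (I, a), j being its sum and N - j the sum of the complementary prefix. *)

Lemma derive_along_line (R : realType) (V W : normedModType R) (F : V -> R)
    (G : W -> R) (x v : V) (y w : W) :
  (forall h : R, F (h *: v + x) = G (h *: w + y)) -> 'D_v F x = 'D_w G y.
Proof.
move=> FG; have FG0 : F x = G y by have := FG 0; rewrite !scale0r !add0r.
rewrite /derive.
set a := (X in lim (X @ _) = _); set b := (X in _ = lim (X @ _)).
suff -> : a = b by [].
by apply/funext => h; rewrite /a /b /= FG FG0.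
Qed.

(** Slices and coordinate projections are affine, so partial derivatives pass through them by
    equality of difference quotients; both sides are the same limit, for arbitrary [F]. *)
Lemma derive_affine (R : realType) (V W : normedModType R) (phi : V -> W)
    (F : W -> R) (x v : V) (w : W) :
  (forall h : R, phi (h *: v + x) = h *: w + phi x) ->
  'D_v (F \o phi) x = 'D_w F (phi x).
Proof. by move=> phiE; apply: derive_along_line => h; rewrite /= phiE. Qed.

Lemma derivable_affine (R : realType) (V W : normedModType R) (phi : V -> W)
    (F : W -> R) (x v : V) (w : W) :
  (forall h : R, phi (h *: v + x) = h *: w + phi x) ->
  derivable F (phi x) w -> derivable (F \o phi) x v.
Proof.
move=> phiE; rewrite /derivable.
set a := (X in cvg (X @ _) -> _); set b := (X in _ -> cvg (X @ _)).
suff -> : b = a by [].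
by apply/funext => h; rewrite /a /b /= phiE.
Qed.

(** Only a directional derivative of [u] is given, so the chain rule is applied on the line through
    [x] in direction [v], where derivability and differentiability coincide. *)
Lemma is_derive_comp1 (R : realType) (V : normedModType R) (phi : R -> R)
    (u : V -> R) (x v : V) (dphi du : R) :
  is_derive (u x) 1 phi dphi -> is_derive x v u du ->
  is_derive x v (phi \o u) (dphi * du).
Proof.
move=> [dp <-] [dv <-].
pose l (h : R) := h *: v + x.
have lE (f : V -> R) : 'D_v f x = 'D_1 (f \o l) 0.
  rewrite [RHS](@derive_affine _ _ _ l f 0 1 v); first by rewrite /l scale0r add0r.
  by move=> h; rewrite /l scale0r add0r addr0 [_%:A]mulr1.
have l0 : l 0 = x by rewrite /l scale0r add0r.
have dul : derivable (u \o l) 0 1 by exact: (derivable1P _ _ _).1.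
have dpl : derivable phi ((u \o l) 0) 1 by rewrite /= l0.
apply: DeriveDef.
  apply: (derivable1P _ _ _).2; rewrite -[X in derivable X]/(phi \o (u \o l)).
  apply/derivable1_diffP; apply: differentiable_comp.
    exact/derivable1_diffP.
  exact/derivable1_diffP.
rewrite lE (lE u) -!derive1E -[_ \o _ \o _]/(phi \o (u \o l)).
by rewrite derive1_comp //= l0 derive1E.
Qed.

Section SmoothCalculus.
Variables (R : realType) (m : nat) (A : set 'rV[R]_m).
Hypothesis Aopen : open A.
Implicit Types (u v : 'rV[R]_m -> R) (x : 'rV[R]_m) (i j : 'I_m) (k : nat).

Lemma near_open x u v : A x -> (forall y, A y -> u y = v y) ->
  \forall y \near x, u y = v y.
Proof.
move=> Ax uv; have : nbhs x A by apply: open_nbhs_nbhs.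
by apply: filterS => y; exact: uv.
Qed.

Lemma eq_partial x i u v : A x -> (forall y, A y -> u y = v y) ->
  partial i u x = partial i v x.
Proof. by move=> Ax uv; apply: near_eq_derive; exact: near_open. Qed.

Lemma near_eq_continuous x u v : A x -> (forall y, A y -> u y = v y) ->
  {for x, continuous u} -> {for x, continuous v}.
Proof.
move=> Ax uv cu; have cu' : u z @[z --> x] --> v x by rewrite -(uv _ Ax).
have e : \forall y \near x, u y = v y by exact: near_open.
exact: cvg_trans (near_eq_cvg e) cu'.
Qed.

Lemma Ck_eq k u v : (forall y, A y -> u y = v y) -> Ck k A u -> Ck k A v.
Proof.
elim: k u v => [|k IH] u v uv [cu du]; (split; [move=> x Ax|]) => //.
- exact: near_eq_continuous Ax uv (cu _ Ax).
- exact: near_eq_continuous Ax uv (cu _ Ax).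
- move=> i; have [di ci] := du i; split.
    move=> x Ax; apply: near_eq_derivable (di _ Ax).
    exact: near_open.
  apply: IH ci => y Ay; exact: eq_partial.
Qed.

Lemma smooth_eq u v : (forall y, A y -> u y = v y) ->
  smooth_on A u -> smooth_on A v.
Proof. by move=> uv su k; exact: Ck_eq (su k). Qed.

Lemma CkW k u : Ck k.+1 A u -> Ck k A u.
Proof.
elim: k u => [|k IH] u [cu du]; split => // i.
by have [di ci] := du i; split => //; exact: IH.
Qed.

Lemma Ck_continuous k u x : Ck k A u -> A x -> {for x, continuous u}.
Proof. by case: k => [|k] [cu _] Ax; exact: cu. Qed.

Lemma Ck_derivable k u x i : Ck k.+1 A u -> A x -> derivable u x (delta_mx 0 i).
Proof. by move=> [_ du] Ax; exact: (du i).1. Qed.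

Lemma smooth_continuous u x : smooth_on A u -> A x -> {for x, continuous u}.
Proof. by move=> su; exact: Ck_continuous (su 0%N). Qed.

Lemma smooth_derivable u x i : smooth_on A u -> A x ->
  derivable u x (delta_mx 0 i).
Proof. by move=> su; exact: Ck_derivable (su 1%N). Qed.

Lemma smooth_partial u i : smooth_on A u -> smooth_on A (partial i u).
Proof. by move=> su k; have [_ du] := su k.+1; exact: (du i).2. Qed.

Lemma smooth_iter_partial u i k : smooth_on A u ->
  smooth_on A (iter k (partial i) u).
Proof. by move=> su; elim: k => //= k; exact: smooth_partial. Qed.

Lemma Ck_cst k (a : R) : Ck k A (fun=> a).
Proof.
elim: k a => [|k IH] a; (split; [by move=> x _; exact: cst_continuous|]) => // i; split.
  by move=> x _; exact: derivable_cst.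
by apply: (Ck_eq _ (IH 0)) => y _; rewrite /partial derive_cst.
Qed.

Lemma CkD k u v : Ck k A u -> Ck k A v -> Ck k A (fun x => u x + v x).
Proof.
elim: k u v => [|k IH] u v cu cv; split.
- by move=> x Ax; exact: continuousD (Ck_continuous cu Ax) (Ck_continuous cv Ax).
- by [].
- by move=> x Ax; exact: continuousD (Ck_continuous cu Ax) (Ck_continuous cv Ax).
- move=> i; split.
    move=> x Ax; apply: derivableD; [exact: (Ck_derivable cu Ax)|exact: (Ck_derivable cv Ax)].
  apply: Ck_eq (IH _ _ (cu.2 i).2 (cv.2 i).2) => y Ay.
  by rewrite /partial -deriveD //; [exact: (Ck_derivable cu Ay)|exact: (Ck_derivable cv Ay)].
Qed.

Lemma CkM k u v : Ck k A u -> Ck k A v -> Ck k A (fun x => u x * v x).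
Proof.
elim: k u v => [|k IH] u v cu cv; split.
- by move=> x Ax; exact: continuousM (Ck_continuous cu Ax) (Ck_continuous cv Ax).
- by [].
- by move=> x Ax; exact: continuousM (Ck_continuous cu Ax) (Ck_continuous cv Ax).
- move=> i; split.
    move=> x Ax; apply: derivableM; [exact: (Ck_derivable cu Ax)|exact: (Ck_derivable cv Ax)].
  apply: Ck_eq (CkD (IH _ _ (CkW cu) (cv.2 i).2) (IH _ _ (CkW cv) (cu.2 i).2)) => y Ay.
  symmetry; apply: (@deriveM _ _ u v); [exact: (Ck_derivable cu Ay)|exact: (Ck_derivable cv Ay)].
Qed.

Lemma smooth_cst (a : R) : smooth_on A (fun=> a).
Proof. by move=> k; exact: Ck_cst. Qed.

Lemma smoothD u v : smooth_on A u -> smooth_on A v ->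
  smooth_on A (fun x => u x + v x).
Proof. by move=> su sv k; exact: CkD. Qed.

Lemma smoothM u v : smooth_on A u -> smooth_on A v ->
  smooth_on A (fun x => u x * v x).
Proof. by move=> su sv k; exact: CkM. Qed.

Lemma smoothZ (a : R) u : smooth_on A u -> smooth_on A (fun x => a * u x).
Proof. by move=> su; apply: smoothM => //; exact: smooth_cst. Qed.

Lemma smoothN u : smooth_on A u -> smooth_on A (fun x => - u x).
Proof.
move=> su; apply: smooth_eq (smoothZ (-1) su) => y _.
by rewrite mulN1r.
Qed.

Lemma smoothB u v : smooth_on A u -> smooth_on A v ->
  smooth_on A (fun x => u x - v x).
Proof. by move=> su sv; apply: smoothD => //; exact: smoothN. Qed.

Lemma smooth_sum (I : Type) (r : seq I) (P : pred I) (F : I -> 'rV[R]_m -> R) :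
  (forall b, P b -> smooth_on A (F b)) ->
  smooth_on A (fun x => \sum_(b <- r | P b) F b x).
Proof.
move=> sF; elim: r => [|a r IH].
  by apply: smooth_eq (smooth_cst 0) => y _; rewrite big_nil.
case Pa: (P a).
  by apply: smooth_eq (smoothD (sF a Pa) IH) => y _; rewrite big_cons Pa.
by apply: smooth_eq IH => y _; rewrite big_cons Pa.
Qed.

Lemma smooth_prod (I : Type) (r : seq I) (P : pred I) (F : I -> 'rV[R]_m -> R) :
  (forall b, P b -> smooth_on A (F b)) ->
  smooth_on A (fun x => \prod_(b <- r | P b) F b x).
Proof.
move=> sF; elim: r => [|a r IH].
  by apply: smooth_eq (smooth_cst 1) => y _; rewrite big_nil.
case Pa: (P a).
  by apply: smooth_eq (smoothM (sF a Pa) IH) => y _; rewrite big_cons Pa.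
by apply: smooth_eq IH => y _; rewrite big_cons Pa.
Qed.

(* [dphi] expresses the derivative of [phi] as a function of [phi] itself, so
   that the induction on the order of differentiability closes. *)
Lemma Ck_comp_ode (phi : R -> R)
    (dphi : ('rV[R]_m -> R) -> ('rV[R]_m -> R)) u n :
  (forall x, A x -> {for u x, continuous phi}) ->
  (forall x, A x -> is_derive (u x) 1 phi (dphi (phi \o u) x)) ->
  (forall k, Ck k A (phi \o u) -> Ck k A (dphi (phi \o u))) ->
  Ck n A u -> Ck n A (phi \o u).
Proof.
move=> cphi dphiP Cd su.
have cu x : A x -> {for x, continuous (phi \o u)}.
  move=> Ax; apply: continuous_comp; first exact: (Ck_continuous su).
  exact: cphi.
elim: n su => [|n IH] su; split => //.
move=> i.
have di x : A x -> is_derive x (delta_mx 0 i) (phi \o u)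
    (dphi (phi \o u) x * partial i u x).
  move=> Ax; apply: is_derive_comp1; first exact: dphiP.
  by apply/derivableP; exact: (Ck_derivable su).
split; first by move=> x /di [].
apply: Ck_eq (CkM (Cd _ (IH (CkW su))) (su.2 i).2) => y /di dy.
by rewrite /partial derive_val.
Qed.

Lemma CkV k u : (forall x, A x -> u x != 0) -> Ck k A u ->
  Ck k A (fun x => (u x)^-1).
Proof.
move=> u0; apply: (@Ck_comp_ode (fun t => t^-1) (fun f x => - (f x * f x))) => //.
- by move=> x /u0 ux; exact: inv_continuous.
- move=> x Ax; have ux := u0 _ Ax.
  have h : derivable (fun t : R => t^-1) (u x) 1 by exact: derivableV.
  apply: DeriveDef => //; rewrite (@deriveV _ _ id) // derive_id /=.
  by rewrite [LHS]mulr1 expr2 invfM.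
- move=> l cf; apply: Ck_eq (CkM (Ck_cst l (-1)) (CkM cf cf)) => y _.
  by rewrite mulN1r.
Qed.

Lemma smoothV u : (forall x, A x -> u x != 0) -> smooth_on A u ->
  smooth_on A (fun x => (u x)^-1).
Proof. by move=> u0 su k; exact: CkV. Qed.

Lemma smooth_sqrt u : (forall x, A x -> 0 < u x) -> smooth_on A u ->
  smooth_on A (fun x => Num.sqrt (u x)).
Proof.
move=> u0 su k; apply: (@Ck_comp_ode Num.sqrt (fun f x => (2 * f x)^-1)) => //.
- by move=> t _; exact: sqrt_continuous.
- by move=> x Ax; exact: is_derive1_sqrt (u0 _ Ax).
- move=> l cf; apply: CkV.
    by move=> x /u0 ux; rewrite mulf_neq0 // gt_eqF // sqrtr_gt0.
  by apply: CkM => //; exact: Ck_cst.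
Qed.

End SmoothCalculus.

Lemma line_MVT (R : realType) (V : normedModType R) (f : V -> R) (x v : V) (d : R) :
  0 < d -> (forall s, 0 <= s <= d -> derivable f (s *: v + x) v) ->
  exists2 s, 0 <= s <= d & f (d *: v + x) - f x = 'D_v f (s *: v + x) * d.
Proof.
move=> d0 df.
pose phi (s : R) := s *: v + x.
have phiE (s h : R) : phi (h *: 1 + s) = h *: v + phi s.
  by rewrite /phi [_%:A]mulr1 scalerDl addrA.
have dphi s : 0 <= s <= d -> is_derive s 1 (f \o phi) ('D_v f (phi s)).
  move=> sd; apply: DeriveDef.
    exact: derivable_affine (phiE s) (df _ sd).
  exact: derive_affine (phiE s).
have phi0 : phi 0 = x by rewrite /phi scale0r add0r.
have [] := @MVT R (f \o phi) (fun s => 'D_v f (phi s)) 0 d d0.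
- move=> s; rewrite in_itv /= => /andP[/ltW s0 /ltW sd].
  by apply: dphi; rewrite s0.
- apply: derivable_within_continuous => s; rewrite in_itv /= => sd.
  by have [] := dphi _ sd.
- move=> s; rewrite in_itv /= => /andP[/ltW s0 /ltW sd].
  by rewrite /= phi0 subr0 => E; exists s => //; rewrite s0.
Qed.

Section PartialRules.
Variables (R : realType) (m : nat) (A : set 'rV[R]_m).
Hypothesis Aopen : open A.
Implicit Types (u v : 'rV[R]_m -> R) (x : 'rV[R]_m) (i j : 'I_m) (k : nat).

Lemma partial_cst i (a : R) x : partial i (fun=> a) x = 0.
Proof. by rewrite /partial derive_cst. Qed.

Lemma partialD i u v x : smooth_on A u -> smooth_on A v -> A x ->
  partial i (fun y => u y + v y) x = partial i u x + partial i v x.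
Proof.
move=> su sv Ax; exact: deriveD (smooth_derivable su Ax) (smooth_derivable sv Ax).
Qed.

Lemma partialM i u v x : smooth_on A u -> smooth_on A v -> A x ->
  partial i (fun y => u y * v y) x = u x * partial i v x + v x * partial i u x.
Proof.
move=> su sv Ax; exact: deriveM (smooth_derivable su Ax) (smooth_derivable sv Ax).
Qed.

Lemma partialZ i (a : R) u x : smooth_on A u -> A x ->
  partial i (fun y => a * u y) x = a * partial i u x.
Proof.
move=> su Ax; rewrite partialM //; last exact: smooth_cst.
by rewrite partial_cst mulr0 addr0.
Qed.

Lemma partialV i u x : smooth_on A u -> A x -> u x != 0 ->
  partial i (fun y => (u y)^-1) x = - (u x) ^- 2 * partial i u x.
Proof.
by move=> su Ax ux; exact: deriveV ux (smooth_derivable su Ax).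
Qed.

Lemma partial_sum i (I : Type) (r : seq I) (P : pred I)
    (F : I -> 'rV[R]_m -> R) x :
  (forall b, P b -> smooth_on A (F b)) -> A x ->
  partial i (fun y => \sum_(b <- r | P b) F b y) x =
  \sum_(b <- r | P b) partial i (F b) x.
Proof.
move=> sF Ax; elim: r => [|a r IH].
  rewrite big_nil -[RHS](partial_cst i 0 x).
  by congr (partial i _ x); apply/funext => y; rewrite big_nil.
rewrite big_cons; case Pa: (P a).
  rewrite -IH -partialD //; [|exact: sF|exact: smooth_sum].
  by congr (partial i _ x); apply/funext => y; rewrite big_cons Pa.
rewrite -IH.
by congr (partial i _ x); apply/funext => y; rewrite big_cons Pa.
Qed.

(** The mean value theorem is used twice: in direction [i] for the difference between [u] and its
    translate along [delta_mx 0 j], then in direction [j] for [partial i u]. *)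
Lemma second_difference i j u x (d : R) : smooth_on A u -> 0 < d ->
  (forall s t, 0 <= s <= d -> 0 <= t <= d ->
     A (s *: delta_mx 0 i + (t *: delta_mx 0 j + x))) ->
  exists s t, [/\ 0 <= s <= d, 0 <= t <= d &
    u (d *: delta_mx 0 i + (d *: delta_mx 0 j + x)) - u (d *: delta_mx 0 i + x)
    - (u (d *: delta_mx 0 j + x) - u x) =
    partial j (partial i u) (s *: delta_mx 0 i + (t *: delta_mx 0 j + x)) * d * d].
Proof.
move=> su d0 inA.
have dd : 0 <= d <= d by rewrite lexx ltW.
have z0 : 0 <= (0 : R) <= d by rewrite lexx ltW.
pose ej : 'rV[R]_m := d *: delta_mx 0 j.
have shiftE (y v : 'rV[R]_m) (h : R) :
  (h *: v + y) + ej = h *: v + (y + ej) by rewrite addrA.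
have inA0 s : 0 <= s <= d -> A (s *: delta_mx 0 i + x).
  by move=> sd; have := inA s 0 sd z0; rewrite scale0r add0r.
have inAd s : 0 <= s <= d -> A (s *: delta_mx 0 i + x + ej).
  by move=> sd; have := inA s d sd dd; rewrite [_ + x]addrC addrA.
have dsh s : 0 <= s <= d ->
    derivable (u \o (fun y => y + ej)) (s *: delta_mx 0 i + x) (delta_mx 0 i).
  move=> sd; apply: (derivable_affine (phi := fun y => y + ej)).
    by move=> h; exact: shiftE.
  exact: (smooth_derivable su (inAd _ sd)).
have d1 s : 0 <= s <= d -> derivable u (s *: delta_mx 0 i + x) (delta_mx 0 i).
  by move=> sd; exact: (smooth_derivable su (inA0 _ sd)).
have [s sd E1] := line_MVT d0
  (fun s sd => derivableB (dsh s sd) (d1 s sd)).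
have [t td E2] : exists2 t, 0 <= t <= d &
    partial i u (s *: delta_mx 0 i + x + ej) - partial i u (s *: delta_mx 0 i + x)
    = partial j (partial i u) (t *: delta_mx 0 j + (s *: delta_mx 0 i + x)) * d.
  have dj t : 0 <= t <= d ->
      derivable (partial i u) (t *: delta_mx 0 j + (s *: delta_mx 0 i + x)) (delta_mx 0 j).
    move=> td; rewrite addrCA.
    exact: (smooth_derivable (smooth_partial i su) (inA _ _ sd td)).
  by have [t td E2] := line_MVT d0 dj; exists t; rewrite // [_ + ej]addrC.
exists s, t; split => //.
rewrite [s *: _ + _]addrCA -E2 -/ej.
move: E1; rewrite (deriveB (dsh _ sd) (d1 _ sd)).
rewrite (@derive_affine _ _ _ (fun y => y + ej) u _ _ (delta_mx 0 i)); last first.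
  by move=> h; exact: shiftE.
rewrite -/(partial i u _) -/(partial i u _) => <-.
by rewrite /= -![(_ - _ : _ -> _) _]/(_ - _) /= (addrC ej x) addrA; ring.
Qed.

Lemma eq_of_close_values (F G : 'rV[R]_m -> R) x :
  {for x, continuous F} -> {for x, continuous G} ->
  (forall r, 0 < r -> exists p q, [/\ ball x r p, ball x r q & F p = G q]) ->
  F x = G x.
Proof.
move=> cF cG FG; apply/eqP; rewrite -subr_eq0 -normr_le0 leNgt; apply/negP => ab.
pose e := `|F x - G x| / 2.
have e0 : 0 < e by rewrite divr_gt0.
have /cvgrPdist_lt /(_ _ e0) n1 := cF.
have /cvgrPdist_lt /(_ _ e0) n2 := cG.
have [r /= r0 rP] := (nbhs_ballP _ _).1 (filterI n1 n2).
have [p [q [/rP [/= Fp _] /rP [_ /= Gq] pq]]] := FG _ r0.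
have : `|F x - G x| < e + e.
  rewrite -(subrKA (F p) (F x) (- G x)); apply: (le_lt_trans (ler_normD _ _)).
  by rewrite distrC -pq in Gq; exact: ltrD Fp Gq.
by rewrite /e -splitr ltxx.
Qed.

(** The second difference of [u] over a parallelogram of side [d] is [d * d] times either mixed
    derivative at some point of it; both derivatives are continuous, and the parallelogram shrinks
    to [x]. *)
Lemma partialC i j u x : smooth_on A u -> A x ->
  partial i (partial j u) x = partial j (partial i u) x.
Proof.
move=> su Ax; apply: eq_of_close_values.
- exact: smooth_continuous (smooth_partial i (smooth_partial j su)) Ax.
- exact: smooth_continuous (smooth_partial j (smooth_partial i su)) Ax.
move=> r0 r0_gt0.
have nA : nbhs x A by apply: open_nbhs_nbhs.
have [r1 /= r1_gt0 r1P] := (nbhs_ballP _ _).1 nA.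
pose r := Num.min r0 r1.
have r_gt0 : 0 < r by rewrite lt_min r0_gt0.
(* With [d = r / 2 / K] every point of the parallelogram is within [d * K = r / 2] of [x]; the
   summand 1 keeps [K] positive. *)
pose K := `|delta_mx 0 i : 'rV[R]_m| + `|delta_mx 0 j : 'rV[R]_m| + 1.
have K0 : 0 < K by rewrite ltr_wpDl // addr_ge0.
pose d := r / 2 / K.
have d0 : 0 < d by rewrite !divr_gt0.
have inb s t (k l : 'I_m) : (k = i /\ l = j) \/ (k = j /\ l = i) ->
    0 <= s <= d -> 0 <= t <= d ->
    ball x r (s *: delta_mx 0 k + (t *: delta_mx 0 l + x)).
  move=> kl /andP[s0 sd] /andP[t0 td].
  rewrite -ball_normE /ball_ /= addrA opprD addrCA subrr addr0 normrN.
  apply: (le_lt_trans (ler_normD _ _)); rewrite !normrZ !ger0_norm //.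
  have : s * `|delta_mx 0 k : 'rV[R]_m| + t * `|delta_mx 0 l : 'rV[R]_m| <= d * K.
    have h1 := ler_wpM2r (normr_ge0 (delta_mx 0 k : 'rV[R]_m)) sd.
    have h2 := ler_wpM2r (normr_ge0 (delta_mx 0 l : 'rV[R]_m)) td.
    by rewrite /K; case: kl h1 h2 => -[-> ->]; lra.
  move/le_lt_trans; apply.
  by rewrite /d divfK ?gt_eqF // ltr_pdivrMr // ltr_pMr // ltrDl.
have b1 y : ball x r y -> A y.
  by move=> xy; apply: r1P; apply: le_ball xy; rewrite ge_min lexx orbT.
have b0 y : ball x r y -> ball x r0 y.
  by move=> xy; apply: le_ball xy; rewrite ge_min lexx.
have ij s t := inb s t i j (or_introl (conj erefl erefl)).
have ji s t := inb s t j i (or_intror (conj erefl erefl)).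
have [s [t [sd td E1]]] := second_difference su d0
  (fun s t sd td => b1 _ (ij s t sd td)).
have [s' [t' [sd' td' E2]]] := second_difference su d0
  (fun s t sd td => b1 _ (ji s t sd td)).
exists (s' *: delta_mx 0 j + (t' *: delta_mx 0 i + x)).
exists (s *: delta_mx 0 i + (t *: delta_mx 0 j + x)).
split; [exact: b0 (ji _ _ sd' td')|exact: b0 (ij _ _ sd td)|].
apply: (mulIf (lt0r_neq0 d0)); apply: (mulIf (lt0r_neq0 d0)).
(* The second difference does not depend on the order of the two directions. *)
have swap (a1 a2 a3 a4 : R) : a1 - a2 - (a3 - a4) = a1 - a3 - (a2 - a4) by ring.
apply: (etrans (esym E2)); apply: (etrans _ E1); clear E1 E2.
apply: (etrans (swap _ _ _ _)); congr (u _ - _ - _); exact: addrCA.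
Qed.

End PartialRules.

(** * Determinants and inverses of matrix-valued functions *)

Section MatrixCalculus.
Variables (R : realType) (m : nat) (A : set 'rV[R]_m).
Hypothesis Aopen : open A.
Implicit Types (u v : 'rV[R]_m -> R) (x : 'rV[R]_m) (k : 'I_m).

Lemma partial_sqrt k u x : smooth_on A u -> A x -> 0 < u x ->
  partial k (fun y => Num.sqrt (u y)) x = (2 * Num.sqrt (u x))^-1 * partial k u x.
Proof.
move=> su Ax ux; have := is_derive_comp1 (is_derive1_sqrt ux)
  (derivableP (smooth_derivable (i := k) su Ax)).
by case.
Qed.

Lemma partial_prod k (I : eqType) (r : seq I) (F : I -> 'rV[R]_m -> R) x :
  uniq r -> (forall b, smooth_on A (F b)) -> A x ->
  partial k (fun y => \prod_(b <- r) F b y) x =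
  \sum_(b <- r) partial k (F b) x * \prod_(c <- r | c != b) F c x.
Proof.
move=> + sF Ax; elim: r => [_|a r IH /= /andP[ar ur]].
  rewrite big_nil -[RHS](partial_cst k 1 x).
  by congr (partial k _ x); apply/funext => y; rewrite big_nil.
transitivity (partial k (fun y => F a y * \prod_(b <- r) F b y) x).
  by congr (partial k _ x); apply/funext => y; rewrite big_cons.
rewrite (@partialM _ _ A) //; last exact: smooth_prod.
rewrite IH // big_cons big_cons eqxx /= addrC mulrC; congr (_ * _ + _).
  rewrite big_seq [RHS]big_seq_cond; apply: eq_bigl => b.
  by case: eqVneq => [->|]; rewrite ?(negPf ar) ?andbT ?andbF.
rewrite mulr_sumr; apply: eq_big_seq => b br.
rewrite big_cons ifT; first by rewrite mulrCA.
by apply: contraNneq ar => ->.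
Qed.

Section Matrix.
Variable p : nat.
Implicit Types X : 'rV[R]_m -> 'M[R]_p.

Definition partial_mx k X x : 'M[R]_p := \matrix_(i, j) partial k (fun y => X y i j) x.

Lemma smooth_det X : (forall i j, smooth_on A (fun y => X y i j)) ->
  smooth_on A (fun y => \det (X y)).
Proof.
move=> sX; rewrite /determinant; apply: smooth_sum => // s _.
by apply: smoothZ => //; apply: smooth_prod.
Qed.

(** In the Leibniz formula the product rule differentiates one row at a time; the contribution of
    row [i] is the determinant of the matrix [Y] with that row differentiated, expanded along the
    same row. *)
Lemma partial_det_cofactor k X x : (forall i j, smooth_on A (fun y => X y i j)) ->
  A x -> partial k (fun y => \det (X y)) x =
  \sum_i \sum_j partial k (fun y => X y i j) x * cofactor (X x) i j.
Proof.
move=> sX Ax; rewrite /determinant (partial_sum Aopen) //; last first.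
  by move=> s _; apply: smoothZ => //; apply: smooth_prod.
under eq_bigr => s _.
  rewrite (partialZ Aopen) //; last exact: smooth_prod.
  rewrite (partial_prod _ (index_enum_uniq _)) // mulr_sumr.
  over.
rewrite exchange_big /=; apply: eq_bigr => i _.
pose Y := \matrix_(a, b) if a == i then partial k (fun y => X y a b) x else X x a b.
transitivity (\det Y).
  rewrite /determinant; apply: eq_bigr => s _; congr (_ * _).
  rewrite [RHS](bigD1 i) //= mxE eqxx; congr (_ * _).
  by apply: eq_bigr => a ai; rewrite mxE (negPf ai).
rewrite (expand_det_row _ i); apply: eq_bigr => j _.
rewrite mxE eqxx; congr (_ * _); rewrite /cofactor; congr (_ * \det _).
by apply/matrixP => a b; rewrite !mxE eq_sym (negPf (neq_lift _ _)).
Qed.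

Lemma partial_det k X x : (forall i j, smooth_on A (fun y => X y i j)) ->
  A x -> X x \in unitmx ->
  partial k (fun y => \det (X y)) x =
  \det (X x) * \tr (invmx (X x) *m partial_mx k X x).
Proof.
move=> sX Ax Xu; rewrite partial_det_cofactor //.
rewrite /invmx Xu -scalemxAl mxtraceZ mulrA divff ?mul1r; last first.
  by rewrite -unitfE -unitmxE.
rewrite /mxtrace exchange_big /=; apply: eq_bigr => i _.
by rewrite !mxE; apply: eq_bigr => j _; rewrite !mxE mulrC.
Qed.

End Matrix.

Lemma smooth_invmx p (X : 'rV[R]_m -> 'M[R]_p) :
  (forall i j, smooth_on A (fun y => X y i j)) ->
  (forall y, A y -> X y \in unitmx) ->
  forall i j, smooth_on A (fun y => invmx (X y) i j).
Proof.
move=> sX Xu i j.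
apply: (@smooth_eq _ _ _ Aopen (fun y => (\det (X y))^-1 * cofactor (X y) j i)).
  by move=> y /Xu Xy; rewrite /invmx Xy !mxE.
apply: smoothM => //.
  apply: smoothV => //; last exact: smooth_det.
  by move=> y /Xu; rewrite unitmxE unitfE.
apply: smoothZ => //; apply: smooth_det => a b.
by apply: smooth_eq (sX (lift j a) (lift i b)) => // y _; rewrite !mxE.
Qed.

(** Obtained by differentiating [invmx X *m X = 1] on the open set [A]. *)
Lemma partial_invmx p (X : 'rV[R]_m -> 'M[R]_p) k x :
  (forall i j, smooth_on A (fun y => X y i j)) ->
  (forall y, A y -> X y \in unitmx) -> A x ->
  partial_mx k (fun y => invmx (X y)) x =
  - (invmx (X x) *m partial_mx k X x *m invmx (X x)).
Proof.
move=> sX Xu Ax; have sH := smooth_invmx sX Xu.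
have E : partial_mx k (fun y => invmx (X y)) x *m X x
         + invmx (X x) *m partial_mx k X x = 0.
  apply/matrixP => i j; rewrite !mxE -big_split /=.
  transitivity (partial k (fun y => \sum_l invmx (X y) i l * X y l j) x).
    rewrite (partial_sum Aopen) //; last by move=> l _; exact: smoothM.
    apply: eq_bigr => l _; rewrite (@partialM _ _ A) // !mxE.
    by rewrite addrC [X in _ + X]mulrC.
  apply: etrans (partial_cst k ((1%:M : 'M[R]_p) i j) x).
  apply: (eq_partial Aopen) => // y /Xu Xy.
  have := congr1 (fun B : 'M[R]_p => B i j) (mulVmx Xy); rewrite [LHS]mxE.
  exact.
rewrite -mulNmx; apply: (canRL (mulmxK (Xu _ Ax))).
by apply/eqP; rewrite -addr_eq0; apply/eqP.
Qed.

End MatrixCalculus.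

(** * Functions of (x, rho) and their expansions at rho = 0 *)

Lemma continuous_mx (R : realType) (T : topologicalType) (p q : nat)
    (f : T -> 'M[R]_(p, q)) (x : T) :
  (forall i j, {for x, continuous (fun y => f y i j)}) -> {for x, continuous f}.
Proof.
move=> cf; apply/cvgrPdist_le => /= e e0; near=> y.
rewrite /Num.Def.normr/= mx_normrE (bigmax_le _ (ltW e0))//= => i _.
rewrite !mxE/=; move: i; near: y; apply: filter_forall => /= i.
have /cvgrPdist_le := cf i.1 i.2; exact.
Unshelve. all: by end_near. Qed.

Lemma eq_continuous_at (S T : topologicalType) (f g : S -> T) (x : S) :
  f =1 g -> {for x, continuous f} -> {for x, continuous g}.
Proof. by move=> /funext ->. Qed.

Section Slices.
Variables (R : realType) (n : nat) (U : set 'rV[R]_n) (eps : R).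
Hypothesis Uopen : open U.
Implicit Types (F G : 'rV[R]_(n + 1) -> R) (u : 'rV[R]_n -> R) (x : 'rV[R]_n)
  (rho : R) (i j k : nat).

Definition tube : set 'rV[R]_(n + 1) :=
  [set z | U (lsubmx z) /\ `|rsubmx z 0 0| < eps].

Definition at_rho rho x : 'rV[R]_(n + 1) := row_mx x rho%:M.

Definition rho_of (z : 'rV[R]_(n + 1)) : R := rsubmx z 0 0.

Lemma lsubmx_at rho x : lsubmx (at_rho rho x) = x.
Proof. exact: row_mxKl. Qed.

Lemma rho_of_at rho x : rho_of (at_rho rho x) = rho.
Proof. by rewrite /rho_of row_mxKr mxE eqxx mulr1n. Qed.

Lemma tube_at rho x : U x -> `|rho| < eps -> tube (at_rho rho x).
Proof. by move=> Ux r; split; rewrite ?lsubmx_at // -/(rho_of _) rho_of_at. Qed.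

Lemma continuous_rho_of : continuous rho_of.
Proof.
move=> z; rewrite /rho_of.
apply: (@continuous_comp _ _ _ rsubmx (fun A : 'rV[R]_1 => A 0 0)).
  exact: continuous_rsubmx.
exact: coord_continuous.
Qed.

Lemma tube_open : open tube.
Proof.
apply: openI.
  apply: open_comp => // z _; exact: continuous_lsubmx.
apply: (@open_comp _ _ (fun z => `|rho_of z|) [set t | t < eps]); last exact: open_lt.
move=> z _; apply: (@continuous_comp _ _ _ rho_of Num.norm).
  exact: continuous_rho_of.
exact: norm_continuous.
Qed.

Lemma continuous_at_rho rho : continuous (at_rho rho).
Proof.
move=> x; apply: continuous_mx => i j; rewrite /at_rho.
case: (split_ordP j) => a ->.
  apply: (eq_continuous_at (f := fun y : 'rV[R]_n => y i a)).
    by move=> y; rewrite row_mxEl.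
  exact: coord_continuous.
apply: (eq_continuous_at (f := fun=> (rho%:M : 'rV[R]_1) i a)).
  by move=> y; rewrite row_mxEr.
exact: cst_continuous.
Qed.

Lemma continuous_at_rhol x : continuous (at_rho ^~ x).
Proof.
move=> rho; apply: continuous_mx => i j; rewrite /at_rho.
case: (split_ordP j) => a ->.
  apply: (eq_continuous_at (f := fun=> x i a)).
    by move=> y; rewrite row_mxEl.
  exact: cst_continuous.
apply: (eq_continuous_at (f := id)); last exact: cvg_id.
by move=> y; rewrite row_mxEr !ord1 mxE eqxx mulr1n.
Qed.

Notation dx a := (partial (lshift 1 a)).
Notation drho := (partial (rshift n (ord0 : 'I_1))).

Lemma at_rho_shift rho x (a : 'I_n) (h : R) :
  at_rho rho (h *: delta_mx 0 a + x) = h *: delta_mx 0 (lshift 1 a) + at_rho rho x.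
Proof.
by rewrite delta_mx_lshift scale_row_mx add_row_mx scaler0 add0r.
Qed.

Lemma at_rho_shiftl rho x (h : R) :
  at_rho (h *: 1 + rho) x = h *: delta_mx 0 (rshift n ord0) + at_rho rho x.
Proof.
rewrite delta_mx_rshift scale_row_mx add_row_mx scaler0 add0r; congr row_mx.
by apply/matrixP => a b; rewrite !ord1 !mxE !eqxx !mulr1n.
Qed.

Lemma partial_slice (a : 'I_n) F rho x :
  partial a (F \o at_rho rho) x = dx a F (at_rho rho x).
Proof. by apply: derive_affine => h; exact: at_rho_shift. Qed.

Lemma derive1_slice F x rho : derive1 (fun s => F (at_rho s x)) rho = drho F (at_rho rho x).
Proof.
rewrite derive1E; apply: (derive_affine (phi := at_rho^~ x)) => h.
exact: at_rho_shiftl.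
Qed.

Lemma derivable_slice F x rho : smooth_on tube F -> tube (at_rho rho x) ->
  derivable (fun s => F (at_rho s x)) rho 1.
Proof.
move=> sF tx; apply: (derivable_affine (phi := at_rho^~ x)) (smooth_derivable sF tx).
by move=> h; exact: at_rho_shiftl.
Qed.

Lemma smooth_slice F rho : `|rho| < eps -> smooth_on tube F ->
  smooth_on U (F \o at_rho rho).
Proof.
move=> re sF k.
elim: k F sF => [|k IH] F sF.
  split => // x Ux; apply: continuous_comp; first exact: continuous_at_rho.
  by apply: (smooth_continuous sF); exact: tube_at.
split=> [x Ux|a].
  apply: continuous_comp; first exact: continuous_at_rho.
  by apply: (smooth_continuous sF); exact: tube_at.
split=> [x Ux|].
  apply: derivable_affine (smooth_derivable sF (tube_at Ux re)).
  by move=> h; exact: at_rho_shift.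
apply: (@Ck_eq _ _ _ Uopen _ (dx a F \o at_rho rho)).
  by move=> y _; rewrite partial_slice.
by apply: IH; exact: smooth_partial.
Qed.

Lemma lsubmx_shift (z : 'rV[R]_(n + 1)) (a : 'I_n) (h : R) :
  lsubmx (h *: delta_mx 0 (lshift 1 a) + z) = h *: delta_mx 0 a + lsubmx z.
Proof. by rewrite linearP /= delta_mx_lshift row_mxKl. Qed.

Lemma lsubmx_shiftr (z : 'rV[R]_(n + 1)) (a : 'I_1) (h : R) :
  lsubmx (h *: delta_mx 0 (rshift n a) + z) = h *: 0 + lsubmx z.
Proof. by rewrite linearP /= delta_mx_rshift row_mxKl. Qed.

Lemma partial_lift (a : 'I_n) u z : dx a (u \o lsubmx) z = partial a u (lsubmx z).
Proof. by apply: derive_affine => h; exact: lsubmx_shift. Qed.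

Lemma drho_lift u z : drho (u \o lsubmx) z = 0.
Proof.
rewrite -(derive0 u (lsubmx z)); apply: derive_affine => h.
exact: lsubmx_shiftr.
Qed.

Lemma smooth_lift u : smooth_on U u -> smooth_on tube (u \o lsubmx).
Proof.
move=> su k; elim: k u su => [|k IH] u su.
  split => // z [Uz _]; apply: continuous_comp; first exact: continuous_lsubmx.
  exact: smooth_continuous su Uz.
split=> [z [Uz _]|a].
  apply: continuous_comp; first exact: continuous_lsubmx.
  exact: smooth_continuous su Uz.
case: (split_ordP a) => b ->; split.
- move=> z [Uz _]; apply: derivable_affine (smooth_derivable su Uz).
  by move=> h; exact: lsubmx_shift.
- apply: (@Ck_eq _ _ _ tube_open _ (partial b u \o lsubmx)).
    by move=> y _; rewrite partial_lift.
  by apply: IH; exact: smooth_partial.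
- move=> z _; have d0 : derivable u (lsubmx z) 0 by exact: derivable0.
  apply: derivable_affine d0.
  by move=> h; exact: lsubmx_shiftr.
- apply: (@Ck_eq _ _ _ tube_open _ (fun=> 0)); last exact: (Ck_cst tube_open).
  by move=> y _; rewrite !ord1 drho_lift.
Qed.

Lemma rho_of_shift (z : 'rV[R]_(n + 1)) (a : 'I_n) (h : R) :
  rho_of (h *: delta_mx 0 (lshift 1 a) + z) = h *: 0 + rho_of z.
Proof. by rewrite /rho_of linearP /= delta_mx_lshift row_mxKr scaler0 !mxE mulr0. Qed.

Lemma rho_of_shiftr (z : 'rV[R]_(n + 1)) (h : R) :
  rho_of (h *: delta_mx 0 (rshift n ord0) + z) = h *: 1 + rho_of z.
Proof. by rewrite /rho_of linearP /= delta_mx_rshift row_mxKr !mxE !eqxx. Qed.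

Lemma partial_rho (a : 'I_n) z : dx a rho_of z = 0.
Proof.
rewrite -(derive0 (id : R -> R) (rho_of z)).
by apply: (@derive_affine _ _ _ rho_of id) => h; exact: rho_of_shift.
Qed.

Lemma drho_rho z : drho rho_of z = 1.
Proof.
rewrite -(derive_id (rho_of z) (1 : R)).
by apply: (@derive_affine _ _ _ rho_of id) => h; exact: rho_of_shiftr.
Qed.

Lemma smooth_rho : smooth_on tube rho_of.
Proof.
case=> [|k]; (split; [by move=> z _; exact: continuous_rho_of|]) => // a.
case: (split_ordP a) => b ->; split.
- move=> z _; have d0 : derivable (id : R -> R) (rho_of z) 0 by exact: derivable0.
  apply: (@derivable_affine _ _ _ rho_of id) d0.
  by move=> h; exact: rho_of_shift.
- apply: (@Ck_eq _ _ _ tube_open _ (fun=> 0)); last exact: (Ck_cst tube_open).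
  by move=> y _; rewrite partial_rho.
- rewrite (ord1 b) => z _.
  have d1 : derivable (id : R -> R) (rho_of z) 1 by exact: derivable_id.
  apply: (@derivable_affine _ _ _ rho_of id) d1.
  by move=> h; exact: rho_of_shiftr.
- apply: (@Ck_eq _ _ _ tube_open _ (fun=> 1)); last exact: (Ck_cst tube_open).
  by move=> y _; rewrite (ord1 b) drho_rho.
Qed.

End Slices.

Local Notation dx a := (partial (lshift 1 a)).
Local Notation drho := (partial (rshift _ (ord0 : 'I_1))).

(* The coefficient of s^j in the expansion at s = 0 in the variable s = - rho / 2,
   which is r^2 / 4 when rho = - r^2 / 2. *)
Definition rho_coef (R : realType) (n : nat) (j : nat) (F : 'rV[R]_(n + 1) -> R)
    (x : 'rV[R]_n) : R :=
  (-2) ^+ j / j`!%:R * iter j drho F (at_rho 0 x).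

Section RhoCoef.
Variables (R : realType) (n : nat) (U : set 'rV[R]_n) (eps : R).
Hypothesis Uopen : open U.
Hypothesis eps0 : 0 < eps.
Implicit Types (F G : 'rV[R]_(n + 1) -> R) (u : 'rV[R]_n -> R) (x : 'rV[R]_n)
  (rho : R) (i j k : nat).

Notation Om := (tube U eps).
Let Om_open : open Om := tube_open Uopen.

Lemma tube0 x : U x -> Om (at_rho 0 x).
Proof. by move=> Ux; apply: tube_at; rewrite ?normr0. Qed.

Lemma smooth_iter_drho j F : smooth_on Om F -> smooth_on Om (iter j drho F).
Proof. exact: smooth_iter_partial. Qed.

Lemma iter_drho_eq j F G z : Om z -> (forall y, Om y -> F y = G y) ->
  iter j drho F z = iter j drho G z.
Proof.
move=> + FG; elim: j z => [|j IH] z Oz /=; first exact: FG.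
by apply: (eq_partial Om_open) => // y Oy; exact: IH.
Qed.

Lemma rho_coef_eq j F G x : U x -> (forall y, Om y -> F y = G y) ->
  rho_coef j F x = rho_coef j G x.
Proof. by move=> Ux FG; rewrite /rho_coef (iter_drho_eq j (tube0 Ux) FG). Qed.

Lemma rho_coef0 F x : rho_coef 0 F x = F (at_rho 0 x).
Proof. by rewrite /rho_coef expr0 fact0 divr1 mul1r. Qed.

Lemma rho_coefS j F x :
  j.+1%:R * rho_coef j.+1 F x = - 2 * rho_coef j (drho F) x.
Proof.
rewrite /rho_coef iterSr factS natrM exprS.
have j0 : j.+1%:R != 0 :> R by rewrite pnatr_eq0.
have f0 : j`!%:R != 0 :> R by rewrite pnatr_eq0 -lt0n fact_gt0.
by field; rewrite f0 nat1r j0.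
Qed.

Lemma rho_coef_drho j F x :
  rho_coef j (drho F) x = - (j.+1%:R / 2) * rho_coef j.+1 F x.
Proof.
apply: (@mulfI _ (- 2)); first by rewrite oppr_eq0 pnatr_eq0.
by rewrite -rho_coefS; field.
Qed.

Lemma rho_coefD j F G x : smooth_on Om F -> smooth_on Om G -> U x ->
  rho_coef j (fun z => F z + G z) x = rho_coef j F x + rho_coef j G x.
Proof.
move=> sF sG Ux; rewrite /rho_coef -mulrDr; congr (_ * _).
move: (at_rho 0 x) (tube0 Ux) => z; elim: j z => //= j IH z Oz.
rewrite -(@partialD _ _ Om) //; try exact: smooth_iter_drho.
by apply: (eq_partial Om_open) => // y Oy; exact: IH.
Qed.

Lemma rho_coefZ j (a : R) F x : smooth_on Om F -> U x ->
  rho_coef j (fun z => a * F z) x = a * rho_coef j F x.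
Proof.
move=> sF Ux; rewrite /rho_coef mulrCA; congr (_ * _).
move: (at_rho 0 x) (tube0 Ux) => z; elim: j z => //= j IH z Oz.
rewrite -(partialZ Om_open) //; last exact: smooth_iter_drho.
by apply: (eq_partial Om_open) => // y Oy; exact: IH.
Qed.

Lemma rho_coefN j F x : smooth_on Om F -> U x ->
  rho_coef j (fun z => - F z) x = - rho_coef j F x.
Proof.
move=> sF Ux; rewrite -[RHS]mulN1r -rho_coefZ //.
by apply: rho_coef_eq => // y _; rewrite mulN1r.
Qed.

Lemma rho_coefB j F G x : smooth_on Om F -> smooth_on Om G -> U x ->
  rho_coef j (fun z => F z - G z) x = rho_coef j F x - rho_coef j G x.
Proof.
by move=> sF sG Ux; rewrite rho_coefD ?rho_coefN //; exact: smoothN.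
Qed.

Lemma rho_coef_cst0 j x : rho_coef j (fun=> 0 : R) x = 0.
Proof.
rewrite /rho_coef (_ : iter j _ _ = fun=> 0) ?mulr0 //.
by elim: j => //= j ->; apply/funext => z; rewrite partial_cst.
Qed.

Lemma rho_coef_sum j (I : Type) (r : seq I) (F : I -> 'rV[R]_(n + 1) -> R) x :
  (forall b, smooth_on Om (F b)) -> U x ->
  rho_coef j (fun z => \sum_(b <- r) F b z) x = \sum_(b <- r) rho_coef j (F b) x.
Proof.
move=> sF Ux; elim: r => [|a r IH].
  rewrite big_nil; apply: etrans (rho_coef_cst0 j x); apply: rho_coef_eq => // y _.
  by rewrite big_nil.
rewrite big_cons -IH -rho_coefD //; last exact: smooth_sum.
by apply: rho_coef_eq => // y _; rewrite big_cons.
Qed.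

(** Cauchy product. After multiplication by [j.+1], the splitting [j.+1 = (j.+1 - i) + i] matches
    the two terms of the Leibniz rule for [drho], each of which is an instance of the induction
    hypothesis through [rho_coefS]. *)
Lemma rho_coefM j F G x : smooth_on Om F -> smooth_on Om G -> U x ->
  rho_coef j (fun z => F z * G z) x =
  \sum_(i < j.+1) rho_coef i F x * rho_coef (j - i) G x.
Proof.
elim: j F G => [|j IH] F G sF sG Ux.
  by rewrite big_ord1 !rho_coef0.
apply: (@mulfI _ j.+1%:R); first by rewrite pnatr_eq0.
have sdF := smooth_partial (rshift n ord0) sF.
have sdG := smooth_partial (rshift n ord0) sG.
rewrite rho_coefS.
rewrite (@rho_coef_eq _ _ (fun z => F z * drho G z + drho F z * G z)) //; last first.
  by move=> y Oy; rewrite (@partialM _ _ Om) // [G y * _]mulrC.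
rewrite rho_coefD //; [|exact: smoothM..].
rewrite (IH _ _ sF sdG) // (IH _ _ sdF sG) //.
transitivity (\sum_(i < j.+2) (j.+1 - i)%:R * (rho_coef i F x * rho_coef (j.+1 - i) G x)
  + \sum_(i < j.+2) i%:R * (rho_coef i F x * rho_coef (j.+1 - i) G x)); last first.
  rewrite -big_split mulr_sumr; apply: eq_bigr => i _ /=.
  by rewrite -mulrDl -natrD subnK // -ltnS.
rewrite mulrDr; congr (_ + _).
  rewrite [RHS]big_ord_recr /= subnn mulr0n mul0r addr0 mulr_sumr; apply: eq_bigr => i _.
  have ij : (i <= j)%N by rewrite -ltnS.
  by rewrite subSn // mulrCA -rho_coefS mulrCA.
rewrite [RHS]big_ord_recl /= mulr0n mul0r add0r mulr_sumr; apply: eq_bigr => i _.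
by rewrite /bump /= add1n subSS [LHS]mulrA -rho_coefS -mulrA.
Qed.

Lemma iter_drho_lift0 j u z :
  iter j.+1 drho (u \o lsubmx) z = 0.
Proof.
elim: j z => [|j IH] z; first exact: drho_lift.
rewrite iterS -[RHS](partial_cst (rshift n (ord0 : 'I_1)) (0 : R) z).
by congr (partial _ _ z); apply/funext => y; rewrite IH.
Qed.

Lemma rho_coef_lift j u x : rho_coef j (u \o lsubmx) x = (j == 0%N)%:R * u x.
Proof.
case: j => [|j]; first by rewrite rho_coef0 /= lsubmx_at mul1r.
by rewrite /rho_coef iter_drho_lift0 mulr0 mul0r.
Qed.

Lemma rho_coef_rho j x : rho_coef j (@rho_of R n) x = (j == 1%N)%:R * - 2.
Proof.
case: j => [|[|j]] /=; rewrite ?mulr0n ?mul0r ?mul1r.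
- by rewrite rho_coef0 rho_of_at.
- by rewrite /rho_coef /= drho_rho mulr1 expr1 divr1.
- rewrite /rho_coef (_ : iter j.+2 _ _ = fun=> 0) ?mulr0 //.
  elim: j => [|j IH]; apply/funext => z.
    rewrite /= -[RHS](partial_cst (rshift n (ord0 : 'I_1)) (1 : R) z).
    by congr (partial _ _ z); apply/funext => y; rewrite drho_rho.
  by rewrite iterS IH partial_cst.
Qed.

(** [rho d/drho] is the Euler operator, which is unchanged by the rescaling [s = - rho / 2]. *)
Lemma rho_coef_rho_drho j F x : smooth_on Om F -> U x ->
  rho_coef j (fun z => rho_of z * drho F z) x = j%:R * rho_coef j F x.
Proof.
move=> sF Ux; rewrite rho_coefM //; [|exact: smooth_rho|exact: smooth_partial].
case: j => [|j].
  by rewrite big_ord1 rho_coef_rho /= !mul0r.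
rewrite 2!big_ord_recl big1 ?addr0 => [|i _]; last first.
  by rewrite rho_coef_rho !lift0 /= !mul0r.
rewrite !rho_coef_rho /bump /= !mul0r add0r mul1r subSS subn0.
by rewrite -rho_coefS.
Qed.

(** Symmetry of mixed derivatives enters here: [dx a] has to be moved past the [j] derivatives in
    [rho]. *)
Lemma rho_coef_partial j (a : 'I_n) F x : smooth_on Om F -> U x ->
  rho_coef j (dx a F) x = partial a (rho_coef j F) x.
Proof.
move=> sF Ux; rewrite /rho_coef.
have sj := smooth_iter_drho j sF.
have e0 : `|0 : R| < eps by rewrite normr0.
rewrite (partialZ Uopen) //; last exact: (smooth_slice Uopen e0 sj).
rewrite -[partial a _ x]/(partial a (iter j drho F \o at_rho 0) x) partial_slice.
congr (_ * _); move: (at_rho 0 x) (tube0 Ux) {sj} => z.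
elim: j z => //= j IH z Oz.
rewrite (eq_partial Om_open _ Oz IH) (partialC Om_open) //.
exact: smooth_iter_drho.
Qed.

Lemma smooth_rho_coef j F : smooth_on Om F -> smooth_on U (rho_coef j F).
Proof.
move=> sF; apply: smoothZ => //.
have e0 : `|0 : R| < eps by rewrite normr0.
exact: (smooth_slice Uopen e0 (smooth_iter_drho j sF)).
Qed.

End RhoCoef.

(** * Taylor coefficients in [r] of functions of [rho = - r^2 / 2] *)

Section EvenTaylor.
Variables (R : realType) (n : nat) (U : set 'rV[R]_n) (eps : R).
Hypothesis Uopen : open U.
Hypothesis eps0 : 0 < eps.
Implicit Types (F G : 'rV[R]_(n + 1) -> R) (x : 'rV[R]_n) (i j : nat).

Notation Om := (tube U eps).
Let Om_open : open Om := tube_open Uopen.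

(* d^2/dr^2 in the variable rho = - r^2 / 2 *)
Definition drr F (z : 'rV[R]_(n + 1)) : R :=
  - 2 * (rho_of z * drho (drho F) z) - drho F z.

Lemma smooth_drr F : smooth_on Om F -> smooth_on Om (drr F).
Proof.
move=> sF; apply: smoothB => //; last exact: smooth_partial.
apply: smoothZ => //; apply: smoothM => //; first exact: smooth_rho.
by apply: smooth_partial; exact: smooth_partial.
Qed.

(** Since [s = r^2 / 4], the second [r]-derivative of s^(i+1) is (2i+2)(2i+1)/4 times s^i. *)
Lemma rho_coef_drr i F x : smooth_on Om F -> U x ->
  rho_coef i (drr F) x = (i.*2.+1)%:R * (i.+1)%:R / 2 * rho_coef i.+1 F x.
Proof.
move=> sF Ux; have sd := smooth_partial (rshift n ord0) sF.
have sm : smooth_on Om (fun z => rho_of z * drho (drho F) z).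
  apply: smoothM; [exact: Om_open|exact: smooth_rho|exact: smooth_partial].
rewrite /drr (rho_coefB Uopen eps0) //; last exact: smoothZ.
rewrite (rho_coefZ Uopen eps0) // (rho_coef_rho_drho Uopen eps0) // rho_coef_drho.
by rewrite -addn1 -addnn -[i.+1]addn1 !natrD; field.
Qed.

Lemma rho_coef_iter_drr j i F x : smooth_on Om F -> U x ->
  rho_coef i (iter j drr F) x =
  (i + j).*2`!%:R / i.*2`!%:R / 4 ^+ j * rho_coef (i + j) F x.
Proof.
move=> sF Ux; elim: j i => [|j IH] i.
  by rewrite addn0 expr0 divr1 divff ?mul1r // pnatr_eq0 -lt0n fact_gt0.
rewrite iterS rho_coef_drr //; last first.
  by elim: j {IH} => //= j; exact: smooth_drr.
rewrite IH addSnnS doubleS 2!factS !natrM exprS.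
have f0 : i.*2`!%:R != 0 :> R by rewrite pnatr_eq0 -lt0n fact_gt0.
have -> : i.*2.+2%:R = 2 * i.+1%:R :> R by rewrite -doubleS -mul2n natrM.
have e0 : (4 : R) ^+ j != 0 by rewrite expf_neq0 // pnatr_eq0.
have i1 : i.+1%:R != 0 :> R by rewrite pnatr_eq0.
have i2 : i.*2.+1%:R != 0 :> R by rewrite pnatr_eq0.
move: (i.+1%:R : R) (i.*2.+1%:R : R) i1 i2 => a b a0 b0.
by field; rewrite a0 b0 f0 e0.
Qed.

Lemma rho_of_r_small (d : R) r : 0 < r < d -> d ^+ 2 <= eps -> `|- r ^+ 2 / 2| < eps.
Proof.
move=> /andP[r0 rd] de.
rewrite mulNr normrN ger0_norm ?divr_ge0 ?sqr_ge0 //.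
have : r ^+ 2 < d ^+ 2 by rewrite ltr_pXn2r // nnegrE ltW // (lt_trans r0).
have : 0 <= r ^+ 2 by rewrite sqr_ge0.
by lra.
Qed.

Lemma is_derive_rho_of_r (r : R) : is_derive r 1 (fun r : R => - r ^+ 2 / 2) (- r).
Proof.
have [h1 h2] := is_deriveZ (- 2^-1) (is_deriveM (is_derive_id r 1) (is_derive_id r 1)).
have -> : (fun r : R => - r ^+ 2 / 2) = - 2^-1 \*: (id * id).
  by apply/funext => s /=; rewrite mulNr mulrC -mulNr expr2.
by apply: DeriveDef => //; rewrite h2 /GRing.scale /=; field.
Qed.

Lemma is_derive_even G x r : smooth_on Om G -> Om (at_rho (- r ^+ 2 / 2) x) ->
  is_derive r 1 (fun r => G (at_rho (- r ^+ 2 / 2) x))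
    (- r * drho G (at_rho (- r ^+ 2 / 2) x)).
Proof.
move=> sG Or.
have dG := derivableP (derivable_slice sG Or).
rewrite -derive1E derive1_slice in dG.
have h := @is_derive_comp1 _ _ (fun s => G (at_rho s x))
  (fun r : R => - r ^+ 2 / 2) r 1 _ _ dG (is_derive_rho_of_r r).
exact: is_derive_eq h (mulrC _ _).
Qed.

(** Agreement is asked for [0 < r < d] only, because the functions to be expanded contain [r^-1].
    The interval is open, so agreement passes to derivatives and the step can be iterated. *)
Lemma derive1n_even_step (d : R) G x (f : R -> R) : d ^+ 2 <= eps -> U x ->
  smooth_on Om G ->
  (forall r, 0 < r < d -> f r = G (at_rho (- r ^+ 2 / 2) x)) ->
  forall r, 0 < r < d -> derive1n 2 f r = drr G (at_rho (- r ^+ 2 / 2) x).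
Proof.
move=> de Ux sG fG.
have Or r : 0 < r < d -> Om (at_rho (- r ^+ 2 / 2) x).
  by move=> rd; apply: tube_at => //; exact: rho_of_r_small rd de.
have near_d (g h : R -> R) r : 0 < r < d ->
    (forall s, 0 < s < d -> g s = h s) -> \forall s \near r, g s = h s.
  move=> rd gh; have : nbhs r [set` `]0, d[].
    by apply: open_nbhs_nbhs; split; [exact: interval_open|rewrite /= in_itv].
  by apply: filterS => s /=; rewrite in_itv /= => /gh.
have d1 r : 0 < r < d -> derive1 f r = - r * drho G (at_rho (- r ^+ 2 / 2) x).
  move=> rd; rewrite derive1E (near_eq_derive _ (near_d _ _ _ rd fG)).
  by have [_ ->] := is_derive_even sG (Or _ rd).
move=> r rd; rewrite /= derive1E (near_eq_derive _ (near_d _ _ _ rd d1)).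
have sdG := smooth_partial (rshift n ord0) sG.
have dG := is_derive_even sdG (Or _ rd).
have dN : is_derive r 1 (fun r : R => - r) (- 1).
  by apply: is_deriveNid.
have [_ ->] := is_deriveM dN dG.
by rewrite /drr rho_of_at /GRing.scale /=; field.
Qed.

Lemma cvg_at_rho_even G x : smooth_on Om G -> U x ->
  G (at_rho (- r ^+ 2 / 2) x) @[r --> 0^'+] --> G (at_rho 0 x).
Proof.
move=> sG Ux; apply: cvg_at_right_filter.
have h0 : - 0 ^+ 2 / 2 = 0 :> R by rewrite expr0n /= oppr0 mul0r.
have [d _] := is_derive_rho_of_r 0.
have c1 : {for (0 : R), continuous (fun r : R => - r ^+ 2 / 2)}.
  exact/differentiable_continuous/derivable1_diffP.
have c2 : {for (0 : R), continuous (fun r : R => at_rho (- r ^+ 2 / 2) x)}.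
  apply: (@continuous_comp _ _ _ _ (fun s : R => at_rho s x) _ c1).
  exact: continuous_at_rhol.
have c3 : {for at_rho (- 0 ^+ 2 / 2) x, continuous G}.
  by rewrite h0; apply: (smooth_continuous sG); exact: tube0.
have c4 := @continuous_comp _ _ _ _ G _ c2 c3.
have -> : G (at_rho 0 x) = G (at_rho (- 0 ^+ 2 / 2) x) by rewrite h0.
exact: c4.
Qed.

(** Near 0 on the right, the derivative of order [j.*2] is [iter j drr F] evaluated at
    [rho = - r^2 / 2], whose limit is its coefficient of degree 0; the factor [4 ^+ j] converts
    powers of [s] into powers of [r^2]. *)
Lemma taylor_coef_even F x (f : R -> R) (d : R) j : 0 < d -> smooth_on Om F -> U x ->
  (forall r, 0 < r < d -> f r = F (at_rho (- r ^+ 2 / 2) x)) ->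
  taylor_coef f j.*2 = rho_coef j F x / 4 ^+ j.
Proof.
move=> d0 sF Ux fF.
wlog de : d d0 fF / d ^+ 2 <= eps.
  (* From [e <= 1] follows [e ^+ 2 <= e <= eps], which keeps [- r ^+ 2 / 2] within the tube for
     [r < e]. *)
  pose e := Num.min d (Num.min 1 eps).
  have ed : e <= d by rewrite ge_min lexx.
  have e1 : e <= 1 by rewrite 2!ge_min lexx orbT.
  have ee : e <= eps by rewrite 2!ge_min lexx !orbT.
  have e0 : 0 < e by rewrite !lt_min d0 eps0 ltr01.
  move=> /(_ e e0); apply.
    by move=> r /andP[r0 re]; apply: fF; rewrite r0 (lt_le_trans re).
  apply: le_trans ee; rewrite expr2 -[leRHS]mulr1 ler_pM // ltW //.
have siter i : smooth_on Om (iter i drr F) by elim: i => //= i; exact: smooth_drr.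
have fj : forall r, 0 < r < d ->
    derive1n j.*2 f r = iter j drr F (at_rho (- r ^+ 2 / 2) x).
  elim: j => [|j IH] r rd; first exact: fF.
  rewrite doubleS -[derive1n _.+2 f]/(derive1n 2 (derive1n j.*2 f)).
  exact: derive1n_even_step (siter j) IH _ rd.
rewrite /taylor_coef.
have -> : lim (derive1n j.*2 f r @[r --> 0^'+]) = iter j drr F (at_rho 0 x).
  apply: cvg_lim => //.
  apply: cvg_trans (cvg_at_rho_even (siter j) Ux); apply: near_eq_cvg.
  near=> r; rewrite fj //; apply/andP; split; near: r.
    exact: nbhs_right_gt.
  exact: nbhs_right_lt.
rewrite -[iter j drr F _]rho_coef0 rho_coef_iter_drr // add0n fact0 divr1.
have f0 : j.*2`!%:R != 0 :> R by rewrite pnatr_eq0 -lt0n fact_gt0.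
have e0 : (4 : R) ^+ j != 0 by rewrite expf_neq0 // pnatr_eq0.
by field; rewrite f0 e0.
Unshelve. all: by end_near. Qed.

End EvenTaylor.

(** * The operators R_k on coefficient sequences *)

Section SequenceAlgebra.
Variables (R : realFieldType) (V : lmodType R) (S : V -> Prop) (m : nat -> V -> V).
Hypothesis S0 : S 0.
Hypothesis SD : forall u v, S u -> S v -> S (u + v).
Hypothesis SZ : forall (a : R) u, S u -> S (a *: u).
Hypothesis Sm : forall c u, S u -> S (m c u).
Hypothesis mD : forall c u v, S u -> S v -> m c (u + v) = m c u + m c v.
Hypothesis mZ : forall c (a : R) u, S u -> m c (a *: u) = a *: m c u.
Implicit Types (a b : nat -> V) (k : R).

(** This is R_k on coefficient sequences in [s]. The map [m c] stands for the coefficient of degree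
    [c] of M(r), and [S] for smoothness, the condition under which [m c] is linear. *)
Definition seqop k a (j : nat) : V :=
  (j.+1%:R * (j.+1%:R - k)) *: a j.+1 + \sum_(c < j.+1) m c (a (j - c)%N).

Definition allS a := forall j, S (a j).

Lemma m0 c : m c 0 = 0.
Proof. by have := mZ c 0 S0; rewrite !scale0r. Qed.

Lemma S_sum (I : Type) (r : seq I) (P : pred I) (F : I -> V) :
  (forall i, S (F i)) -> S (\sum_(i <- r | P i) F i).
Proof. by move=> SF; apply: (big_ind S) => // i _; exact: SF. Qed.

Lemma m_sum c (I : Type) (r : seq I) (P : pred I) (F : I -> V) :
  (forall i, S (F i)) -> m c (\sum_(i <- r | P i) F i) = \sum_(i <- r | P i) m c (F i).
Proof.
move=> SF; elim: r => [|i r IH]; first by rewrite !big_nil m0.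
by rewrite !big_cons; case: (P i) => //; rewrite mD ?IH //; exact: S_sum.
Qed.

Lemma seqop_S k a : allS a -> allS (seqop k a).
Proof.
move=> Sa j; apply: SD; first exact/SZ/Sa.
by apply: S_sum => c; exact/Sm/Sa.
Qed.

Lemma seqopD k a b : allS a -> allS b ->
  seqop k (fun j => a j + b j) = (fun j => seqop k a j + seqop k b j).
Proof.
move=> Sa Sb; apply/funext => j; rewrite /seqop.
under eq_bigr do rewrite mD //.
by rewrite big_split scalerDr addrACA.
Qed.

Lemma seqopZ k (x : R) a : allS a ->
  seqop k (fun j => x *: a j) = (fun j => x *: seqop k a j).
Proof.
move=> Sa; apply/funext => j; rewrite /seqop.
under eq_bigr do rewrite mZ //.
by rewrite scalerDr scaler_sumr !scalerA mulrC.
Qed.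

(** The operator of index [ks p] acts first and that of index [ks 1] last, so that a chain of length
    [N] is one of length [N.-1] applied to the result of its operator of index [ks N]. *)
Fixpoint chain (ks : nat -> R) (p : nat) a : nat -> V :=
  if p is p'.+1 then chain ks p' (seqop (ks p'.+1) a) else a.

Lemma chainD ks p a b : allS a -> allS b ->
  chain ks p (fun j => a j + b j) = (fun j => chain ks p a j + chain ks p b j).
Proof.
elim: p a b => //= p IH a b Sa Sb.
by rewrite seqopD // IH //; exact: seqop_S.
Qed.

Lemma chainZ ks p (x : R) a : allS a ->
  chain ks p (fun j => x *: a j) = (fun j => x *: chain ks p a j).
Proof.
by elim: p a => //= p IH a Sa; rewrite seqopZ // IH //; exact: seqop_S.
Qed.

Definition shift_seq a (j : nat) : V := if j is j'.+1 then a j' else 0.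

Lemma shift_seq_S a : allS a -> allS (shift_seq a).
Proof. by move=> Sa [|j] /=. Qed.

(** [shift_seq] is multiplication by [s]. It commutes with the [m c], and the coefficients of the
    derivative terms differ by (j+1)(j+1-k) - j(j+2-k) = 1 - k. *)
Lemma seqop_shift k a : allS a ->
  seqop k (shift_seq a) =
  (fun j => shift_seq (seqop (k - 2) a) j + (1 - k) *: a j).
Proof.
move=> Sa; apply/funext => -[|j]; rewrite /seqop /=.
  by rewrite big_ord1 /= m0 addr0 mul1r add0r.
rewrite big_ord_recr /= subnn m0 addr0.
have -> : \sum_(c < j.+1) m c (shift_seq a (j.+1 - c)) =
          \sum_(c < j.+1) m c (a (j - c)%N).
  by apply: eq_bigr => c _; rewrite subSn // -ltnS.
rewrite [RHS]addrAC -scalerDl; congr (_ *: _ + _).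
by rewrite -[j.+2]addn1 natrD; ring.
Qed.

Variable N : nat.

Definition chain_index (j : nat) : R := (j.*2)%:R - N%:R.

(** Moving [s] to the left past an operator lowers its index by 2, to the index of its neighbour.
    Hence every commutator leaves the same shorter chain, and the scalars 1 - (2i - N) for i = 1,
    ..., p simply add up to p (N - p). The sequence [b] collects what retains a factor [s] and is
    invisible in degree 0. *)
Lemma chain_shift p a : allS a ->
  exists b, chain chain_index p (shift_seq a) =
    (fun j => shift_seq b j + (p%:R * (N%:R - p%:R)) *: chain chain_index p.-1 a j).
Proof.
elim: p a => [|p IH] a Sa.
  by exists a; apply/funext => j; rewrite /= mul0r scale0r addr0.
rewrite /= seqop_shift //.
have ki : chain_index p.+1 - 2 = chain_index p.
  by rewrite /chain_index doubleS -addn2 natrD; ring.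
rewrite ki chainD; last 2 first.
- exact/shift_seq_S/seqop_S.
- by move=> j; exact: SZ.
have [b ->] := IH _ (seqop_S (chain_index p) Sa).
exists b; apply/funext => j; rewrite chainZ // -addrA; congr (_ + _).
case: p {IH b ki} => [|p] /=.
  by rewrite mul0r scale0r add0r /chain_index -muln2 natrM; congr (_ *: _); ring.
rewrite -scalerDl; congr (_ *: _).
by rewrite /chain_index -muln2 natrM -[p.+2]addn2 -[p.+1]addn1 !natrD; ring.
Qed.

(** A sequence starting with 0 is a multiple of [s], and the scalar [p * (N - p)] of [chain_shift]
    is zero at [p = N]. *)
Lemma chain_vanish a : allS a -> a 0%N = 0 -> chain chain_index N a 0%N = 0.
Proof.
move=> Sa a0.
have -> : a = shift_seq (fun j => a j.+1) by apply/funext => -[|j].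
have [j|b ->] := @chain_shift N (fun j => a j.+1); first exact: Sa.
by rewrite subrr mulr0 scale0r addr0.
Qed.

(** The [m c] never lower the degree, so [p] operators bring degree [p] down to 0 only if each
    contributes its derivative term. The operator of index 2i - N takes degree i to i - 1 with
    factor i (i - (2i - N)) = i (N - i). *)
Lemma chain_low p a : (forall j, (j < p)%N -> a j = 0) ->
  chain chain_index p a 0%N =
  (\prod_(i < p) (i.+1%:R * (N%:R - i.+1%:R))) *: a p.
Proof.
elim: p a => [|p IH] a a0; first by rewrite big_ord0 scale1r.
have sum0 q : (q <= p)%N -> \sum_(c < q.+1) m c (a (q - c)%N) = 0.
  by move=> qp; rewrite big1 // => c _; rewrite a0 ?m0 // ltnS (leq_trans (leq_subr _ _)).
rewrite /= IH => [|j jp]; last first.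
  by rewrite /seqop sum0 ?(ltnW jp) // a0 ?scaler0 ?addr0 // ltnS.
rewrite /seqop sum0 // addr0 scalerA big_ord_recr /=; congr (_ * _ *: _).
by congr (_ * _); rewrite /chain_index -muln2 natrM; ring.
Qed.

(** The inverse, up to sign, of the factor t (t - N) with which R_N takes degree t to t - 1. The
    convention [0^-1 = 0] makes [weight 0] vanish, which gives the solution [f] below the initial
    value 0. *)
Definition weight (t : nat) : R := (t%:R * (N%:R - t%:R))^-1.

(* The sequence f = weight * g solves R_N f = - psi up to an obstruction, g N, in
   degree N - 1; applying the remaining factors, [chain_vanish] disposes of f. *)
Lemma chain_obstruction psi (g : nat -> V) : (0 < N)%N -> allS psi -> allS g ->
  (forall j, (j < N)%N ->
     g j.+1 = psi j + \sum_(c < j) m c (weight (j - c) *: g (j - c)%N)) ->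
  chain chain_index N.-1 psi 0%N = (N.-1`!%:R ^+ 2) *: g N.
Proof.
move=> N0 Spsi Sg gE.
pose f j := weight j *: g j.
have Sf : allS f by move=> j; exact: SZ.
have f0 : f 0%N = 0 by rewrite /f /weight mul0r invr0 scale0r.
have kN : chain_index N = N%:R by rewrite /chain_index -addnn natrD; ring.
pose b j := psi j + seqop N%:R f j.
have chainb : chain chain_index N.-1 b 0%N = chain chain_index N.-1 psi 0%N.
  rewrite /b chainD //; last exact: seqop_S.
  have := chain_vanish Sf f0.
  by rewrite -[X in chain _ X]prednK //= prednK // kN => ->; rewrite addr0.
have seqf j : (j < N)%N ->
    seqop N%:R f j = (j.+1%:R * (j.+1%:R - N%:R)) *: f j.+1 + g j.+1 - psi j.
  move=> jN; rewrite /seqop big_ord_recr /= subnn f0 m0 addr0 gE //.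
  by rewrite -!addrA; congr (_ + _); rewrite addrCA subrr addr0.
(* Below degree [N - 1] the factor [N - j.+1] is nonzero, so [weight] inverts the derivative
   coefficient up to sign and the term [g j.+1] is cancelled. *)
have b_low j : (j < N.-1)%N -> b j = 0.
  move=> jN; have jN' : (j.+1 < N)%N by rewrite -ltn_predRL.
  rewrite /b seqf ?(ltnW jN') // addrCA subrr addr0 /f scalerA.
  suff -> : j.+1%:R * (j.+1%:R - N%:R) * weight j.+1 = -1 by rewrite scaleN1r addNr.
  have h1 : j.+1%:R != 0 :> R by rewrite pnatr_eq0.
  have h2 : N%:R - j.+1%:R != 0 :> R by rewrite subr_eq0 eqr_nat gtn_eqF.
  rewrite /weight; move: (j.+1%:R : R) h1 h2 => t h1 h2.
  by field; rewrite h1 h2.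
(* In degree [N - 1] the derivative coefficient of R_N is zero, whatever [f N] is, and [g N] is left
   over. *)
have b_N : b N.-1 = g N.
  rewrite /b seqf ?ltn_predL // prednK // subrr mulr0 scale0r add0r.
  by rewrite addrCA subrr addr0.
rewrite -chainb chain_low // b_N; congr (_ *: _).
rewrite big_split /= expr2; congr (_ * _).
  by rewrite -natr_prod fact_prod big_add1 /= big_mkord.
(* Read backwards, the factors [N - i.+1] run through 1, ..., N - 1 and give the second
   factorial. *)
rewrite fact_prod big_add1 /= big_mkord natr_prod (reindex_inj rev_ord_inj) /=.
apply: eq_bigr => i _; have iN : (i < N.-1)%N by [].
rewrite subnSK // natrB ?(ltnW iN) // -{1}(prednK N0) -[N.-1.+1]addn1 -[i.+1]addn1.
by rewrite !natrD; ring.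
Qed.

End SequenceAlgebra.

(** * The obstruction as a sum over compositions *)

Section CompositionSums.
Variables (R : realFieldType) (V : lmodType R) (S : V -> Prop) (m : nat -> V -> V).
Hypothesis S0 : S 0.
Hypothesis SD : forall u v, S u -> S v -> S (u + v).
Hypothesis SZ : forall (a : R) u, S u -> S (a *: u).
Hypothesis Sm : forall c u, S u -> S (m c u).
Hypothesis mD : forall c u v, S u -> S v -> m c (u + v) = m c u + m c v.
Hypothesis mZ : forall c (a : R) u, S u -> m c (a *: u) = a *: m c u.
Variables (N : nat) (psi : nat -> V).
Hypothesis Spsi : forall j, S (psi j).

(* The weights of the nonempty proper suffixes of the composition (I, a). *)
Fixpoint comp_weight (I : seq nat) (a : nat) : R :=
  if I is i :: I' then weight R N (sumn (rcons I' a)) * comp_weight I' a else 1.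

(** Both indices are lowered by one because M_2i is the coefficient of degree i - 1 of M(r), up to
    the factor (i-1)!^2, and W_2a enters psi in degree a - 1. *)
Definition comp_op (I : seq nat) (a : nat) : V :=
  foldr (fun i => m i.-1) (psi a.-1) I.

Definition comp_term (I : seq nat) (a : nat) : V := comp_weight I a *: comp_op I a.

(** Indexed exactly as in [sum_compositions], so that the final comparison is term by term, but with
    the total [j] separate from the bound [N]: the recursion runs over [j] while the weights refer
    to [N]. *)
Definition comp_sum_len (k j : nat) : V :=
  \sum_(I : k.-tuple 'I_N.+1)
    \sum_(a < N.+1 | is_composition j (rcons (map val I) a)) comp_term (map val I) a.

Definition comp_sum (j : nat) : V := \sum_(k < N) comp_sum_len k j.

Lemma comp_op_S I a : S (comp_op I a).
Proof. by elim: I => //= i I IH; exact: Sm. Qed.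

Lemma comp_term_S I a : S (comp_term I a).
Proof. by apply: SZ; exact: comp_op_S. Qed.

Lemma comp_sum_len_S k j : S (comp_sum_len k j).
Proof.
apply: (S_sum S0 SD) => I; apply: (S_sum S0 SD) => a; exact: comp_term_S.
Qed.

Lemma comp_sum_S j : S (comp_sum j).
Proof. by apply: (S_sum S0 SD) => k; exact: comp_sum_len_S. Qed.

Lemma composition_size j I : is_composition j I -> (size I <= j)%N.
Proof.
move=> /andP[aI /eqP <-]; elim: I aI => //= i I IH /andP[i1 aI].
by rewrite -add1n leq_add // IH.
Qed.

Lemma composition_cons j i I : is_composition j (i :: I) =
  [&& (0 < i)%N, (i <= j)%N & is_composition (j - i) I].
Proof.
rewrite /is_composition /=; case: (ltnP 0 i) => //= i0.
case: (leqP i j) => /= ij.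
  by congr (_ && _); rewrite -[RHS](eqn_add2l i) subnKC.
by rewrite [_ == j]gtn_eqF ?andbF // (leq_trans ij) // leq_addr.
Qed.

Lemma comp_sum_len_large k j : (j <= k)%N -> comp_sum_len k j = 0.
Proof.
move=> jk; rewrite /comp_sum_len big1 // => I _; rewrite big_pred0 // => a.
apply/negP => /composition_size; rewrite size_rcons size_map size_tuple.
by rewrite ltnNge jk.
Qed.

Lemma comp_sum_len0 j : (j < N)%N -> comp_sum_len 0 j.+1 = psi j.
Proof.
move=> jN; rewrite /comp_sum_len (big_pred1 [tuple]) => [|I]; last first.
  by apply/esym/eqP; exact: tuple0.
have jN1 : (j.+1 < N.+1)%N by [].
rewrite (big_pred1 (Ordinal jN1)) => [|a].
  by rewrite /comp_term /comp_op /= scale1r.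
rewrite /= /is_composition /= addn0 andbT -val_eqE /=.
by case: eqP => [->|]; rewrite ?andbT ?andbF.
Qed.

(** Removing the first entry [i] leaves a composition of [j - i]. This is the longest proper suffix,
    so it accounts for exactly one new weight; it is nonempty, whence [i < j]. *)
Lemma comp_sum_lenS k j : comp_sum_len k.+1 j =
  \sum_(i < N.+1 | (0 < i < j)%N) m i.-1 (weight R N (j - i) *: comp_sum_len k (j - i)).
Proof.
rewrite {1}/comp_sum_len.
pose cons_t (p : 'I_N.+1 * k.-tuple 'I_N.+1) := [tuple of p.1 :: p.2].
rewrite (reindex cons_t) /=; last first.
  exists (fun t : k.+1.-tuple 'I_N.+1 => (thead t, [tuple of behead t])).
    by move=> [i I] _; congr (_, _); apply: val_inj.
  by move=> t _; rewrite /cons_t /= -tuple_eta.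
rewrite -(pair_bigA _ (fun (i : 'I_N.+1) (I : k.-tuple 'I_N.+1) => \sum_(a < N.+1 |
    is_composition j (rcons (map val (i :: I)) a)) comp_term (map val (i :: I)) a)) /=.
rewrite [RHS]big_mkcond /=; apply: eq_bigr => i _.
case: ifPn => [/andP[i0 ij]|iP]; last first.
  rewrite big1 // => I _; rewrite big_pred0 // => a; rewrite composition_cons.
  apply: contraNF iP => /and3P[-> ij /composition_size].
  by rewrite size_rcons /= -(subn_gt0 i j); exact: leq_trans.
rewrite (mZ _ _ (comp_sum_len_S _ _)) (m_sum S0 SD mD mZ); last first.
  by move=> I; apply: (S_sum S0 SD) => a; exact: comp_term_S.
rewrite scaler_sumr; apply: eq_bigr => I _.
rewrite (m_sum S0 SD mD mZ) => [|a]; last exact: comp_term_S.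
rewrite scaler_sumr; apply: eq_big => [a|a].
  by rewrite composition_cons i0 (ltnW ij).
rewrite composition_cons => /and3P[_ _ /andP[_ /eqP aE]].
by rewrite /comp_term /= aE mZ ?scalerA //; exact: comp_op_S.
Qed.

(** This is the recursion required by [chain_obstruction]: an empty [I] contributes [psi j], and a
    composition with first entry [c.+1] contributes to the term of index [c]. *)
Lemma comp_sum_rec j : (j < N)%N ->
  comp_sum j.+1 = psi j +
    \sum_(c < j) m c (weight R N (j - c) *: comp_sum (j - c)).
Proof.
move=> jN; rewrite /comp_sum.
have split_first (F : nat -> V) : \sum_(k < N) F k = F 0%N + \sum_(k < N.-1) F k.+1.
  by case: N jN => // N' _; rewrite big_ord_recl.
rewrite (split_first (comp_sum_len^~ j.+1)) comp_sum_len0 //; congr (_ + _).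
under eq_bigr => k _ do rewrite comp_sum_lenS.
rewrite exchange_big /= big_mkcond big_ord_recl /= add0r.
rewrite (big_ord_widen N (fun c => m c (weight R N (j - c) *: comp_sum (j - c)%N)) (ltnW jN)).
rewrite [RHS]big_mkcond; apply: eq_bigr => i _ /=.
rewrite /bump /= add1n ltnS; case: ifP => // ij; rewrite subSS.
rewrite /comp_sum scaler_sumr (m_sum S0 SD mD mZ); last first.
  by move=> k; apply: SZ; exact: comp_sum_len_S.
have N0 : (0 < N)%N by exact: leq_ltn_trans jN.
have split_last (F : nat -> V) : \sum_(k < N) F k = \sum_(k < N.-1) F k + F N.-1.
  by case: N N0 => // N' _; rewrite big_ord_recr.
(* One length too many appears on the right. Its term is zero, because a composition of
   [j - i <= N - 1] has at most [N - 1] entries, hence fewer than [N - 1] before the last. *)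
rewrite (split_last (fun k => m i (weight R N (j - i) *: comp_sum_len k (j - i)))) [X in _ = _ + X](_ : _ = 0) ?addr0 //.
rewrite comp_sum_len_large ?scaler0 ?(m0 S0 mZ) //.
by rewrite (leq_trans (leq_subr _ _)) // -ltnS prednK.
Qed.

Lemma chain_comp_sum : (0 < N)%N ->
  chain m (chain_index R N) N.-1 psi 0%N = (N.-1`!%:R ^+ 2) *: comp_sum N.
Proof.
move=> N0; apply: (chain_obstruction S0 SD SZ Sm mD mZ) => //.
  exact: comp_sum_S.
by move=> j jN; exact: comp_sum_rec.
Qed.

(** The weight of a suffix with sum t is 1 / (t (N - t)), and N - t is the sum of the complementary
    prefix once the whole composition has total [N]. *)
Lemma comp_weight_prod I a : sumn (rcons I a) = N ->
  comp_weight I a =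
  \prod_(1 <= j < size (rcons I a))
    ((sumn (take j (rcons I a)))%:R * (sumn (drop j (rcons I a)))%:R)^-1.
Proof.
move=> sN.
transitivity (\prod_(1 <= j < size (rcons I a)) weight R N (sumn (drop j (rcons I a)))).
  elim: I {sN} => [|i I IH] /=; first by rewrite big_geq.
  rewrite IH [RHS]big_ltn ?size_rcons // big_add1 /= drop0; congr (_ * _); by rewrite ?size_rcons !big_add1.
apply: eq_big_nat => j _; rewrite /weight mulrC; congr (_ * _)^-1.
by rewrite -sN -{1}(cat_take_drop j (rcons I a)) sumn_cat natrD addrK.
Qed.

End CompositionSums.

(** * The Laplacians of the metrics g_rho and conjugation by w *)

Section Signature.
Variables (R : realType) (n p q : nat).
Implicit Types A B : 'M[R]_n.

(** Determinants in [S^T *m A *m S = diag] give det(S)^2 det(A) = (-1)^q. Metrics of one signature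
    thus have positive determinant ratios, and the roots defining w are smooth. *)
Lemma signature_det A : has_signature p q A -> 0 < (-1) ^+ q * \det A.
Proof.
move=> [pq [S Su SA]].
have dS : \det S != 0 by rewrite -unitfE -unitmxE.
have : \det (S^T *m A *m S) = (-1) ^+ q.
  rewrite SA det_diag; subst n.
  under eq_bigr do rewrite mxE.
  rewrite big_split_ord /= big1 ?mul1r => [|i _]; last by rewrite ltn_ord.
  under eq_bigr do rewrite ltnNge leq_addr /=.
  by rewrite prodr_const card_ord.
rewrite !det_mulmx det_tr => E.
have : 0 < (\det S) ^+ 2 * ((-1) ^+ q * \det A).
  have -> : \det S ^+ 2 * ((-1) ^+ q * \det A) = (-1) ^+ q * (\det S * \det A * \det S) by ring.
  by rewrite E -expr2 sqrr_sign ltr01.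
by rewrite pmulr_rgt0 // exprn_even_gt0.
Qed.

Lemma signature_unit A : has_signature p q A -> A \in unitmx.
Proof.
move=> /signature_det; rewrite unitmxE unitfE; apply: contraTneq => ->.
by rewrite mulr0 ltxx.
Qed.

Lemma signature_det_ratio A B : has_signature p q A -> has_signature p q B ->
  0 < \det A / \det B.
Proof.
move=> /signature_det dA /signature_det dB.
have := divr_gt0 dA dB; rewrite invfM mulrACA divff ?mul1r //.
by rewrite signr_eq0.
Qed.

End Signature.

(** With [h] the inverse metric and [D e i j] the derivative of g_ij along e, the left side is h^ij
    Gamma^k_ij. By symmetry the first two terms of the symbol coincide and give - d_i h^ik, the
    derivative of the inverse matrix; the third gives half the gradient of log det. *)
Lemma contract_christoffel (R : realType) (n : nat) (h : 'I_n -> 'I_n -> R)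
    (D : 'I_n -> 'I_n -> 'I_n -> R) (k : 'I_n) :
  (forall i j, h i j = h j i) -> (forall e i j, D e i j = D e j i) ->
  \sum_i \sum_j h i j * (2^-1 * \sum_l h k l * (D i j l + D j i l - D l i j)) =
  \sum_i \sum_a \sum_b h i a * D i a b * h b k
  - \sum_l 2^-1 * (\sum_a \sum_b h a b * D l b a) * h k l.
Proof.
move=> hs Ds.
pose T (f : 'I_n -> 'I_n -> 'I_n -> R) := \sum_i \sum_j \sum_l h i j * h k l * f i j l.
have -> : \sum_i \sum_j h i j * (2^-1 * \sum_l h k l * (D i j l + D j i l - D l i j)) =
    2^-1 * (T (fun i j l => D i j l) + T (fun i j l => D j i l)
            - T (fun i j l => D l i j)).
  rewrite /T -big_split -sumrB mulr_sumr; apply: eq_bigr => i _.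
  rewrite -big_split -sumrB mulr_sumr; apply: eq_bigr => j _.
  rewrite -big_split -sumrB mulrCA !mulr_sumr; apply: eq_bigr => l _ /=; ring.
have -> : T (fun i j l => D j i l) = T (fun i j l => D i j l).
  rewrite /T exchange_big; apply: eq_bigr => i _; apply: eq_bigr => j _.
  by apply: eq_bigr => l _; rewrite (hs j i).
have -> : \sum_i \sum_a \sum_b h i a * D i a b * h b k = T (fun i j l => D i j l).
  apply: eq_bigr => i _; apply: eq_bigr => j _; apply: eq_bigr => l _.
  by rewrite (hs l k); ring.
have -> : \sum_l 2^-1 * (\sum_a \sum_b h a b * D l b a) * h k l =
    2^-1 * T (fun i j l => D l i j).
  rewrite /T mulr_sumr.
  under [RHS]eq_bigr do rewrite exchange_big.
  rewrite -mulr_sumr exchange_big mulr_sumr; apply: eq_bigr => l _.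
  rewrite -mulrA mulr_suml; congr (_ * _); apply: eq_bigr => i _.
  rewrite mulr_suml; apply: eq_bigr => j _; rewrite (Ds l j i); ring.
by field.
Qed.

Lemma sum_combination4 (R : pzRingType) (I : finType) (x y : R) (L A B C D : I -> R) :
  (forall i, L i = x * A i + B i + (y * C i + D i)) ->
  \sum_i L i = x * (\sum_i A i) + \sum_i B i + (y * (\sum_i C i) + \sum_i D i).
Proof.
by move=> LE; rewrite (eq_bigr _ (fun i _ => LE i)) !big_split /= !mulr_sumr.
Qed.

Lemma sum_combination2 (R : pzRingType) (I : finType) (x y : R) (L A C : I -> R) :
  (forall i, L i = x * A i + y * C i) ->
  \sum_i L i = x * (\sum_i A i) + y * (\sum_i C i).
Proof.
by move=> LE; rewrite (eq_bigr _ (fun i _ => LE i)) !big_split /= !mulr_sumr.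
Qed.

Section Geometry.
Variables (R : realType) (n p q : nat) (U : set 'rV[R]_n) (eps : R).
Hypothesis Uopen : open U.
Hypothesis eps0 : 0 < eps.
Variable gr : R -> 'rV[R]_n -> 'M[R]_n.
Notation Om := (tube U eps).
Let Om_open : open Om := tube_open Uopen.

Definition gmat (z : 'rV[R]_(n + 1)) : 'M[R]_n := gr (rho_of z) (lsubmx z).
Definition gmat0 (z : 'rV[R]_(n + 1)) : 'M[R]_n := gr 0 (lsubmx z).

Hypothesis gmat_smooth : forall i j, smooth_on Om (fun z => gmat z i j).
Hypothesis gmat_sym : forall z, Om z -> (gmat z)^T = gmat z.
Hypothesis gmat_sig : forall z, Om z -> has_signature p q (gmat z).

Implicit Types (F f : 'rV[R]_(n + 1) -> R) (z : 'rV[R]_(n + 1)) (x : 'rV[R]_n).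

Lemma gmat_at rho x : gmat (at_rho rho x) = gr rho x.
Proof. by rewrite /gmat rho_of_at lsubmx_at. Qed.

Lemma gmat0E z : gmat0 z = gmat (at_rho 0 (lsubmx z)).
Proof. by rewrite gmat_at. Qed.

Lemma tube_base z : Om z -> Om (at_rho 0 (lsubmx z)).
Proof. by move=> [Uz _]; apply: tube_at; rewrite ?normr0. Qed.

Lemma gmat_unit z : Om z -> gmat z \in unitmx.
Proof. by move=> /gmat_sig; exact: signature_unit. Qed.

Lemma gmat0_unit z : Om z -> gmat0 z \in unitmx.
Proof. by move=> /tube_base /gmat_unit; rewrite gmat0E. Qed.

Lemma gmat0_smooth i j : smooth_on Om (fun z => gmat0 z i j).
Proof.
have e : `|0 : R| < eps by rewrite normr0.
have sl := smooth_lift eps Uopen (smooth_slice Uopen e (gmat_smooth i j)).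
by move=> k; apply: (Ck_eq Om_open _ (sl k)) => z _; rewrite /= gmat0E.
Qed.

Definition ginv (i j : 'I_n) z : R := invmx (gmat z) i j.

Lemma ginv_smooth i j : smooth_on Om (ginv i j).
Proof. exact: (smooth_invmx Om_open gmat_smooth gmat_unit). Qed.

Lemma ginv_sym i j z : Om z -> ginv i j z = ginv j i z.
Proof. by move=> Oz; rewrite /ginv -[in LHS](gmat_sym Oz) -trmx_inv mxE. Qed.

Lemma dgmat_sym e i j z : Om z ->
  partial_mx e gmat z i j = partial_mx e gmat z j i.
Proof.
move=> Oz; rewrite !mxE; apply: (eq_partial Om_open) => // y Oy.
by rewrite -[in LHS](gmat_sym Oy) mxE.
Qed.

Lemma partial_ginv e i j z : Om z ->
  partial e (ginv i j) z =
  - \sum_k \sum_l ginv i k z * partial_mx e gmat z k l * ginv l j z.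
Proof.
move=> Oz; have := partial_invmx Om_open e gmat_smooth gmat_unit Oz.
move=> /(congr1 (fun B : 'M[R]_n => B i j)); rewrite [LHS]mxE => ->.
rewrite !mxE; congr (- _); rewrite exchange_big /=; apply: eq_bigr => l _.
by rewrite mxE mulr_suml.
Qed.

(** This is W(r) in the variable [rho]; the nested square roots follow the definitions of V and
    W. *)
Definition wden z : R := Num.sqrt (Num.sqrt (\det (gmat z) / \det (gmat0 z))).

Lemma det_ratio_gt0 z : Om z -> 0 < \det (gmat z) / \det (gmat0 z).
Proof.
move=> Oz; rewrite gmat0E.
by apply: (signature_det_ratio (gmat_sig Oz)); exact: gmat_sig (tube_base Oz).
Qed.

Lemma det_gmat_neq0 z : Om z -> \det (gmat z) != 0.
Proof. by move=> /gmat_unit; rewrite unitmxE unitfE. Qed.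

Lemma det_gmat0_neq0 z : Om z -> \det (gmat0 z) != 0.
Proof. by move=> /gmat0_unit; rewrite unitmxE unitfE. Qed.

Lemma det_ratio_smooth : smooth_on Om (fun z => \det (gmat z) / \det (gmat0 z)).
Proof.
apply: smoothM => //; first exact: smooth_det.
apply: smoothV => //; first exact: det_gmat0_neq0.
by apply: smooth_det => //; exact: gmat0_smooth.
Qed.

Lemma wden_gt0 z : Om z -> 0 < wden z.
Proof. by move=> /det_ratio_gt0 h; rewrite !sqrtr_gt0. Qed.

Lemma wden_neq0 z : Om z -> wden z != 0.
Proof. by move=> /wden_gt0 h; rewrite gt_eqF. Qed.

Lemma wden_smooth : smooth_on Om wden.
Proof.
apply: smooth_sqrt => //; first by move=> z /det_ratio_gt0; rewrite sqrtr_gt0.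
by apply: smooth_sqrt => //; [exact: det_ratio_gt0|exact: det_ratio_smooth].
Qed.

(* The derivative of log det of the metrics, by Jacobi's formula. *)
Definition dlog e z : R := \tr (invmx (gmat z) *m partial_mx e gmat z).
Definition dlog0 e z : R := \tr (invmx (gmat0 z) *m partial_mx e gmat0 z).

Lemma partial_wden e z : Om z ->
  partial e wden z = wden z / 4 * (dlog e z - dlog0 e z).
Proof.
move=> Oz; have r0 := det_ratio_gt0 Oz.
have sv : smooth_on Om (fun z => Num.sqrt (\det (gmat z) / \det (gmat0 z))).
  by apply: smooth_sqrt => //; [exact: det_ratio_gt0|exact: det_ratio_smooth].
have v0 : 0 < Num.sqrt (\det (gmat z) / \det (gmat0 z)) by rewrite sqrtr_gt0.
rewrite (partial_sqrt e sv Oz v0) (partial_sqrt e det_ratio_smooth Oz r0).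
have sd := smooth_det Om_open gmat_smooth.
have sd0 := smooth_det Om_open gmat0_smooth.
rewrite (@partialM _ _ Om) //; last by apply: smoothV => // y; exact: det_gmat0_neq0.
rewrite (partialV e sd0 Oz (det_gmat0_neq0 Oz)).
rewrite (partial_det Om_open e gmat_smooth Oz (gmat_unit Oz)).
rewrite (partial_det Om_open e gmat0_smooth Oz (gmat0_unit Oz)).
rewrite -/(dlog e z) -/(dlog0 e z) /wden.
set r := _ / _ in r0 v0 *; set v := Num.sqrt r in v0 *; set w := Num.sqrt v.
have w0 : 0 < w by rewrite sqrtr_gt0.
have vw : v = w ^+ 2 by rewrite sqr_sqrtr // ltW.
have rv : r = v ^+ 2 by rewrite sqr_sqrtr // ltW.
have d0 := det_gmat0_neq0 Oz.
have dE : \det (gmat z) = r * \det (gmat0 z) by rewrite divfK.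
rewrite dE rv vw; clearbody w; move: (\det (gmat0 z)) d0 => d d0.
have w0' : w != 0 by rewrite gt_eqF.
by field; rewrite w0' d0.
Qed.

Lemma drho_wden z : Om z ->
  drho wden z = wden z / 4 * dlog (rshift n ord0) z.
Proof.
move=> Oz; rewrite partial_wden // /dlog0.
rewrite (_ : partial_mx _ gmat0 z = 0) ?mulmx0 ?mxtrace0 ?subr0 //.
apply/matrixP => i j; rewrite !mxE.
exact: (drho_lift (fun x => gr 0 x i j)).
Qed.

Lemma dlog0_smooth e : smooth_on Om (dlog0 e).
Proof.
rewrite /dlog0 /mxtrace; apply: smooth_sum => // i _.
apply: (@smooth_eq _ _ _ Om_open
  (fun z => \sum_j invmx (gmat0 z) i j * partial e (fun z => gmat0 z j i) z)).
  by move=> z _; rewrite mxE; apply: eq_bigr => j _; rewrite mxE.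
apply: smooth_sum => // j _; apply: smoothM => //.
  exact: (smooth_invmx Om_open gmat0_smooth gmat0_unit).
by apply: smooth_partial; exact: gmat0_smooth.
Qed.

Definition flux F (i : 'I_n) z : R := \sum_j ginv i j z * dx j F z.

(** This is delta (g_rho^-1 dF) on the tube. The divergence of g enters only through Gamma^i_ik,
    which is half the derivative of log det g, so [dlog0] replaces the Christoffel symbols. *)
Definition dg F z : R :=
  \sum_i dx i (flux F i) z + \sum_k 2^-1 * dlog0 (lshift 1 k) z * flux F k z.

Definition christ (k i j : 'I_n) z : R :=
  2^-1 * \sum_l ginv k l z *
    (dx i (fun y => gmat y j l) z + dx j (fun y => gmat y i l) z
     - dx l (fun y => gmat y i j) z).

Definition lap F z : R :=
  \sum_i \sum_j ginv i j z * (dx i (dx j F) z - \sum_k christ k i j z * dx k F z).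

Lemma contracted_christ k z : Om z ->
  \sum_i \sum_j ginv i j z * christ k i j z =
  - \sum_i dx i (ginv i k) z - \sum_j 2^-1 * dlog (lshift 1 j) z * ginv k j z.
Proof.
move=> Oz.
pose D (e i j : 'I_n) := partial_mx (lshift 1 e) gmat z i j.
have DE e i j : D e i j = dx e (fun y => gmat y i j) z by rewrite /D mxE.
transitivity (\sum_i \sum_j ginv i j z *
    (2^-1 * \sum_l ginv k l z * (D i j l + D j i l - D l i j))).
  apply: eq_bigr => i _; apply: eq_bigr => j _; congr (_ * (_ * _)).
  by apply: eq_bigr => l _; rewrite !DE.
rewrite (@contract_christoffel _ _ (fun i j => ginv i j z) D); last 2 first.
- by move=> i j; exact: ginv_sym.
- by move=> e i j; exact: dgmat_sym.
congr (_ - _).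
  rewrite -sumrN; apply: eq_bigr => i _.
  by rewrite partial_ginv // opprK.
apply: eq_bigr => l _; congr (_ * _ * _); rewrite /dlog /mxtrace.
by apply: eq_bigr => a _; rewrite mxE.
Qed.

Lemma flux_smooth F i : smooth_on Om F -> smooth_on Om (flux F i).
Proof.
move=> sF; apply: smooth_sum => // j _; apply: smoothM => //; first exact: ginv_smooth.
exact: smooth_partial.
Qed.

Lemma dg_smooth F : smooth_on Om F -> smooth_on Om (dg F).
Proof.
move=> sF; apply: smoothD => //; apply: smooth_sum => // i _.
  by apply: smooth_partial; exact: flux_smooth.
apply: smoothM => //; last exact: flux_smooth.
by apply: smoothZ => //; exact: dlog0_smooth.
Qed.

Lemma dg_eq F f z : (forall y, Om y -> F y = f y) -> Om z -> dg F z = dg f z.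
Proof.
move=> Ff Oz.
have fl i y : Om y -> flux F i y = flux f i y.
  by move=> Oy; apply: eq_bigr => j _; rewrite (eq_partial Om_open _ Oy Ff).
have -> : dg F z = \sum_i dx i (flux f i) z
    + \sum_k 2^-1 * dlog0 (lshift 1 k) z * flux f k z; last by [].
rewrite /dg; apply: (congr2 +%R); apply: eq_bigr => i _; last by rewrite fl.
exact: (eq_partial Om_open _ Oz (fl i)).
Qed.

Lemma partial_flux F i e z : smooth_on Om F -> Om z ->
  partial e (flux F i) z =
  \sum_j (ginv i j z * partial e (dx j F) z + dx j F z * partial e (ginv i j) z).
Proof.
move=> sF Oz; rewrite (partial_sum Om_open) //; last first.
  by move=> j _; apply: smoothM => //; [exact: ginv_smooth|exact: smooth_partial].
apply: eq_bigr => j _; apply: (@partialM _ _ Om) => //; first exact: ginv_smooth.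
exact: smooth_partial.
Qed.

Definition grad_dot F f z : R := \sum_i flux F i z * dx i f z.

Lemma grad_dotC F f z : Om z -> grad_dot F f z = grad_dot f F z.
Proof.
move=> Oz; rewrite /grad_dot /flux.
under eq_bigr do rewrite mulr_suml.
under [RHS]eq_bigr do rewrite mulr_suml.
rewrite [RHS]exchange_big; apply: eq_bigr => i _; apply: eq_bigr => j _.
by rewrite (ginv_sym j i Oz); ring.
Qed.

(** The divergences of g_rho and of g differ by the logarithmic derivative of the ratio of their
    volume densities. This ratio is [wden ^+ 2], whence the factor [2 / wden]. *)
Lemma lap_dg F z : smooth_on Om F -> Om z ->
  lap F z = dg F z + 2 / wden z * grad_dot wden F z.
Proof.
move=> sF Oz.
have -> : grad_dot wden F z = grad_dot F wden z by exact: grad_dotC.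
have -> : lap F z = \sum_i \sum_j ginv i j z * dx i (dx j F) z
    - \sum_k (\sum_i \sum_j ginv i j z * christ k i j z) * dx k F z.
  have -> : \sum_k (\sum_i \sum_j ginv i j z * christ k i j z) * dx k F z =
      \sum_i \sum_j \sum_k ginv i j z * christ k i j z * dx k F z.
    under eq_bigr do rewrite mulr_suml.
    rewrite exchange_big; apply: eq_bigr => i _.
    under eq_bigr do rewrite mulr_suml.
    by rewrite exchange_big.
  rewrite /lap -sumrB; apply: eq_bigr => i _; rewrite -sumrB; apply: eq_bigr => j _.
  rewrite mulrBr mulr_sumr; congr (_ - _); apply: eq_bigr => k _; exact: mulrA.
under [X in _ - X]eq_bigr => k _ do rewrite contracted_christ //.
have -> : dg F z = \sum_i \sum_j ginv i j z * dx i (dx j F) z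
    + \sum_k (\sum_i dx i (ginv i k) z) * dx k F z
    + \sum_k 2^-1 * dlog0 (lshift 1 k) z * flux F k z.
  rewrite /dg; congr (_ + _).
  under eq_bigr => i _ do rewrite partial_flux // big_split /=.
  rewrite big_split; congr (_ + _) => /=.
  rewrite exchange_big; apply: eq_bigr => k _; rewrite mulr_suml.
  by apply: eq_bigr => i _; rewrite mulrC.
have -> : 2 / wden z * grad_dot F wden z =
    \sum_k 2^-1 * (dlog (lshift 1 k) z - dlog0 (lshift 1 k) z) * flux F k z.
  rewrite /grad_dot mulr_sumr; apply: eq_bigr => k _.
  by rewrite partial_wden //; field; exact: wden_neq0.
have -> : \sum_k (- \sum_i dx i (ginv i k) z
      - \sum_j 2^-1 * dlog (lshift 1 j) z * ginv k j z) * dx k F z =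
    - \sum_k (\sum_i dx i (ginv i k) z) * dx k F z
    - \sum_k 2^-1 * dlog (lshift 1 k) z * flux F k z.
  under eq_bigr do rewrite mulrBl.
  rewrite sumrB; congr (_ - _); first by rewrite -sumrN; apply: eq_bigr => k _; rewrite mulNr.
  under eq_bigr do rewrite mulr_suml.
  rewrite exchange_big; apply: eq_bigr => k _; rewrite /flux [RHS]mulr_sumr.
  by apply: eq_bigr => j _; rewrite (ginv_sym j k Oz) mulrA.
have -> : \sum_k 2^-1 * (dlog (lshift 1 k) z - dlog0 (lshift 1 k) z) * flux F k z =
   \sum_k 2^-1 * dlog (lshift 1 k) z * flux F k z -
   \sum_k 2^-1 * dlog0 (lshift 1 k) z * flux F k z.
  by rewrite -[RHS]sumrB; apply: eq_bigr => k _; rewrite mulrBr mulrBl.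
have collect (a b c d : R) : a - (- b - c) = a + b + d + (c - d) by ring.
exact: collect.
Qed.

Lemma dgM F f z : smooth_on Om F -> smooth_on Om f -> Om z ->
  dg (fun y => F y * f y) z = F z * dg f z + f z * dg F z + 2 * grad_dot F f z.
Proof.
move=> sF sf Oz.
have fl i y : Om y -> flux (fun y => F y * f y) i y = F y * flux f i y + f y * flux F i y.
  move=> Oy; rewrite /flux !mulr_sumr -big_split; apply: eq_bigr => j _ /=.
  by rewrite (@partialM _ _ Om) //; ring.
have dfl i : dx i (flux (fun y => F y * f y) i) z =
    F z * dx i (flux f i) z + flux f i z * dx i F z +
    (f z * dx i (flux F i) z + flux F i z * dx i f z).
  rewrite (eq_partial Om_open _ Oz (fl i)).
  have sfl := flux_smooth i sf; have sFl := flux_smooth i sF.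
  rewrite (@partialD _ _ Om) //; try exact: smoothM.
  by rewrite !(@partialM _ _ Om).
have E1 : \sum_i dx i (flux (fun y => F y * f y) i) z =
    F z * (\sum_i dx i (flux f i) z) + grad_dot f F z +
    (f z * (\sum_i dx i (flux F i) z) + grad_dot F f z).
  exact: (sum_combination4 dfl).
have E2 : \sum_k 2^-1 * dlog0 (lshift 1 k) z * flux (fun y => F y * f y) k z =
    F z * (\sum_k 2^-1 * dlog0 (lshift 1 k) z * flux f k z) +
    f z * (\sum_k 2^-1 * dlog0 (lshift 1 k) z * flux F k z).
  have fl' k : 2^-1 * dlog0 (lshift 1 k) z * flux (fun y => F y * f y) k z =
      F z * (2^-1 * dlog0 (lshift 1 k) z * flux f k z) +
      f z * (2^-1 * dlog0 (lshift 1 k) z * flux F k z).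
    rewrite fl //; move: (dlog0 _ z) (flux f k z) (flux F k z) => a b c; ring.
  exact: (sum_combination2 fl').
rewrite {1}/dg E1 E2 (grad_dotC f F Oz) /dg.
have collect (x y a b c d e : R) :
    x * b + a + (y * c + a) + (x * d + y * e) = x * (b + d) + y * (c + e) + 2 * a.
  by ring.
exact: collect.
Qed.

(** Under rho = - r^2 / 2, r^-1 d_r becomes - d_rho, and d_r^2 - (n-1) r^-1 d_r becomes - 2 rho
    d_rho^2 + (n-2) d_rho. The singularity of U(r) at r = 0 is thereby removed. *)
Definition Upot z : R :=
  (- 2 * (rho_of z * drho (drho wden) z) + (n%:R - 2) * drho wden z + dg wden z) / wden z.

Definition Rop (k : R) F z : R :=
  - 2 * (rho_of z * drho (drho F) z) + (2 * k - 2) * drho F z + dg F z - Upot z * F z.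

(* t^(2 - gamma) times the ambient Laplacian of t^gamma f *)
Definition Lop (gamma : R) f z : R :=
  - 2 * (rho_of z * drho (drho f) z)
  + (2 * gamma + n%:R - 2 - rho_of z * dlog (rshift n ord0) z) * drho f z
  + gamma / 2 * dlog (rshift n ord0) z * f z + lap f z.

Lemma Upot_smooth : smooth_on Om Upot.
Proof.
have sw := wden_smooth; have sdw := smooth_partial (rshift n ord0) sw.
apply: smoothM => //; last by apply: smoothV => //; exact: wden_neq0.
apply: smoothD => //; last exact: dg_smooth.
apply: smoothD => //; last by apply: smoothZ.
apply: smoothZ => //; apply: smoothM => //; first exact: smooth_rho.
exact: smooth_partial.
Qed.

Lemma Rop_smooth k F : smooth_on Om F -> smooth_on Om (Rop k F).
Proof.
move=> sF; have sdF := smooth_partial (rshift n ord0) sF.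
apply: smoothB => //; last by apply: smoothM => //; exact: Upot_smooth.
apply: smoothD => //; last exact: dg_smooth.
apply: smoothD => //; last by apply: smoothZ.
apply: smoothZ => //; apply: smoothM => //; first exact: smooth_rho.
exact: smooth_partial.
Qed.

Lemma Rop_eq k F f z : (forall y, Om y -> F y = f y) -> Om z -> Rop k F z = Rop k f z.
Proof.
move=> Ff Oz.
have d y : Om y -> drho F y = drho f y by move=> Oy; exact: (eq_partial Om_open).
rewrite /Rop (eq_partial Om_open _ Oz d) d // Ff // (dg_eq Ff) //.
Qed.

(** With d_rho w = (w/4) [dlog], the cross term of - 2 rho d_rho^2 is the [- rho * dlog] term of
    [Lop]. The difference between (2k - 2) and the (n - 2) of [Upot] is 2 gamma, which yields
    gamma/2 times [dlog]. The cross term of [dg] is the one in [lap_dg]. *)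
Lemma Lop_conj gamma f z : smooth_on Om f -> Om z ->
  wden z * Lop gamma f z = Rop (gamma + n%:R / 2) (fun y => wden y * f y) z.
Proof.
move=> sf Oz; have sw := wden_smooth.
have sdw := smooth_partial (rshift n ord0) sw.
have sdf := smooth_partial (rshift n ord0) sf.
have d1 y : Om y -> drho (fun y => wden y * f y) y = wden y * drho f y + f y * drho wden y.
  by move=> Oy; rewrite (@partialM _ _ Om).
have d2 : drho (drho (fun y => wden y * f y)) z =
    wden z * drho (drho f) z + drho f z * drho wden z +
    (f z * drho (drho wden) z + drho wden z * drho f z).
  rewrite (eq_partial Om_open _ Oz d1) (@partialD _ _ Om) //; try exact: smoothM.
  by rewrite !(@partialM _ _ Om).
rewrite /Rop d2 d1 // dgM // /Lop lap_dg // /Upot drho_wden //.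
have w0 := wden_neq0 Oz.
move: (drho (drho wden) z) (drho (drho f) z) (drho f z) (dg wden z) (dg f z)
  (grad_dot wden f z) (dlog _ z) (rho_of z) (wden z) (f z) w0.
move=> a1 a2 a3 a4 a5 a6 a7 a8 a9 a10 w0.
by field.
Qed.

Variable g : 'rV[R]_n -> 'M[R]_n.
Hypothesis gE : forall y, U y -> gr 0 y = g y.

Lemma partial_gmat0 (a i j : 'I_n) z : Om z ->
  dx a (fun y => gmat0 y i j) z = partial a (fun y => g y i j) (lsubmx z).
Proof.
move=> [Uz _]; apply: etrans (partial_lift a (fun y => gr 0 y i j) z) _.
by apply: (eq_partial Uopen) => // y Uy; rewrite gE.
Qed.

(** In the trace Gamma^i_ik, two of the three derivative terms cancel by symmetry of the metric and
    its inverse. *)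
Lemma trace_christoffel k z : Om z ->
  \sum_i christoffel g i i k (lsubmx z) = 2^-1 * dlog0 (lshift 1 k) z.
Proof.
move=> Oz; have Uz := Oz.1.
pose h i j := invmx (gmat0 z) i j.
pose D a i j := partial a (fun y => g y i j) (lsubmx z).
have hs i j : h i j = h j i.
  by rewrite /h gmat0E -[in LHS](gmat_sym (tube_base Oz)) -trmx_inv mxE.
have Ds a i j : D a i j = D a j i.
  apply: (eq_partial Uopen) => // y Uy.
  have e : `|0 : R| < eps by rewrite normr0.
  by rewrite -gE // -(gmat_at 0 y) -[in LHS](gmat_sym (tube_at Uy e)) mxE.
have -> : dlog0 (lshift 1 k) z = \sum_i \sum_j h i j * D k j i.
  rewrite /dlog0 /mxtrace; apply: eq_bigr => i _; rewrite mxE; apply: eq_bigr => j _.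
  by rewrite mxE partial_gmat0.
have -> : \sum_i christoffel g i i k (lsubmx z) =
    2^-1 * (\sum_i \sum_j h i j * D i k j + \sum_i \sum_j h i j * D k i j
            - \sum_i \sum_j h i j * D j i k).
  rewrite -big_split -sumrB mulr_sumr; apply: eq_bigr => i _.
  rewrite -big_split -sumrB /christoffel; congr (_ * _); apply: eq_bigr => j _ /=.
  by rewrite /h /gmat0 gE // mulrBr mulrDr.
congr (_ * _).
have -> : \sum_i \sum_j h i j * D j i k = \sum_i \sum_j h i j * D i k j.
  rewrite exchange_big; apply: eq_bigr => i _; apply: eq_bigr => j _.
  by rewrite hs Ds.
rewrite addrAC subrr add0r; apply: eq_bigr => i _; apply: eq_bigr => j _.
by rewrite Ds.
Qed.

Lemma div_grad_at F rho x : Om (at_rho rho x) ->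
  div_grad g (gr rho) (F \o at_rho rho) x = dg F (at_rho rho x).
Proof.
move=> Or; rewrite /div_grad /divergence big_split /dg.
have fl i : (fun y => \sum_j invmx (gr rho y) i j * partial j (F \o at_rho rho) y) =
    flux F i \o at_rho rho.
  apply/funext => y; apply: eq_bigr => j _.
  by rewrite partial_slice /ginv gmat_at.
apply: (congr2 +%R).
  by apply: eq_bigr => i _; rewrite fl partial_slice.
rewrite exchange_big; apply: eq_bigr => k _ /=.
rewrite -mulr_suml -(trace_christoffel k Or) lsubmx_at.
apply: (congr2 *%R) => //; apply: eq_bigr => j _.
by rewrite partial_slice /ginv gmat_at.
Qed.

Lemma Wfun_at r x : Wfun gr r x = wden (at_rho (- r ^+ 2 / 2) x).
Proof.
rewrite /Wfun /Vfun /wden gmat_at /gmat0 lsubmx_at /hfam.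
by rewrite (_ : - 0 ^+ 2 / 2 = 0 :> R) // expr0n /= oppr0 mul0r.
Qed.

(* The action of M(r) on functions of x, continued to the tube. *)
Definition Mlift (u : 'rV[R]_n -> R) z : R :=
  dg (u \o lsubmx) z - Upot z * (u \o lsubmx) z.

Lemma Ufun_at (d r : R) x : d ^+ 2 <= eps -> 0 < r < d -> U x ->
  Ufun g gr r x = Upot (at_rho (- r ^+ 2 / 2) x).
Proof.
move=> de rd Ux.
have Or : Om (at_rho (- r ^+ 2 / 2) x) by apply: tube_at => //; exact: rho_of_r_small rd de.
have WE : (fun s => Wfun gr s x) = (fun s => wden (at_rho (- s ^+ 2 / 2) x)).
  by apply/funext => s; rewrite Wfun_at.
have W2E := derive1n_even_step de Ux wden_smooth
  (fun s _ => congr1 (fun h : R -> R => h s) WE) rd.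
rewrite /Ufun W2E Wfun_at /Upot; congr (_ / _).
have -> : div_grad g (hfam gr r) (Wfun gr r) x = dg wden (at_rho (- r ^+ 2 / 2) x).
  have -> : Wfun gr r = wden \o at_rho (- r ^+ 2 / 2).
    by apply/funext => y; rewrite Wfun_at.
  exact: (div_grad_at wden Or).
congr (_ + _); rewrite WE derive1E.
have [_ ->] := is_derive_even wden_smooth Or.
rewrite /drr rho_of_at.
have r0 : r != 0 by case/andP: rd => r0 _; rewrite gt_eqF.
move: (drho (drho wden) _) (drho wden _) => a b.
by field.
Qed.

Lemma Mop_at (d r : R) (u : 'rV[R]_n -> R) x : d ^+ 2 <= eps -> 0 < r < d -> U x ->
  Mop g gr r u x = Mlift u (at_rho (- r ^+ 2 / 2) x).
Proof.
move=> de rd Ux.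
have Or : Om (at_rho (- r ^+ 2 / 2) x) by apply: tube_at => //; exact: rho_of_r_small rd de.
have uE : u = (u \o lsubmx) \o at_rho (- r ^+ 2 / 2).
  by apply/funext => y; rewrite /= lsubmx_at.
have dE : div_grad g (hfam gr r) u x = dg (u \o lsubmx) (at_rho (- r ^+ 2 / 2) x).
  by rewrite {1}uE; exact: (div_grad_at (u \o lsubmx) Or).
by rewrite /Mop dE (Ufun_at de rd Ux) /Mlift /= lsubmx_at.
Qed.

Lemma Mlift_smooth u : smooth_on U u -> smooth_on Om (Mlift u).
Proof.
move=> su; have sl := smooth_lift eps Uopen su.
apply: smoothB => //; first exact: dg_smooth.
by apply: smoothM => //; exact: Upot_smooth.
Qed.

Lemma small_radius : exists2 d : R, 0 < d & d ^+ 2 <= eps.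
Proof.
exists (Num.min 1 eps); first by rewrite lt_min ltr01.
have e1 : Num.min 1 eps <= 1 by rewrite ge_min lexx.
have e2 : Num.min 1 eps <= eps by rewrite ge_min lexx orbT.
apply: le_trans e2; rewrite expr2 -[leRHS]mulr1 ler_wpM2l //.
by rewrite le_min ler01 ltW.
Qed.

Lemma M2_locE c u x : smooth_on U u -> U x ->
  M2_loc g gr c.+1 u x = c`!%:R ^+ 2 * rho_coef c (Mlift u) x.
Proof.
move=> su Ux; have [d d0 de] := small_radius.
rewrite /M2_loc /= (taylor_coef_even Uopen eps0 c d0 (Mlift_smooth su) Ux).
  have e0 : (4 : R) ^+ c != 0 by rewrite expf_neq0 // pnatr_eq0.
  by field.
by move=> r rd; exact: Mop_at rd Ux.
Qed.

Lemma W2_locE a x : U x -> W2_loc gr a x = rho_coef a wden x / 4 ^+ a.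
Proof.
move=> Ux; rewrite /W2_loc.
rewrite (taylor_coef_even Uopen eps0 a ltr01 wden_smooth Ux) //.
by move=> r _; exact: Wfun_at.
Qed.

(** The operator M_(2c+2) / c!^2. In [dg] minus [Upot] only the inverse metric and [Upot] depend on
    [rho], and both occur linearly, so each is replaced by its coefficient of degree [c]. *)
Definition Mcoef (c : nat) (u : 'rV[R]_n -> R) x : R :=
  \sum_i partial i (fun y => \sum_j rho_coef c (ginv i j) y * partial j u y) x
  + \sum_k 2^-1 * dlog0 (lshift 1 k) (at_rho 0 x) *
      (\sum_j rho_coef c (ginv k j) x * partial j u x)
  - rho_coef c Upot x * u x.

Lemma dlog0_base k z : dlog0 (lshift 1 k) z = dlog0 (lshift 1 k) (at_rho 0 (lsubmx z)).
Proof.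
rewrite /dlog0 /gmat0 lsubmx_at; congr (\tr (_ *m _)); apply/matrixP => i j.
rewrite !mxE (partial_lift k (fun y => gr 0 y i j)).
by rewrite (partial_lift k (fun y => gr 0 y i j)) lsubmx_at.
Qed.

Lemma rho_coef_liftM j u F x : smooth_on U u -> smooth_on Om F -> U x ->
  rho_coef j (fun z => u (lsubmx z) * F z) x = u x * rho_coef j F x.
Proof.
move=> su sF Ux; have sl := smooth_lift eps Uopen su.
rewrite (rho_coefM Uopen eps0 j sl sF Ux) big_ord_recl big1 ?addr0 => [|i _].
  by rewrite rho_coef_lift mul1r subn0.
by rewrite rho_coef_lift !mul0r.
Qed.

Lemma rho_coef_flux j F i x : smooth_on Om F -> U x ->
  rho_coef j (flux F i) x =
  \sum_(c < j.+1) \sum_l rho_coef c (ginv i l) x * partial l (rho_coef (j - c) F) x.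
Proof.
move=> sF Ux.
rewrite (rho_coef_sum Uopen eps0) //; last first.
  by move=> l; apply: smoothM => //; [exact: ginv_smooth|exact: smooth_partial].
rewrite exchange_big; apply: eq_bigr => l _.
rewrite (rho_coefM Uopen eps0) //; [|exact: ginv_smooth|exact: smooth_partial].
by apply: eq_bigr => c _; rewrite (rho_coef_partial Uopen eps0).
Qed.

Lemma Mcoef_summand_smooth c i j u : smooth_on U u ->
  smooth_on U (fun y => rho_coef c (ginv i j) y * partial j u y).
Proof.
move=> su; apply: smoothM => //; last exact: smooth_partial.
exact: (smooth_rho_coef Uopen eps0 c (ginv_smooth i j)).
Qed.

Lemma Mcoef_flux_smooth c i u : smooth_on U u ->
  smooth_on U (fun y => \sum_j rho_coef c (ginv i j) y * partial j u y).
Proof. by move=> su; apply: smooth_sum => // j _; exact: Mcoef_summand_smooth. Qed.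

(** No derivative in [rho] occurs in the operator, so its coefficients and those of [F] combine by a
    Cauchy product. *)
Lemma rho_coef_dg_sub j F x : smooth_on Om F -> U x ->
  rho_coef j (fun z => dg F z - Upot z * F z) x =
  \sum_(c < j.+1) Mcoef c (rho_coef (j - c) F) x.
Proof.
move=> sF Ux.
have sU := Upot_smooth; have sD := dg_smooth sF.
have sc i : smooth_on U (rho_coef i F) := smooth_rho_coef Uopen eps0 i sF.
rewrite (rho_coefB Uopen eps0) //; last exact: smoothM.
rewrite (rho_coefM Uopen eps0) // /Mcoef [RHS]sumrB; congr (_ - _).
have sfl i := flux_smooth i sF.
have sdl k : smooth_on U (fun y => 2^-1 * dlog0 (lshift 1 k) (at_rho 0 y)).
  apply: smoothZ => //; apply: (smooth_slice Uopen (eps := eps)); rewrite ?normr0 //.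
  exact: dlog0_smooth.
have s1 : smooth_on Om (fun z => \sum_i dx i (flux F i) z).
  by apply: smooth_sum => // i _; exact: smooth_partial.
have s2 k : smooth_on Om (fun z => 2^-1 * dlog0 (lshift 1 k) z * flux F k z).
  by apply: smoothM => //; apply: smoothZ => //; exact: dlog0_smooth.
rewrite (rho_coefD Uopen eps0) //; last exact: smooth_sum.
rewrite [RHS]big_split /=; apply: (congr2 +%R).
  rewrite (rho_coef_sum Uopen eps0) //; last by move=> i; exact: smooth_partial.
  rewrite [RHS]exchange_big; apply: eq_bigr => i _.
  rewrite (rho_coef_partial Uopen eps0) //.
  rewrite (eq_partial Uopen i Ux (fun y Uy => rho_coef_flux j i sF Uy)).
  by rewrite (partial_sum Uopen) // => c _; exact: Mcoef_flux_smooth.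
rewrite (rho_coef_sum Uopen eps0) // [RHS]exchange_big; apply: eq_bigr => k _.
transitivity (2^-1 * dlog0 (lshift 1 k) (at_rho 0 x) * rho_coef j (flux F k) x).
  rewrite -(rho_coef_liftM j (sdl k) (sfl k) Ux).
  by apply: (rho_coef_eq Uopen eps0) => // z _; rewrite (dlog0_base k z).
by rewrite rho_coef_flux // mulr_sumr.
Qed.

Lemma McoefZ c (a : R) u x : smooth_on U u -> U x ->
  Mcoef c (fun y => a * u y) x = a * Mcoef c u x.
Proof.
move=> su Ux.
have fl i y : U y -> \sum_j rho_coef c (ginv i j) y * partial j (fun y => a * u y) y =
    a * \sum_j rho_coef c (ginv i j) y * partial j u y.
  move=> Uy; rewrite mulr_sumr; apply: eq_bigr => j _.
  by rewrite (partialZ Uopen) // mulrCA.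
rewrite /Mcoef mulrBr mulrDr !mulr_sumr; congr (_ + _ - _); last exact: mulrCA.
  apply: eq_bigr => i _; rewrite (eq_partial Uopen i Ux (fl i)).
  by rewrite (partialZ Uopen) //; exact: Mcoef_flux_smooth.
by apply: eq_bigr => k _; rewrite fl // mulrCA.
Qed.

Lemma McoefD c u v x : smooth_on U u -> smooth_on U v -> U x ->
  Mcoef c (fun y => u y + v y) x = Mcoef c u x + Mcoef c v x.
Proof.
move=> su sv Ux.
have fl i y : U y -> \sum_j rho_coef c (ginv i j) y * partial j (fun y => u y + v y) y =
    \sum_j rho_coef c (ginv i j) y * partial j u y +
    \sum_j rho_coef c (ginv i j) y * partial j v y.
  move=> Uy; rewrite -big_split; apply: eq_bigr => j _.
  by rewrite (@partialD _ _ U) // mulrDr.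
have collect (a b e a' b' e' : R) :
  a + a' + (b + b') - (e + e') = a + b - e + (a' + b' - e') by ring.
rewrite /Mcoef -collect; congr (_ + _ - _); last exact: mulrDr.
  rewrite -big_split; apply: eq_bigr => i _; rewrite (eq_partial Uopen i Ux (fl i)).
  by rewrite (@partialD _ _ U) //; exact: Mcoef_flux_smooth.
by rewrite -big_split; apply: eq_bigr => k _; rewrite fl // mulrDr.
Qed.

Lemma Mcoef_smooth c u : smooth_on U u -> smooth_on U (Mcoef c u).
Proof.
move=> su.
have sfl i := Mcoef_flux_smooth c i su.
apply: smoothB => //; last first.
  by apply: smoothM => //; exact: (smooth_rho_coef Uopen eps0 c Upot_smooth).
apply: smoothD => //; apply: smooth_sum => // i _; first exact: smooth_partial.
apply: smoothM => //; apply: smoothZ => //.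
apply: (smooth_slice Uopen (eps := eps)); rewrite ?normr0 //.
exact: dlog0_smooth.
Qed.

Lemma rho_coef_Mlift c u x : smooth_on U u -> U x ->
  rho_coef c (Mlift u) x = Mcoef c u x.
Proof.
move=> su Ux; have sl := smooth_lift eps Uopen su.
rewrite rho_coef_dg_sub // big_ord_recr /= subnn big1 ?add0r => [|i _].
  congr (Mcoef c _ x); apply/funext => y.
  by rewrite rho_coef_lift mul1r.
(* A lifted function has no coefficient of positive degree; zero is written as [0 * u y] to let
   [McoefZ] apply. *)
rewrite (_ : rho_coef _ _ = (fun y => 0 * u y)).
  by rewrite McoefZ // mul0r.
by apply/funext => y; rewrite rho_coef_lift subn_eq0 leqNgt ltn_ord.
Qed.

(** In terms of the coefficient of degree j + 1, the term - 2 rho d_rho^2 contributes j (j+1) and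
    the term (2k - 2) d_rho contributes - (k-1)(j+1); the sum is (j+1)(j+1-k). *)
Lemma rho_coef_Rop k j F x : smooth_on Om F -> U x ->
  rho_coef j (Rop k F) x =
  j.+1%:R * (j.+1%:R - k) * rho_coef j.+1 F x +
  \sum_(c < j.+1) Mcoef c (rho_coef (j - c) F) x.
Proof.
move=> sF Ux; have sdF := smooth_partial (rshift n ord0) sF.
have sr : smooth_on Om (fun z => rho_of z * drho (drho F) z).
  by apply: smoothM => //; [exact: smooth_rho|exact: smooth_partial].
have sD := dg_smooth sF.
have sU : smooth_on Om (fun z => Upot z * F z) by apply: smoothM => //; exact: Upot_smooth.
rewrite -rho_coef_dg_sub //.
transitivity (rho_coef j (fun z => (- 2 * (rho_of z * drho (drho F) z) +
    (2 * k - 2) * drho F z) + (dg F z - Upot z * F z)) x).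
  by apply: (rho_coef_eq Uopen eps0) => // z _; exact: (esym (addrA _ _ _)).
have s1 := smoothZ Om_open (- 2) sr; have s2 := smoothZ Om_open (2 * k - 2) sdF.
rewrite (rho_coefD Uopen eps0 j (smoothD Om_open s1 s2) (smoothB Om_open sD sU) Ux).
congr (_ + _); rewrite (rho_coefD Uopen eps0 j s1 s2 Ux).
rewrite (rho_coefZ Uopen eps0 j _ sr Ux) (rho_coefZ Uopen eps0 j _ sdF Ux).
rewrite (rho_coef_rho_drho Uopen eps0) // !rho_coef_drho.
by rewrite -[j.+1]addn1 natrD; field.
Qed.

End Geometry.

(** * The ambient metric *)

Section Ambient.
Variables (R : realType) (n : nat).
Implicit Types (z : 'rV[R]_(1 + (n + 1))) (f : 'rV[R]_(n + 1) -> R).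

Definition it : 'I_(1 + (n + 1)) := lshift (n + 1) ord0.
Definition ix (i : 'I_n) : 'I_(1 + (n + 1)) := rshift 1 (lshift 1 i).
Definition ir : 'I_(1 + (n + 1)) := rshift 1 (rshift n ord0).

Lemma sum_ambient (V : nmodType) (F : 'I_(1 + (n + 1)) -> V) :
  \sum_I F I = F it + (\sum_i F (ix i) + F ir).
Proof. by rewrite big_split_ord big_ord1 big_split_ord big_ord1. Qed.

Lemma amb_t_shift_it z (h : R) : amb_t (h *: delta_mx 0 it + z) = h *: 1 + amb_t z.
Proof. by rewrite /amb_t linearP /= delta_mx_lshift row_mxKl !mxE !eqxx. Qed.

Lemma rsubmx_shift_it z (h : R) : rsubmx (h *: delta_mx 0 it + z) = rsubmx z.
Proof. by rewrite linearP /= delta_mx_lshift row_mxKr scaler0 add0r. Qed.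

Lemma amb_t_shift_r z e (h : R) : amb_t (h *: delta_mx 0 (rshift 1 e) + z) = amb_t z.
Proof.
by rewrite /amb_t linearP /= delta_mx_rshift row_mxKl scaler0 add0r.
Qed.

Lemma rsubmx_shift_r z (e : 'I_(n + 1)) (h : R) :
  rsubmx (h *: delta_mx 0 (rshift 1 e) + z) = h *: delta_mx 0 e + rsubmx z.
Proof. by rewrite linearP /= delta_mx_rshift row_mxKr. Qed.

Lemma partial_it (a : R -> R) da f z : is_derive (amb_t z) 1 a da ->
  partial it (fun y => a (amb_t y) * f (rsubmx y)) z = da * f (rsubmx z).
Proof.
move=> [ha <-].
transitivity ('D_1 (f (rsubmx z) \*o a) (amb_t z)); last by rewrite deriveMl // mulrC.
apply: derive_along_line => h.
by rewrite amb_t_shift_it rsubmx_shift_it /= mulrC.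
Qed.

Lemma partial_ir (a : R -> R) e f z : derivable f (rsubmx z) (delta_mx 0 e) ->
  partial (rshift 1 e) (fun y => a (amb_t y) * f (rsubmx y)) z =
  a (amb_t z) * partial e f (rsubmx z).
Proof.
move=> df; transitivity ('D_(delta_mx 0 e) (a (amb_t z) \*o f) (rsubmx z)); last exact: deriveMl.
by apply: derive_along_line => h; rewrite amb_t_shift_r rsubmx_shift_r.
Qed.

Lemma continuous_amb_t : continuous (@amb_t R n).
Proof.
move=> z; apply: (@continuous_comp _ _ _ lsubmx (fun A : 'rV[R]_1 => A 0 0)).
  exact: continuous_lsubmx.
exact: coord_continuous.
Qed.

Lemma ambient_ind (P : 'I_(1 + (n + 1)) -> Prop) :
  P it -> (forall i, P (ix i)) -> P ir -> forall I, P I.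
Proof.
move=> P0 Px Pr I; case: (split_ordP I) => [i ->|J ->]; first by rewrite (ord1 i).
by case: (split_ordP J) => [j ->|k ->]; [exact: Px|rewrite (ord1 k)].
Qed.

Section Blocks.
Variables (a b c : R) (G : 'M[R]_n).

(** Shape common to the ambient metric, where [c = 0], and to its inverse, where [a = 0]; one set of
    entry rules then serves both. *)
Definition ambient_block : 'M[R]_(1 + (n + 1)) :=
  block_mx a%:M (row_mx 0 b%:M) (col_mx 0 b%:M) (block_mx G 0 0 c%:M).

Lemma ambient_block_tt : ambient_block it it = a.
Proof. by rewrite /it block_mxEul mxE eqxx. Qed.

Lemma ambient_block_tx j : ambient_block it (ix j) = 0.
Proof. by rewrite /it /ix block_mxEur row_mxEl mxE. Qed.

Lemma ambient_block_tr : ambient_block it ir = b.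
Proof. by rewrite /it /ir block_mxEur row_mxEr mxE eqxx. Qed.

Lemma ambient_block_xt i : ambient_block (ix i) it = 0.
Proof. by rewrite /it /ix block_mxEdl col_mxEu mxE. Qed.

Lemma ambient_block_xx i j : ambient_block (ix i) (ix j) = G i j.
Proof. by rewrite /ix block_mxEdr block_mxEul. Qed.

Lemma ambient_block_xr i : ambient_block (ix i) ir = 0.
Proof. by rewrite /ix /ir block_mxEdr block_mxEur mxE. Qed.

Lemma ambient_block_rt : ambient_block ir it = b.
Proof. by rewrite /it /ir block_mxEdl col_mxEd mxE eqxx. Qed.

Lemma ambient_block_rx j : ambient_block ir (ix j) = 0.
Proof. by rewrite /ix /ir block_mxEdr block_mxEdl mxE. Qed.

Lemma ambient_block_rr : ambient_block ir ir = c.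
Proof. by rewrite /ir block_mxEdr block_mxEdr mxE eqxx. Qed.

End Blocks.

Definition ambient_blockE :=
  (ambient_block_tt, ambient_block_tx, ambient_block_tr, ambient_block_xt,
   ambient_block_xx, ambient_block_xr, ambient_block_rt, ambient_block_rx,
   ambient_block_rr).

Lemma ambient_block1 : ambient_block 1 0 1 1%:M = 1%:M.
Proof.
rewrite /ambient_block [RHS]scalar_mx_block [in RHS]scalar_mx_block.
congr block_mx.
- by rewrite -[RHS]row_mx0; congr row_mx; apply/matrixP => i j; rewrite !mxE mul0rn.
- by rewrite -[RHS]col_mx0; congr col_mx; apply/matrixP => i j; rewrite !mxE mul0rn.
Qed.

Lemma invmx_ambient_block (t a : R) (G : 'M[R]_n) : t != 0 -> G \in unitmx ->
  invmx (ambient_block a t 0 G) = ambient_block 0 t^-1 (- a * t ^- 2) (invmx G).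
Proof.
move=> t0 Gu; set A := ambient_block _ _ _ _; set B := ambient_block _ _ _ _.
suff AB : A *m B = 1%:M.
  have [Au _] := mulmx1_unit AB.
  by rewrite -[RHS](mulKmx Au) AB mulmx1.
rewrite -ambient_block1; apply/matrixP.
have s0 (F : 'I_n -> R) : (forall i, F i = 0) -> \sum_i F i = 0.
  by move=> F0; rewrite big1.
elim/ambient_ind => [|i|]; elim/ambient_ind => [|j|];
  rewrite mxE sum_ambient !ambient_blockE.
- by rewrite s0 ?mulfV ?mulr0 ?add0r // => i; rewrite !ambient_blockE mul0r.
- by rewrite s0 ?mulr0 ?addr0 // => i; rewrite !ambient_blockE mul0r.
- by rewrite s0 => [|i]; [field|rewrite !ambient_blockE mul0r].
- by rewrite s0 ?mul0r ?addr0 // => l; rewrite !ambient_blockE mulr0.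
- rewrite !mul0r add0r addr0 -(mulmxV Gu) mxE; apply: eq_bigr => l _.
  by rewrite !ambient_blockE.
- by rewrite s0 ?mul0r ?addr0 // => l; rewrite !ambient_blockE mulr0.
- by rewrite s0 ?mul0r ?mulr0 ?addr0 // => l; rewrite !ambient_blockE mul0r.
- by rewrite s0 ?mul0r ?mulr0 ?addr0 // => l; rewrite !ambient_blockE mul0r.
- by rewrite s0 ?mulfV ?mul0r ?addr0 // => l; rewrite !ambient_blockE mul0r.
Qed.

End Ambient.

Lemma double_sum_combination (R : comPzRingType) (I : finType)
    (h H A G D : I -> I -> R) (x y r : R) :
  (forall i j, H i j = A i j + x * D j i + (G j i - r * D j i) * y) ->
  \sum_i \sum_j h i j * H i j =
  (\sum_i \sum_j h i j * A i j) + x * (\sum_i \sum_j h i j * D j i) +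
  ((\sum_i \sum_j h i j * G j i) - r * (\sum_i \sum_j h i j * D j i)) * y.
Proof.
move=> HE; rewrite !mulr_sumr -sumrB mulr_suml -!big_split; apply: eq_bigr => i _ /=.
rewrite !mulr_sumr -sumrB mulr_suml -!big_split; apply: eq_bigr => j _ /=.
by rewrite HE; ring.
Qed.

Section AmbientMetric.
Variables (R : realType) (n p q : nat) (U : set 'rV[R]_n) (eps : R).
Hypothesis Uopen : open U.
Hypothesis eps0 : 0 < eps.
Variable gr : R -> 'rV[R]_n -> 'M[R]_n.
Notation Om := (tube U eps).
Let Om_open : open Om := tube_open Uopen.
Notation gmat := (gmat gr).
Notation ginv := (ginv gr).
Hypothesis gmat_smooth : forall i j, smooth_on Om (fun z => gmat z i j).
Hypothesis gmat_sym : forall z, Om z -> (gmat z)^T = gmat z.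
Hypothesis gmat_sig : forall z, Om z -> has_signature p q (gmat z).
Implicit Types (z : 'rV[R]_(1 + (n + 1))) (f : 'rV[R]_(n + 1) -> R)
  (u : 'rV[R]_(1 + (n + 1)) -> R).

Notation it := (it n).
Notation ix := (@ix n).
Notation ir := (ir n).
Notation rr := (rshift n ord0).

Definition cone : set 'rV[R]_(1 + (n + 1)) := [set z | 0 < amb_t z /\ Om (rsubmx z)].

Lemma cone_open : open cone.
Proof.
apply: openI.
  apply: (@open_comp _ _ (@amb_t R n) [set t | 0 < t]); last exact: open_gt.
  by move=> z _; exact: continuous_amb_t.
by apply: open_comp => // z _; exact: continuous_rsubmx.
Qed.

Lemma gtildeE z : gtilde gr z =
  ambient_block (2 * rho_of (rsubmx z)) (amb_t z) 0 (amb_t z ^+ 2 *: gmat (rsubmx z)).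
Proof. by rewrite /gtilde /ambient_block raddf0. Qed.

Lemma invmx_gtilde z : cone z -> invmx (gtilde gr z) =
  ambient_block 0 (amb_t z)^-1 (- (2 * rho_of (rsubmx z)) * amb_t z ^- 2)
    (amb_t z ^- 2 *: invmx (gmat (rsubmx z))).
Proof.
move=> [t0 Oz]; have t0' : amb_t z != 0 by rewrite gt_eqF.
have t2 : amb_t z ^+ 2 \is a GRing.unit by rewrite unitfE expf_neq0.
have Gu := gmat_unit gmat_sig Oz.
rewrite gtildeE invmx_ambient_block ?unitmxZ //.
by rewrite invmxZ // unitmxZ.
Qed.

Definition dgt E I J z := partial E (fun y => gtilde gr y I J) z.

Lemma dgt_zero E I J z : (forall y, gtilde gr y I J = 0) -> dgt E I J z = 0.
Proof.
move=> g0; rewrite /dgt (_ : (fun y => _) = fun=> 0) ?partial_cst //.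
exact/funext.
Qed.

Lemma is_derive_cst1 (t c : R) : is_derive t 1 (fun=> c) 0.
Proof. exact: is_derive_cst. Qed.

Lemma is_derive_id1 (t : R) : is_derive t 1 (fun s => s) 1.
Proof. exact: is_derive_id. Qed.

Lemma is_derive_sqr1 (t : R) : is_derive t 1 (fun s => s ^+ 2) (2 * t).
Proof.
have [h1 h2] := is_deriveM (is_derive_id t (1 : R)) (is_derive_id t 1).
have -> : (fun s : R => s ^+ 2) = (id * id) by apply/funext => s; rewrite expr2.
by apply: DeriveDef => //; rewrite h2 /GRing.scale /=; ring.
Qed.

Section Entries.
Variable z : 'rV[R]_(1 + (n + 1)).
Hypothesis zcone : cone z.
Let Oz : Om (rsubmx z) := zcone.2.

Lemma dgt_t0 E j : dgt E it (ix j) z = 0.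
Proof. by apply: dgt_zero => y; rewrite gtildeE ambient_blockE. Qed.
Lemma dgt_xt0 E i : dgt E (ix i) it z = 0.
Proof. by apply: dgt_zero => y; rewrite gtildeE ambient_blockE. Qed.
Lemma dgt_xr E i : dgt E (ix i) ir z = 0.
Proof. by apply: dgt_zero => y; rewrite gtildeE ambient_blockE. Qed.
Lemma dgt_rx E j : dgt E ir (ix j) z = 0.
Proof. by apply: dgt_zero => y; rewrite gtildeE ambient_blockE. Qed.
Lemma dgt_rr E : dgt E ir ir z = 0.
Proof. by apply: dgt_zero => y; rewrite gtildeE ambient_blockE. Qed.

Let gtt : (fun y => gtilde gr y it it) = (fun y => 2 * rho_of (rsubmx y)).
Proof. by apply/funext => y; rewrite gtildeE ambient_blockE. Qed.
Let gtr : (fun y => gtilde gr y it ir) = (fun y => amb_t y * 1).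
Proof. by apply/funext => y; rewrite gtildeE ambient_blockE mulr1. Qed.
Let grt : (fun y => gtilde gr y ir it) = (fun y => amb_t y * 1).
Proof. by apply/funext => y; rewrite gtildeE ambient_blockE mulr1. Qed.
Let gxx i j : (fun y => gtilde gr y (ix i) (ix j)) =
  (fun y => amb_t y ^+ 2 * gmat (rsubmx y) i j).
Proof. by apply/funext => y; rewrite gtildeE ambient_blockE mxE. Qed.

Let drho_of e : derivable (@rho_of R n) (rsubmx z) (delta_mx 0 e).
Proof. exact: (smooth_derivable (smooth_rho eps Uopen) Oz). Qed.

Lemma dgt_ttt : dgt it it it z = 0.
Proof.
rewrite /dgt gtt (partial_it (a := fun=> 2) _ (is_derive_cst1 _ _)).
exact: mul0r.
Qed.
Lemma dgt_xtt i : dgt (ix i) it it z = 0.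
Proof.
by rewrite /dgt gtt (partial_ir (fun=> 2)) // partial_rho mulr0.
Qed.
Lemma dgt_rtt : dgt ir it it z = 2.
Proof. by rewrite /dgt gtt (partial_ir (fun=> 2)) // drho_rho mulr1. Qed.

Let d1 e : derivable (fun=> 1 : R) (rsubmx z) (delta_mx 0 e : 'rV[R]_(n + 1)).
Proof. exact: derivable_cst. Qed.

Let dt_r e : partial (rshift 1 e) (fun y => amb_t y * 1) z = 0.
Proof.
have E : partial (rshift 1 e) (fun y => amb_t y * 1) z =
    amb_t z * partial e (fun=> 1) (rsubmx z) := partial_ir id (@d1 e).
by rewrite E partial_cst mulr0.
Qed.

Lemma dgt_ttr : dgt it it ir z = 1.
Proof.
by rewrite /dgt gtr (partial_it (a := id) (fun=> 1) (is_derive_id1 _)) mulr1.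
Qed.
Lemma dgt_xtr i : dgt (ix i) it ir z = 0.
Proof. by rewrite /dgt gtr dt_r. Qed.
Lemma dgt_rtr : dgt ir it ir z = 0.
Proof. by rewrite /dgt gtr dt_r. Qed.
Lemma dgt_trt : dgt it ir it z = 1.
Proof.
by rewrite /dgt grt (partial_it (a := id) (fun=> 1) (is_derive_id1 _)) mulr1.
Qed.
Lemma dgt_xrt i : dgt (ix i) ir it z = 0.
Proof. by rewrite /dgt grt dt_r. Qed.
Lemma dgt_rrt : dgt ir ir it z = 0.
Proof. by rewrite /dgt grt dt_r. Qed.

Lemma dgt_txx i j : dgt it (ix i) (ix j) z = 2 * amb_t z * gmat (rsubmx z) i j.
Proof.
rewrite /dgt gxx.
exact: (partial_it (fun y => gmat y i j) (is_derive_sqr1 (amb_t z))).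
Qed.
Lemma dgt_rsxx e i j : dgt (rshift 1 e) (ix i) (ix j) z =
  amb_t z ^+ 2 * partial e (fun y => gmat y i j) (rsubmx z).
Proof.
rewrite /dgt gxx; apply: (partial_ir (fun t => t ^+ 2)).
exact: (smooth_derivable (gmat_smooth i j) Oz).
Qed.

Definition dgtE := (dgt_t0, dgt_xt0, dgt_xr, dgt_rx, dgt_rr, dgt_ttt, dgt_xtt, dgt_rtt,
  dgt_ttr, dgt_xtr, dgt_rtr, dgt_trt, dgt_xrt, dgt_rrt, dgt_txx).

(** The inverse ambient metric has no tt, tx or xr entries, so the Laplacian calls only for symbols
    with lower indices tr, rt, rr and xx. *)
Lemma christoffel_gtilde K I J : christoffel (gtilde gr) K I J z =
  2^-1 * \sum_L invmx (gtilde gr z) K L * (dgt I J L z + dgt J I L z - dgt L I J z).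
Proof. by []. Qed.

Lemma christoffel_tr K : christoffel (gtilde gr) K it ir z =
  invmx (gtilde gr z) K it.
Proof.
rewrite christoffel_gtilde sum_ambient big1 => [|i _].
  by rewrite !dgtE; field.
by rewrite !dgtE; ring.
Qed.

Lemma christoffel_rt K : christoffel (gtilde gr) K ir it z =
  invmx (gtilde gr z) K it.
Proof.
rewrite christoffel_gtilde sum_ambient big1 => [|i _].
  by rewrite !dgtE; field.
by rewrite !dgtE; ring.
Qed.

Lemma christoffel_rr K : christoffel (gtilde gr) K ir ir z = 0.
Proof.
rewrite christoffel_gtilde sum_ambient big1 => [|i _].
  by rewrite !dgtE; field.
by rewrite !dgtE; ring.
Qed.

Lemma christoffel_xx K i j : christoffel (gtilde gr) K (ix i) (ix j) z =
  - invmx (gtilde gr z) K it * amb_t z * gmat (rsubmx z) i j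
  - 2^-1 * invmx (gtilde gr z) K ir * amb_t z ^+ 2 * drho (fun y => gmat y i j) (rsubmx z)
  + 2^-1 * amb_t z ^+ 2 * \sum_l invmx (gtilde gr z) K (ix l) *
      (dx i (fun y => gmat y j l) (rsubmx z) + dx j (fun y => gmat y i l) (rsubmx z)
       - dx l (fun y => gmat y i j) (rsubmx z)).
Proof.
rewrite christoffel_gtilde sum_ambient !dgtE.
have -> : \sum_l invmx (gtilde gr z) K (ix l) *
    (dgt (ix i) (ix j) (ix l) z + dgt (ix j) (ix i) (ix l) z - dgt (ix l) (ix i) (ix j) z) =
  amb_t z ^+ 2 * \sum_l invmx (gtilde gr z) K (ix l) *
      (dx i (fun y => gmat y j l) (rsubmx z) + dx j (fun y => gmat y i l) (rsubmx z)
       - dx l (fun y => gmat y i j) (rsubmx z)).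
  rewrite mulr_sumr; apply: eq_bigr => l _; rewrite !dgt_rsxx -mulrDr -mulrBr.
  exact: mulrCA.
rewrite dgt_rsxx.
move: (\sum_l _) (invmx _ K it) (invmx _ K ir) (drho _ _) (amb_t z) (gmat _ i j).
by move=> a1 a2 a3 a4 a5 a6; field.
Qed.

Lemma christoffel_xx_t i j : christoffel (gtilde gr) it (ix i) (ix j) z =
  - 2^-1 * amb_t z * partial_mx rr gmat (rsubmx z) j i.
Proof.
rewrite christoffel_xx (invmx_gtilde zcone) !ambient_blockE big1 => [|l _]; last first.
  by rewrite ambient_blockE mul0r.
rewrite -(dgmat_sym Uopen gmat_sym rr i j Oz) mxE.
have tn : amb_t z != 0 by case: zcone => t0 _; rewrite gt_eqF.
by move: (drho _ _) (gmat _ i j) => a b; field.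
Qed.

Lemma christoffel_xx_x k i j : christoffel (gtilde gr) (ix k) (ix i) (ix j) z =
  christ gr k i j (rsubmx z).
Proof.
rewrite christoffel_xx (invmx_gtilde zcone) !ambient_blockE /christ.
have tn : amb_t z != 0 by case: zcone => t0 _; rewrite gt_eqF.
rewrite mulr0 oppr0 !mul0r subrr add0r -mulrA; congr (_ * _).
rewrite mulr_sumr; apply: eq_bigr => l _.
by rewrite ambient_blockE mxE mulrA mulrA divff ?mul1r // expf_neq0.
Qed.

Lemma christoffel_xx_r i j : christoffel (gtilde gr) ir (ix i) (ix j) z =
  - gmat (rsubmx z) j i + rho_of (rsubmx z) * partial_mx rr gmat (rsubmx z) j i.
Proof.
rewrite christoffel_xx (invmx_gtilde zcone) !ambient_blockE big1 => [|l _]; last first.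
  by rewrite ambient_blockE mul0r.
rewrite -(dgmat_sym Uopen gmat_sym rr i j Oz) mxE.
have -> : gmat (rsubmx z) j i = gmat (rsubmx z) i j by rewrite -[in LHS](gmat_sym Oz) mxE.
have tn : amb_t z != 0 by case: zcone => t0 _; rewrite gt_eqF.
by move: (drho _ _) (gmat _ i j) => a b; field.
Qed.

End Entries.

(** Here [u] is arbitrary, so both orders of the mixed t, rho derivatives are kept. The symbols with
    lower indices xx are contracted with g_rho^-1: their multiples of g_rho give the dimension [n],
    those of d_rho g_rho give [dlog]. *)
Lemma laplacian_gtilde u z : cone z ->
  laplacian (gtilde gr) u z =
  (amb_t z)^-1 * (partial it (partial ir u) z + partial ir (partial it u) z)
  - 2 * rho_of (rsubmx z) * amb_t z ^- 2 * partial ir (partial ir u) z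
  + amb_t z ^- 2 * (\sum_i \sum_j ginv i j (rsubmx z) *
      (partial (ix i) (partial (ix j) u) z
       - \sum_k christ gr k i j (rsubmx z) * partial (ix k) u z))
  + (amb_t z)^-1 * (dlog gr rr (rsubmx z) / 2) * partial it u z
  + amb_t z ^- 2 * (n%:R - 2 - rho_of (rsubmx z) * dlog gr rr (rsubmx z)) * partial ir u z.
Proof.
move=> zc; have [t0 Oz] := zc; have tn : amb_t z != 0 by rewrite gt_eqF.
rewrite /laplacian.
pose H I J := partial I (partial J u) z
  - \sum_K christoffel (gtilde gr) K I J z * partial K u z.
have Htr : H it ir = partial it (partial ir u) z - (amb_t z)^-1 * partial ir u z.
  rewrite /H; congr (_ - _); rewrite sum_ambient !christoffel_tr //.
  rewrite (invmx_gtilde zc) !ambient_blockE big1 => [|i _]; first by rewrite mul0r !add0r.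
  by rewrite christoffel_tr // (invmx_gtilde zc) !ambient_blockE mul0r.
have Hrt : H ir it = partial ir (partial it u) z - (amb_t z)^-1 * partial ir u z.
  rewrite /H; congr (_ - _); rewrite sum_ambient !christoffel_rt //.
  rewrite (invmx_gtilde zc) !ambient_blockE big1 => [|i _]; first by rewrite mul0r !add0r.
  by rewrite christoffel_rt // (invmx_gtilde zc) !ambient_blockE mul0r.
have Hrr : H ir ir = partial ir (partial ir u) z.
  by rewrite /H big1 ?subr0 // => K _; rewrite christoffel_rr // mul0r.
have Hxx i j : H (ix i) (ix j) =
    (partial (ix i) (partial (ix j) u) z
       - \sum_k christ gr k i j (rsubmx z) * partial (ix k) u z)
    + 2^-1 * amb_t z * partial_mx rr gmat (rsubmx z) j i * partial it u z
    + (gmat (rsubmx z) j i - rho_of (rsubmx z) * partial_mx rr gmat (rsubmx z) j i) *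
      partial ir u z.
  rewrite /H sum_ambient christoffel_xx_t // christoffel_xx_r //.
  under eq_bigr => k _ do rewrite christoffel_xx_x //.
  have collect (a b d e r x y w : R) :
    a - (- 2^-1 * d * e * x + (b + (- y + r * e) * w)) =
    a - b + 2^-1 * d * e * x + (y - r * e) * w by ring.
  exact: collect.
have S1 : \sum_i \sum_j ginv i j (rsubmx z) * gmat (rsubmx z) j i = n%:R.
  transitivity (\tr (invmx (gmat (rsubmx z)) *m gmat (rsubmx z))).
    by apply: eq_bigr => i _; rewrite mxE.
  by rewrite mulVmx ?mxtrace1 // (gmat_unit gmat_sig Oz).
have S2 : \sum_i \sum_j ginv i j (rsubmx z) * partial_mx rr gmat (rsubmx z) j i =
   dlog gr rr (rsubmx z).
  by apply: eq_bigr => i _; rewrite mxE.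
have row_t : \sum_J invmx (gtilde gr z) it J * H it J = (amb_t z)^-1 * H it ir.
  rewrite (invmx_gtilde zc) sum_ambient !ambient_blockE mul0r add0r big1 ?add0r // => j _.
  by rewrite ambient_blockE mul0r.
have row_x i : \sum_J invmx (gtilde gr z) (ix i) J * H (ix i) J =
    amb_t z ^- 2 * \sum_j ginv i j (rsubmx z) * H (ix i) (ix j).
  rewrite (invmx_gtilde zc) sum_ambient !ambient_blockE !mul0r add0r addr0.
  by rewrite mulr_sumr; apply: eq_bigr => j _; rewrite ambient_blockE mxE mulrA.
have row_r : \sum_J invmx (gtilde gr z) ir J * H ir J =
    (amb_t z)^-1 * H ir it - 2 * rho_of (rsubmx z) * amb_t z ^- 2 * H ir ir.
  rewrite (invmx_gtilde zc) sum_ambient !ambient_blockE big1 ?add0r => [|j _].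
    by rewrite !mulNr.
  by rewrite ambient_blockE mul0r.
transitivity (\sum_I \sum_J invmx (gtilde gr z) I J * H I J); first by [].
rewrite sum_ambient row_t row_r (eq_bigr _ (fun i _ => row_x i)) -mulr_sumr.
have -> : \sum_i \sum_j ginv i j (rsubmx z) * H (ix i) (ix j) =
    (\sum_i \sum_j ginv i j (rsubmx z) *
      (partial (ix i) (partial (ix j) u) z
       - \sum_k christ gr k i j (rsubmx z) * partial (ix k) u z))
    + 2^-1 * amb_t z * partial it u z * dlog gr rr (rsubmx z)
    + (n%:R - rho_of (rsubmx z) * dlog gr rr (rsubmx z)) * partial ir u z.
  rewrite -S2 -S1; apply: double_sum_combination => i j.
  rewrite Hxx; congr (_ + _ + _); exact: mulrAC.
rewrite Htr Hrt Hrr.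
move: (\sum_i \sum_j _) (dlog _ _ _) (partial ir (partial ir u) z) (partial ir (partial it u) z)
  (partial it (partial ir u) z) (partial ir u z) (partial it u z) (rho_of _) (amb_t z) tn.
move=> a1 a2 a3 a4 a5 a6 a7 a8 a9 tn.
by field.
Qed.

End AmbientMetric.

(** * Iterated ambient Laplacians of homogeneous functions *)

Section AmbientPowers.
Variables (R : realType) (n p q : nat) (U : set 'rV[R]_n) (eps : R).
Hypothesis Uopen : open U.
Hypothesis eps0 : 0 < eps.
Variable gr : R -> 'rV[R]_n -> 'M[R]_n.
Notation Om := (tube U eps).
Let Om_open : open Om := tube_open Uopen.
Hypothesis gmat_smooth : forall i j, smooth_on Om (fun z => gmat gr z i j).
Hypothesis gmat_sym : forall z, Om z -> (gmat gr z)^T = gmat gr z.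
Hypothesis gmat_sig : forall z, Om z -> has_signature p q (gmat gr z).
Implicit Types (z : 'rV[R]_(1 + (n + 1))) (F f : 'rV[R]_(n + 1) -> R)
  (u v : 'rV[R]_(1 + (n + 1)) -> R).

Notation it := (it n).
Notation ix := (@ix n).
Notation ir := (ir n).
Notation rr := (rshift n ord0).
Notation cone := (cone U eps).
Let cone_open' : open cone := cone_open Uopen.

Lemma partial_it_powR (gamma : R) f z : 0 < amb_t z ->
  partial it (fun y => amb_t y `^ gamma * f (rsubmx y)) z =
  gamma * amb_t z `^ (gamma - 1) * f (rsubmx z).
Proof.
by move=> t0; apply: (partial_it (a := fun t => t `^ gamma)); exact: is_derive1_powR.
Qed.

Lemma partial_ir_powR (gamma : R) e f z : smooth_on Om f -> cone z ->
  partial (rshift 1 e) (fun y => amb_t y `^ gamma * f (rsubmx y)) z =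
  amb_t z `^ gamma * partial e f (rsubmx z).
Proof.
move=> sf [t0 Oz]; apply: (partial_ir (fun t => t `^ gamma)).
exact: (smooth_derivable sf Oz).
Qed.

Lemma powR_succ (t gamma : R) : 0 < t ->
  t `^ (gamma - 1) = t `^ (gamma - 2) * t /\ t `^ gamma = t `^ (gamma - 2) * t ^+ 2.
Proof.
move=> t0; have tn : t != 0 by rewrite gt_eqF.
split.
  rewrite -{3}[t]powRr1 ?ltW // -powRD ?tn ?implybT //.
  by congr (_ `^ _); ring.
rewrite -powR_mulrn ?ltW // -powRD ?tn ?implybT //.
by congr (_ `^ _); ring.
Qed.

Lemma laplacian_powR (gamma : R) f z : smooth_on Om f -> cone z ->
  laplacian (gtilde gr) (fun y => amb_t y `^ gamma * f (rsubmx y)) z =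
  amb_t z `^ (gamma - 2) * Lop gr gamma f (rsubmx z).
Proof.
move=> sf zc; have [t0 Oz] := zc.
rewrite (laplacian_gtilde Uopen gmat_smooth gmat_sym gmat_sig _ zc).
set u := fun y => _.
have dt y : cone y -> partial it u y =
    gamma * (amb_t y `^ (gamma - 1) * f (rsubmx y)).
  by move=> [ty _]; rewrite partial_it_powR // mulrA.
have ds e y : cone y -> partial (rshift 1 e) u y = amb_t y `^ gamma * partial e f (rsubmx y).
  by move=> cy; exact: partial_ir_powR.
have sd e : smooth_on Om (partial e f) by exact: smooth_partial.
have dss e e' : partial (rshift 1 e) (partial (rshift 1 e') u) z =
    amb_t z `^ gamma * partial e (partial e' f) (rsubmx z).
  by rewrite (eq_partial cone_open' _ zc (ds e')) partial_ir_powR.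
have dts e : partial it (partial (rshift 1 e) u) z =
    gamma * amb_t z `^ (gamma - 1) * partial e f (rsubmx z).
  by rewrite (eq_partial cone_open' _ zc (ds e)) partial_it_powR.
have dst e : partial (rshift 1 e) (partial it u) z =
    gamma * amb_t z `^ (gamma - 1) * partial e f (rsubmx z).
  rewrite (eq_partial cone_open' _ zc dt).
  transitivity (gamma * (amb_t z `^ (gamma - 1)) * partial e f (rsubmx z)) => //.
  rewrite -(partial_ir (fun t => gamma * t `^ (gamma - 1)) (f := f)); last first.
    exact: (smooth_derivable sf Oz).
  by congr (partial _ _ z); apply/funext => y; rewrite mulrA.
have -> : \sum_i \sum_j ginv gr i j (rsubmx z) *
      (partial (ix i) (partial (ix j) u) z
       - \sum_k christ gr k i j (rsubmx z) * partial (ix k) u z) =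
    amb_t z `^ gamma * lap gr f (rsubmx z).
  rewrite /lap mulr_sumr; apply: eq_bigr => i _; rewrite mulr_sumr; apply: eq_bigr => j _.
  rewrite dss [RHS]mulrCA; congr (_ * _); rewrite [RHS]mulrBr mulr_sumr.
  congr (_ - _); apply: eq_bigr => k _.
  by rewrite ds // mulrCA.
rewrite dts dst dss dt // ds // /Lop.
have [-> ->] := powR_succ gamma t0.
have tn : amb_t z != 0 by rewrite gt_eqF.
move: (drho (drho f) _) (drho f _) (lap _ _ _) (dlog _ _ _) (rho_of _) (amb_t z) (f _) tn.
move=> a1 a2 a3 a4 a5 t a7 tn.
move: (t `^ (gamma - 2)) => P.
by field.
Qed.

(** Formally the derivative at gamma = 0 of the result for t^gamma, which is gamma [dlog] / 2 times
    t^(gamma-2). The exponent is left as [0 - 2] to match the noncritical case with gamma = 0. *)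
Lemma laplacian_ln z : cone z ->
  laplacian (gtilde gr) (fun y => ln (amb_t y)) z =
  amb_t z `^ (0 - 2) * (dlog gr rr (rsubmx z) / 2).
Proof.
move=> zc; have [t0 Oz] := zc.
rewrite (laplacian_gtilde Uopen gmat_smooth gmat_sym gmat_sig _ zc).
have uE : (fun y => ln (@amb_t R n y)) = (fun y => ln (amb_t y) * (fun=> 1) (rsubmx y)).
  by apply/funext => y; rewrite mulr1.
have d1 (e : 'I_(n + 1)) (y : 'rV[R]_(1 + (n + 1))) :
    derivable (fun=> 1 : R) (rsubmx y) (delta_mx 0 e).
  exact: derivable_cst.
have dt y : cone y -> partial it (fun y => ln (amb_t y)) y = (amb_t y)^-1 * (fun=> 1) (rsubmx y).
  move=> [ty _]; rewrite uE.
  exact: (partial_it (a := @ln R) (fun=> 1) (is_derive1_ln ty)).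
have ds e y : cone y -> partial (rshift 1 e) (fun y => ln (amb_t y)) y = 0.
  by move=> _; rewrite uE (partial_ir (@ln R) (d1 e y)) partial_cst mulr0.
have dss I e : partial I (partial (rshift 1 e) (fun y => ln (amb_t y))) z = 0.
  by rewrite (eq_partial cone_open' _ zc (ds e)) partial_cst.
have dst e : partial (rshift 1 e) (partial it (fun y => ln (amb_t y))) z = 0.
  rewrite (eq_partial cone_open' _ zc dt).
  by rewrite (partial_ir (fun t => t^-1) (d1 e z)) partial_cst mulr0.
have [_] := powR_succ 0 t0; rewrite powRr0.
have tn : amb_t z != 0 by rewrite gt_eqF.
have collect (t P d r m A B C S p1 p2 : R) : t != 0 -> 1 = P * t ^+ 2 ->
    A = 0 -> B = 0 -> C = 0 -> S = 0 -> p1 = t^-1 * 1 -> p2 = 0 ->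
    t^-1 * (A + B) - 2 * r * t ^- 2 * C + t ^- 2 * S + t^-1 * (d / 2) * p1
    + t ^- 2 * (m - 2 - r * d) * p2 = P * (d / 2).
  move=> tn' P1 -> -> -> -> -> ->.
  apply: (mulIf (expf_neq0 2 tn')); rewrite [RHS]mulrAC -P1 mul1r.
  by field.
move=> P1; apply: (collect _ _ _ _ _ _ _ _ _ _ _ tn P1).
- exact: dss.
- exact: dst.
- exact: dss.
- rewrite big1 // => i _; rewrite big1 // => j _.
  have -> : partial (ix i) (partial (ix j) (fun y => ln (amb_t y))) z = 0 by exact: dss.
  by rewrite big1 ?subr0 ?mulr0 // => k _; rewrite ds // mulr0.
- exact: dt.
- exact: ds.
Qed.

Lemma laplacian_eq u v z : (forall y, cone y -> u y = v y) -> cone z ->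
  laplacian (gtilde gr) u z = laplacian (gtilde gr) v z.
Proof.
move=> uv zc.
have d1 I y : cone y -> partial I u y = partial I v y.
  by move=> cy; exact: (eq_partial cone_open').
rewrite /laplacian; apply: eq_bigr => I _; apply: eq_bigr => J _.
rewrite (eq_partial cone_open' I zc (d1 J)); congr (_ * (_ - _)).
by apply: eq_bigr => K _; rewrite d1.
Qed.

Lemma iter_laplacian_eq j u v z : (forall y, cone y -> u y = v y) -> cone z ->
  iter j (laplacian (gtilde gr)) u z = iter j (laplacian (gtilde gr)) v z.
Proof.
move=> uv; elim: j z => [|j IH] z zc; first exact: uv.
by apply: laplacian_eq => // y cy; exact: IH.
Qed.

Fixpoint Rchain (j : nat) (k : R) F : 'rV[R]_(n + 1) -> R :=
  if j is j'.+1 then Rchain j' (k - 2) (Rop gr k F) else F.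

(** With the argument written as [F / wden] the conjugations telescope: each Laplacian replaces [F]
    by [Rop] of it, keeps the divisor and lowers both gamma and k by 2. *)
Lemma iter_laplacian_powR j (gamma : R) F z : smooth_on Om F -> cone z ->
  iter j (laplacian (gtilde gr))
    (fun y => amb_t y `^ gamma * (F (rsubmx y) / wden gr (rsubmx y))) z =
  amb_t z `^ (gamma - 2 * j%:R) *
    (Rchain j (gamma + n%:R / 2) F (rsubmx z) / wden gr (rsubmx z)).
Proof.
elim: j gamma F => [|j IH] gamma F sF zc; first by rewrite mulr0 subr0.
have sw := wden_smooth Uopen eps0 gmat_smooth gmat_sig.
have sf : smooth_on Om (fun y => F y / wden gr y).
  apply: smoothM => //; apply: smoothV => // y Oy.
  exact: (wden_neq0 eps0 gmat_sig Oy).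
rewrite iterSr.
rewrite (@iter_laplacian_eq _ _ (fun y => amb_t y `^ (gamma - 2) *
   (Rop gr (gamma + n%:R / 2) F (rsubmx y) / wden gr (rsubmx y)))) //; last first.
  move=> y cy; have Oy := cy.2.
  have w0 := wden_neq0 eps0 gmat_sig Oy.
  rewrite (laplacian_powR _ sf cy); congr (_ * _).
  apply: (mulfI w0); rewrite (Lop_conj Uopen eps0 gmat_smooth gmat_sym gmat_sig) //.
  rewrite mulrCA divff // mulr1; apply: (Rop_eq _ _ _ _ Oy) => // s Os.
  by rewrite mulrCA divff ?mulr1 // (wden_neq0 eps0 gmat_sig Os).
rewrite IH //; last exact: (Rop_smooth Uopen eps0 gmat_smooth gmat_sig).
congr (_ `^ _ * (Rchain j _ _ _ / _)).
  by rewrite -[j.+1]addn1 natrD; ring.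
by rewrite /=; ring.
Qed.

End AmbientPowers.

(** * The formula *)

Section LocalFormula.
Variables (R : realType) (n p q : nat) (U : set 'rV[R]_n) (eps : R).
Hypothesis Uopen : open U.
Hypothesis eps0 : 0 < eps.
Variable gr : R -> 'rV[R]_n -> 'M[R]_n.
Notation Om := (tube U eps).
Let Om_open : open Om := tube_open Uopen.
Hypothesis gmat_smooth : forall i j, smooth_on Om (fun z => gmat gr z i j).
Hypothesis gmat_sym : forall z, Om z -> (gmat gr z)^T = gmat gr z.
Hypothesis gmat_sig : forall z, Om z -> has_signature p q (gmat gr z).
Implicit Types (F : 'rV[R]_(n + 1) -> R) (x : 'rV[R]_n).

Local Notation V := ('rV[R]_n -> R^o).
Implicit Types u v : V.

(* Functions are set to 0 outside U so that the operators are linear maps, not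
   merely maps that are linear up to equality on U. *)
Definition restr_to (D : set 'rV[R]_n) (u : 'rV[R]_n -> R) : V :=
  fun x => if x \in D then u x else 0.

Definition Mres (c : nat) (u : V) : V := restr_to U (Mcoef gr c u).

Definition coef_seq F (j : nat) : V := restr_to U (rho_coef j F).

Lemma restr_toE (u : 'rV[R]_n -> R) x : U x -> restr_to U u x = u x.
Proof. by move=> Ux; rewrite /restr_to mem_set. Qed.

Lemma restr_to_smooth (u : 'rV[R]_n -> R) : smooth_on U u -> smooth_on U (restr_to U u).
Proof. by apply: (smooth_eq Uopen) => y Uy; rewrite restr_toE. Qed.

Lemma Mcoef_eq c u v x : (forall y, U y -> u y = v y) -> U x ->
  Mcoef gr c u x = Mcoef gr c v x.
Proof.
move=> uv Ux.
have fl i y : U y -> \sum_j rho_coef c (ginv gr i j) y * partial j u y =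
    \sum_j rho_coef c (ginv gr i j) y * partial j v y.
  by move=> Uy; apply: eq_bigr => j _; rewrite (eq_partial Uopen j Uy uv).
rewrite /Mcoef; apply: (congr2 (fun a b : R => a - b)); last by rewrite uv.
apply: (congr2 +%R); apply: eq_bigr => i _.
  exact: (eq_partial Uopen i Ux (fl i)).
by rewrite fl.
Qed.

Let S u := smooth_on U u.

Let S0 : S 0. Proof. exact: (smooth_cst Uopen). Qed.
Let SD u v : S u -> S v -> S (u + v). Proof. exact: (smoothD Uopen). Qed.
Let SZ (a : R) u : S u -> S (a *: u). Proof. exact: (smoothZ Uopen a). Qed.

Let Sm c u : S u -> S (Mres c u).
Proof.
move=> Su; apply: restr_to_smooth.
exact: (Mcoef_smooth Uopen eps0 gmat_smooth gmat_sig).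
Qed.

Let mD c u v : S u -> S v -> Mres c (u + v) = Mres c u + Mres c v.
Proof.
move=> Su Sv; apply/funext => x; rewrite /Mres.
have -> : (restr_to U (Mcoef gr c u) + restr_to U (Mcoef gr c v)) x =
  restr_to U (Mcoef gr c u) x + restr_to U (Mcoef gr c v) x by [].
rewrite /restr_to; case: ifPn => [/set_mem Ux|_]; last by rewrite addr0.
exact: (McoefD Uopen eps0 gmat_smooth gmat_sig).
Qed.

Let mZ c (a : R) u : S u -> Mres c (a *: u) = a *: Mres c u.
Proof.
move=> Su; apply/funext => x; rewrite /Mres.
have -> : (a *: restr_to U (Mcoef gr c u)) x = a * restr_to U (Mcoef gr c u) x by [].
rewrite /restr_to; case: ifPn => [/set_mem Ux|_]; last by rewrite mulr0.
exact: (McoefZ Uopen eps0 gmat_smooth gmat_sig).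
Qed.

Lemma sum_fun_apply (I : Type) (r : seq I) (P : pred I) (F : I -> V) x :
  (\sum_(i <- r | P i) F i) x = \sum_(i <- r | P i) F i x.
Proof. exact: (big_morph (fun h : V => h x)). Qed.

Lemma coef_seq_smooth F j : smooth_on Om F -> smooth_on U (coef_seq F j).
Proof.
by move=> sF; apply: restr_to_smooth; exact: (smooth_rho_coef Uopen eps0).
Qed.

Lemma seqop_coef_seq k F : smooth_on Om F ->
  seqop Mres k (coef_seq F) = coef_seq (Rop gr k F).
Proof.
move=> sF; apply/funext => j; apply/funext => x; rewrite /seqop.
have -> : ((j.+1%:R * (j.+1%:R - k)) *: coef_seq F j.+1 +
    \sum_(c < j.+1) Mres c (coef_seq F (j - c))) x =
  j.+1%:R * (j.+1%:R - k) * coef_seq F j.+1 x +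
    \sum_(c < j.+1) Mres c (coef_seq F (j - c)) x.
  by apply: (congr2 +%R (erefl _)); exact: sum_fun_apply.
case: (boolP (x \in U)) => [/set_mem Ux|xU]; last first.
  rewrite /coef_seq /Mres /restr_to (negPf xU) mulr0 add0r big1 // => c _.
rewrite /coef_seq !restr_toE // (rho_coef_Rop Uopen eps0 gmat_smooth gmat_sig) //.
congr (_ + _); apply: eq_bigr => c _; rewrite /Mres restr_toE //.
by apply: Mcoef_eq => // y Uy; rewrite restr_toE.
Qed.

Lemma chain_coef_seq N j F : smooth_on Om F ->
  chain Mres (chain_index R N) j (coef_seq F) =
  coef_seq (Rchain gr j (chain_index R N j) F).
Proof.
elim: j F => //= j IH F sF.
rewrite seqop_coef_seq // IH; last exact: (Rop_smooth Uopen eps0 gmat_smooth gmat_sig).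
congr (coef_seq (Rchain gr j _ _)).
by rewrite /chain_index doubleS -addn2 natrD; ring.
Qed.

Definition psi_seq := coef_seq (fun z => - 2 * drho (wden gr) z).

Let sw := wden_smooth Uopen eps0 gmat_smooth gmat_sig.

Lemma psi_smooth : smooth_on Om (fun z => - 2 * drho (wden gr) z).
Proof. by apply: smoothZ => //; exact: smooth_partial. Qed.

Lemma psi_seq_smooth j : S (psi_seq j).
Proof. by apply: coef_seq_smooth; exact: psi_smooth. Qed.

(** Differentiation in [rho] takes degree a to a - 1 with factor - a/2, and the -2 in psi turns this
    into a; [4 ^+ a] converts powers of r^2 into powers of s. *)
Lemma psi_seqE a x : U x -> (0 < a)%N ->
  psi_seq a.-1 x = a%:R * 4 ^+ a * W2_loc gr a x.
Proof.
move=> Ux; case: a => // a _; rewrite /psi_seq /coef_seq restr_toE //.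
rewrite (rho_coefZ Uopen eps0 _ _ (smooth_partial _ sw) Ux) -rho_coefS.
rewrite (W2_locE Uopen eps0 gmat_smooth gmat_sig) //.
have e0 : (4 : R) ^+ a.+1 != 0 by rewrite expf_neq0 // pnatr_eq0.
move: (rho_coef _ _ _) (4 ^+ a.+1 : R) (a.+1%:R : R) e0 => r e b e0.
by field.
Qed.

Lemma wden_base x : U x -> wden gr (at_rho 0 x) = 1.
Proof.
move=> Ux; rewrite /wden gmat0E lsubmx_at divff ?sqrtr1 //.
exact: (det_gmat_neq0 gmat_sig (tube0 eps0 Ux)).
Qed.

(* Both cases of the definition of Q_2N apply the remaining N - 1 ambient
   Laplacians to the multiple of t^(N - n/2 - 2) wden^-1 d(wden)/drho. *)
Lemma iter_laplacian_chain N (a : R) x : U x ->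
  iter N (laplacian (gtilde gr))
    (fun y => amb_t y `^ (N.+1%:R - n%:R / 2 - 2) *
      (a * (dlog gr (rshift n ord0) (rsubmx y) / 2))) (amb_pt 1 x 0) =
  - a * chain Mres (chain_index R N.+1) N psi_seq 0%N x.
Proof.
move=> Ux.
have cx : cone U eps (amb_pt 1 x 0).
  split; first by rewrite /amb_t row_mxKl mxE eqxx ltr01.
  by rewrite row_mxKr; exact: tube0.
(* As d_rho w = (w/4) [dlog], the given factor a [dlog] / 2 equals [Fa / wden], with [Fa] the
   multiple - a of psi. *)
pose Fa z : R := - a * (- 2 * drho (wden gr) z).
have sFa : smooth_on Om Fa by apply: smoothZ => //; exact: psi_smooth.
rewrite (@iter_laplacian_eq _ _ U eps Uopen gr N _ (fun y =>
  amb_t y `^ (N.+1%:R - n%:R / 2 - 2) * (Fa (rsubmx y) / wden gr (rsubmx y)))) //; last first.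
  move=> y [_ Oy]; congr (_ * _); rewrite /Fa (drho_wden Uopen eps0 gmat_smooth gmat_sig) //.
  have w0 := wden_neq0 eps0 gmat_sig Oy.
  by field.
rewrite (iter_laplacian_powR Uopen eps0 gmat_smooth gmat_sym gmat_sig) //.
have -> : amb_t (amb_pt 1 x 0) = 1 by rewrite /amb_t row_mxKl mxE eqxx.
have -> : rsubmx (amb_pt 1 x 0) = at_rho 0 x by rewrite row_mxKr.
rewrite powR1 mul1r wden_base // divr1.
(* Here [N.+1] is the order of the Q-curvature and one Laplacian has been spent: k = N - 1 = 2 N -
   (N+1) is the index of the next factor. *)
have -> : N.+1%:R - n%:R / 2 - 2 + n%:R / 2 = chain_index R N.+1 N.
  by rewrite /chain_index -addnn -addn1 !natrD; ring.
rewrite -rho_coef0 -(restr_toE _ Ux) -/(coef_seq _ 0%N) -chain_coef_seq //.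
have -> : coef_seq Fa = (fun j => - a *: psi_seq j).
  apply/funext => j; apply/funext => y.
  have -> : (- a *: psi_seq j) y = - a * psi_seq j y by [].
  case: (boolP (y \in U)) => [/set_mem Uy|yU]; last first.
    by rewrite /psi_seq /coef_seq /restr_to (negPf yU) mulr0.
  rewrite /psi_seq /coef_seq !restr_toE //.
  by rewrite (rho_coefZ Uopen eps0 _ _ psi_smooth).
by rewrite (chainZ S0 SD SZ Sm mZ) //; exact: psi_seq_smooth.
Qed.

Lemma Lop_cst1 (gamma : R) z :
  Lop gr gamma (fun=> 1) z = gamma * (dlog gr (rshift n ord0) z / 2).
Proof.
have d0 (e : 'I_(n + 1)) : partial e (fun=> 1 : R) = (fun=> 0 : R).
  by apply/funext => y; rewrite partial_cst.
have l0 : lap gr (fun=> 1) z = 0.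
  rewrite /lap big1 // => i _; rewrite big1 // => j _.
  rewrite d0 partial_cst big1 ?subr0 ?mulr0 // => k _.
  by rewrite d0 mulr0.
by rewrite /Lop l0 d0 partial_cst; ring.
Qed.

(** The two cases differ only in the scalar [a] produced by the first Laplacian: 1 from log t, whose
    sign meets the minus sign in the definition, and N - n/2 from the power of t, cancelled up to
    that sign by the denominator n/2 - N. *)
Lemma Q2_loc_chain N x : (0 < N)%N -> U x ->
  (-1) ^+ N * Q2_loc gr N x = chain Mres (chain_index R N) N.-1 psi_seq 0%N x.
Proof.
case: N => // N _ Ux; rewrite /Q2_loc /=.
have cx : cone U eps (amb_pt 1 x 0).
  split; first by rewrite /amb_t row_mxKl mxE eqxx ltr01.
  by rewrite row_mxKr; exact: tube0.
have sgn (b : R) : (-1) ^+ N.+1 * ((-1) ^+ N.+1 * b) = b.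
  by rewrite mulrA -expr2 sqrr_sign mul1r.
case: eqP => [Nn|Nn].
  have gam : N.+1%:R - n%:R / 2 = 0 :> R by rewrite -Nn -muln2 natrM; field.
  rewrite sgn /amb_power iterSr.
  rewrite (@iter_laplacian_eq _ _ U eps Uopen gr N _ (fun y =>
    amb_t y `^ (N.+1%:R - n%:R / 2 - 2) *
      (1 * (dlog gr (rshift n ord0) (rsubmx y) / 2)))) //; last first.
    move=> y cy; rewrite gam mul1r.
    exact: (laplacian_ln Uopen gmat_smooth gmat_sym gmat_sig).
  by rewrite iter_laplacian_chain // mulN1r opprK.
have gam : n%:R / 2 - N.+1%:R != 0 :> R.
  rewrite subr_eq0; apply/eqP => h; apply: Nn; apply/eqP.
  by rewrite -(eqr_nat R) -muln2 natrM -h divfK // pnatr_eq0.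
rewrite -mulrA sgn /P2_loc /amb_power iterSr.
rewrite (@iter_laplacian_eq _ _ U eps Uopen gr N _ (fun y =>
    amb_t y `^ (N.+1%:R - n%:R / 2 - 2) *
      ((N.+1%:R - n%:R / 2) * (dlog gr (rshift n ord0) (rsubmx y) / 2)))) //; last first.
  move=> y cy.
  rewrite (laplacian_powR Uopen gmat_smooth gmat_sym gmat_sig _ (smooth_cst Om_open 1) cy).
  by rewrite Lop_cst1.
by rewrite iter_laplacian_chain // opprB mulrAC divff // mul1r.
Qed.

Lemma Q2_loc_comp_sum N x : (0 < N)%N -> U x ->
  (-1) ^+ N * Q2_loc gr N x =
  \sum_(k < N) \sum_(I : k.-tuple 'I_N.+1)
    \sum_(a < N.+1 | is_composition N (rcons (map val I) a))
      N.-1`!%:R ^+ 2 * (comp_weight R N (map val I) a *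
        comp_op Mres psi_seq (map val I) a x).
Proof.
move=> N0 Ux; rewrite Q2_loc_chain //.
rewrite (chain_comp_sum S0 SD SZ Sm mD mZ psi_seq_smooth N0).
have -> : (N.-1`!%:R ^+ 2 *: comp_sum Mres N psi_seq N) x =
  N.-1`!%:R ^+ 2 * comp_sum Mres N psi_seq N x by [].
rewrite /comp_sum sum_fun_apply mulr_sumr; apply: eq_bigr => k _.
rewrite /comp_sum_len sum_fun_apply mulr_sumr; apply: eq_bigr => I _.
by rewrite sum_fun_apply mulr_sumr; apply: eq_bigr.
Qed.

Lemma comp_op_smooth I a : smooth_on U (comp_op Mres psi_seq I a).
Proof. exact: (comp_op_S Sm psi_seq_smooth). Qed.

(** Bridge between [M2_loc], applied to functions pulled back from the manifold, and [Mres], applied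
    to functions cut off outside [U]; equality on [U] suffices since [U] is open and the operator is
    differential. *)
Lemma M2_loc_scaled g (u : 'rV[R]_n -> R) v (a : R) c x :
  (forall y, U y -> gr 0 y = g y) -> (forall y, U y -> u y = a * v y) ->
  smooth_on U v -> U x ->
  M2_loc g gr c.+1 u x = a * (c`!%:R ^+ 2 * Mres c v x).
Proof.
move=> gE uv sv Ux.
have sav := smoothZ Uopen a sv.
have su : smooth_on U u by apply: (smooth_eq Uopen) sav => y /uv.
rewrite (M2_locE Uopen eps0 gmat_smooth gmat_sym gmat_sig gE) //.
rewrite (rho_coef_Mlift Uopen eps0 gmat_smooth gmat_sig) //.
rewrite (Mcoef_eq c uv Ux) (McoefZ Uopen eps0 gmat_smooth gmat_sig) //.
by rewrite /Mres restr_toE // mulrCA.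
Qed.

End LocalFormula.

(** The first factor on the left rewrites M_2i and W_2a in terms of [Mres] and [psi_seq]. Its
    (i-1)!^2 cancel those of n_(I,a) for the entries of I, and for the last entry a! (a-1)! /
    (a-1)!^2 = a and 2^(2a) = 4^a cancel its denominator. *)
Lemma nI_rcons (R : realFieldType) (N : nat) (I : seq nat) (a : nat) :
  (0 < a)%N -> sumn (rcons I a) = N ->
  (\prod_(i <- I) (i.-1`!%:R : R) ^+ 2) / (a%:R * 4 ^+ a) *
    (a`!%:R * a.-1`!%:R * 2 ^+ a.*2 *
     ((sumn (rcons I a)).-1`!%:R ^+ 2 *
      \prod_(i <- rcons I a) (i.-1`!%:R ^+ 2)^-1 *
      \prod_(1 <= j < size (rcons I a))
        ((sumn (take j (rcons I a)))%:R * (sumn (drop j (rcons I a)))%:R)^-1)) =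
  N.-1`!%:R ^+ 2 * comp_weight R N I a.
Proof.
move=> a0 sN; rewrite (comp_weight_prod R sN) sN -[in \prod_(i <- rcons I a) _]cats1.
rewrite big_cat big_seq1 /= prodfV.
set P := \prod_(i <- I) _; set Q := \prod_(1 <= j < _) _.
have P0 : P != 0.
  by rewrite prodf_seq_neq0; apply/allP => i _ /=; rewrite expf_neq0 // pnatr_eq0 -lt0n fact_gt0.
have f0 : a.-1`!%:R != 0 :> R by rewrite pnatr_eq0 -lt0n fact_gt0.
have aE : a`!%:R = a%:R * a.-1`!%:R :> R.
  by rewrite -{1}(prednK a0) factS natrM prednK.
have a0' : a%:R != 0 :> R by rewrite pnatr_eq0 -lt0n.
have -> : (2 : R) ^+ a.*2 = 4 ^+ a.
  by rewrite -mul2n exprM; congr (_ ^+ _); ring.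
have e0 : (4 : R) ^+ a != 0 by rewrite expf_neq0 // pnatr_eq0.
rewrite aE; move: (a.-1`!%:R : R) (a%:R : R) (4 ^+ a : R) f0 a0' e0 => f b e f0 b0 e0.
by move: (N.-1`!%:R : R) => w; field; rewrite f0 b0 e0 P0.
Qed.

(** * From the chart to the manifold *)

Section OnChart.
Variables (R : realType) (n p q : nat) (M : manifold R n) (g : tensor2 M).
Variables (eps : R) (gr : R -> tensor2 M).
Hypothesis hgr : poincare_normal_form p q g eps gr.
Variable c : mindex M.

Notation C := (mchart c).
Notation U := (cimg C).
Notation grc := (gr^~ c).
Notation Om := (tube U eps).

Lemma chart_gmat_smooth i j : smooth_on Om (fun z => gmat grc z i j).
Proof. by case: hgr => _ [_ sm] _ _; exact: sm. Qed.

Lemma chart_gmat_sym z : Om z -> (gmat grc z)^T = gmat grc z.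
Proof.
case: hgr => _ [fam _] _ _ [Uz ez].
by have [_ /(_ c _ Uz) [-> _] _] := fam _ ez.
Qed.

Lemma chart_gmat_sig z : Om z -> has_signature p q (gmat grc z).
Proof.
case: hgr => _ [fam _] _ _ [Uz ez].
by have [_ /(_ c _ Uz) [_ ?] _] := fam _ ez.
Qed.

Lemma cmap_cinv y : U y -> cmap C (cinv C y) = y.
Proof. by move=> [x Cx <-]; rewrite cmapK. Qed.

(** Each [M2] composes with [cinv] before acting and with [cmap] afterwards; these cancel on the
    image of the chart. The induction is over all of [U], since the next operator differentiates the
    previous result. *)
Lemma M2_comp_chart I a y : all (leq 1) I -> (0 < a)%N -> U y ->
  M2_comp g gr c I (W2 gr c a) (cinv C y) =
  (\prod_(i <- I) i.-1`!%:R ^+ 2) / (a%:R * 4 ^+ a) *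
  comp_op (Mres U grc) (psi_seq U grc) I a y.
Proof.
case: hgr => eps0 _ gE _ => + a0.
have Uopen : open U := @cimg_open _ _ _ C.
elim: I y => [|i I IH] y /=.
  move=> _ Uy; rewrite big_nil /comp_op /= /W2 cmap_cinv //.
  rewrite (psi_seqE Uopen eps0 chart_gmat_smooth chart_gmat_sig Uy a0).
  have a0' : a%:R != 0 :> R by rewrite pnatr_eq0 -lt0n.
  have e0 : (4 : R) ^+ a != 0 by rewrite expf_neq0 // pnatr_eq0.
  move: (a%:R : R) (4 ^+ a : R) (W2_loc _ _ _) a0' e0 => b e w b0 e0.
  by field; rewrite b0 e0.
move=> /andP[i0 aI] Uy; rewrite {1}/M2 cmap_cinv //.
case: i i0 => // i _.
rewrite (M2_loc_scaled Uopen eps0 chart_gmat_smooth chart_gmat_sym chart_gmat_sig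
  i (gE c) (fun y Uy => IH y aI Uy) _ Uy); last first.
  exact: (comp_op_smooth Uopen eps0 chart_gmat_smooth chart_gmat_sig).
by rewrite big_cons /comp_op /=; ring.
Qed.

End OnChart.

Theorem theorem1p3 (R : realType) (n p q : nat) (hn : (3 <= n)%N)
    (M : manifold R n) (g : tensor2 M) (hg : is_metric p q g)
    (eps : R) (gr : R -> tensor2 M) (hgr : poincare_normal_form p q g eps gr)
    (N : nat) (hN : (1 <= N)%N) (hNn : ~~ odd n -> (N.*2 <= n)%N)
    (c : mindex M) (x : M) (hx : cdom (mchart c) x) :
  (-1) ^+ N * Q2 gr c N x =
    sum_compositions N (fun I a =>
      nI R (rcons I a) * a`!%:R * a.-1`!%:R * 2 ^+ a.*2 *
      M2_comp g gr c I (W2 gr c a) x).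
Proof.
have [eps0 _ _ _] := hgr.
have Ux : cimg (mchart c) (cmap (mchart c) x) by exists x.
have Uopen : open (cimg (mchart c)) := @cimg_open _ _ _ (mchart c).
rewrite /Q2 (Q2_loc_comp_sum Uopen eps0 (chart_gmat_smooth hgr c)
  (@chart_gmat_sym _ _ _ _ _ _ _ _ hgr c) (@chart_gmat_sig _ _ _ _ _ _ _ _ hgr c) hN Ux).
rewrite /sum_compositions; apply: eq_bigr => k _; apply: eq_bigr => I _.
apply: eq_bigr => a /andP[]; rewrite all_rcons => /andP[a0 aI] /eqP sN.
(* The point [x] is rewritten as [cinv] of its coordinates, the form in which the composition has
   been computed. *)
rewrite -[in RHS](cmapK hx) (M2_comp_chart hgr aI a0 Ux) mulrA -(nI_rcons R a0 sN) /nI.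
by ring.
Qed.
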